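(* Assume the global noise law, the edge condition, and the holomorphic subspace local law (all defined in the context). Let $C_n\subset\{1,\dots,r_n\}$ be a cluster separated from all other deterministic outlier locations by a stable contour: there is a stable compact finite union of intervals $J\subset(b,\infty)$ with stable contour $\Gamma$ such that $\{i:\rho(\theta_{n,i})\in J\}=C_n$; assume weighted compatibility on a compact neighborhood of $\Gamma$. Suppose $$\max_{i\in C_n}|\theta_{n,i}-\theta|\to0$$ for some $\theta>\theta_\star$. Let $q_n=|C_n|$, let $U_{C_n},V_{C_n}$ be the matrices of columns of $U_n,V_n$ with indices in $C_n$, and let $\widehat U_{C_n}$ and $\widehat V_{C_n}$ be paired left and right singular-vector matrices for the singular values of $W_n$ enclosed by the contour, with the same orthogonal or unitary change of basis applied on the two sides inside every repeated singular-value block. Then there exists a random $q_n\times q_n$ orthogonal (if $\mathbb F=\mathbb R$) or unitary (if $\mathbb F=\mathbb C$) matrix $Q_n$ such that, in probability, $$\|U_{C_n}^*\widehat U_{C_n}-\sqrt{\kappa_{\mathrm L}(\theta)}\,Q_n\|_{\mathrm{op}}\to0,\qquad\|V_{C_n}^*\widehat V_{C_n}-\sqrt{\kappa_{\mathrm R}(\theta)}\,Q_n\|_{\mathrm{op}}\to0.$$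
   Context: Setting. $\mathbb F\in\{\mathbb R,\mathbb C\}$; for each $n$, $m=m(n)\ge n$ is an integer and $n/m\to c\in(0,1]$. $X_n$ is a random $n\times m$ matrix over $\mathbb F$; $P_n$ is an $n\times m$ matrix of rank $r_n$ (deterministic, or random on the same probability space; neither independence from $X_n$ nor any rank restriction is assumed); $W_n=X_n+P_n$. With $\mathrm{St}(N,r)=\{Q\in\mathbb F^{N\times r}:Q^*Q=I_r\}$, fix $P_n=U_n\Theta_nV_n^*$, $U_n\in\mathrm{St}(n,r_n)$, $V_n\in\mathrm{St}(m,r_n)$, $\Theta_n=\operatorname{diag}(\theta_{n,1},\dots,\theta_{n,r_n})$, $\theta_{n,1}\ge\dots\ge\theta_{n,r_n}>0$. Left/right singular vectors are paired: $W_n\widehat v=\sigma\widehat u$, $W_n^*\widehat u=\sigma\widehat v$. With probability tending to one exactly $q_n$ singular values of $W_n$ lie in $J$, so that $\widehat U_{C_n},\widehat V_{C_n}$ have $q_n$ columns; the statement is understood on that event. Global noise law. There is a compactly supported probability measure $\mu$ on $[0,\infty)$ such that the empirical spectral measure of $X_nX_n^*$ converges weakly to $\mu$ in probability and $\|X_n\|_{\mathrm{op}}\to b:=\sqrt{\sup\operatorname{supp}\mu}$ in probability. Transforms. For $\zeta\in\mathbb C\setminus[-b,b]$: $\phi(\zeta)=\int\frac{\zeta}{\zeta^2-x}\,\mu(dx)$, $\widetilde\phi(\zeta)=c\,\phi(\zeta)+\frac{1-c}{\zeta}$, $d(\zeta)=\phi(\zeta)\widetilde\phi(\zeta)$ (positive,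 strictly decreasing on $(b,\infty)$). Edge condition. $d(b+):=\lim_{z\downarrow b}d(z)\in(0,\infty)$. Put $\theta_\star=d(b+)^{-1/2}$; $\rho(\theta)=d^{-1}(\theta^{-2})\in(b,\infty)$ for $\theta>\theta_\star$ and $\rho(\theta)=b$ for $0\le\theta\le\theta_\star$. The deterministic locations are the numbers $\rho(\theta_{n,i})$. Overlap weights. For $\theta>\theta_\star$, $\rho=\rho(\theta)$: $\kappa_{\mathrm L}(\theta)=-\frac{2\phi(\rho)}{\theta^2d'(\rho)}$, $\kappa_{\mathrm R}(\theta)=-\frac{2\widetilde\phi(\rho)}{\theta^2d'(\rho)}$. Linearization. $\mathcal X_n=\begin{pmatrix}0&X_n\\ X_n^*&0\end{pmatrix}$, $\mathcal E_n=\begin{pmatrix}U_n&0\\0&V_n\end{pmatrix}$, $\mathcal K_n=\begin{pmatrix}0&\Theta_n\\\Theta_n&0\end{pmatrix}$, $\mathcal G_n(\zeta)=\mathcal E_n^*(\zeta I-\mathcal X_n)^{-1}\mathcal E_n$, $\mathcal M(\zeta)=\begin{pmatrix}\phi(\zeta)I_{r_n}&0\\0&\widetilde\phi(\zeta)I_{r_n}\end{pmatrix}$. Holomorphic subspace local law. For every compact $K\subset\mathbb C\setminus[-b,b]$ there is a deterministic sequence $\varepsilon_n(K)\to0$ such that, with probability tending to one, $\sup_{\zeta\in K}\|\mathcal G_n(\zeta)-\mathcal M(\zeta)\|_{\mathrm{op}}\le\varepsilon_n(K)$. Weighted compatibility on a compact $K\subset\mathbb C\setminus[-b,b]$: $\sup_{\zeta\in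 K}\big(\|(\mathcal G_n(\zeta)-\mathcal M(\zeta))\mathcal K_n\|_{\mathrm{op}}+\|\mathcal K_n(\mathcal G_n(\zeta)-\mathcal M(\zeta))\|_{\mathrm{op}}\big)\to0$ in probability. (Suprema are $+\infty$ if $\mathcal G_n$ is undefined somewhere on $K$.) Stability. A contour $\Gamma$ (fixed positively oriented finite union of rectifiable Jordan curves, $\Omega_\Gamma$ the union of their interiors) is stable if $\overline{\Omega_\Gamma}$ is a compact subset of $\mathbb C\setminus[-b,b]$, it encloses a specified subset of the positive roots $\rho(\theta_{n,i})$ ($\theta_{n,i}>\theta_\star$), and $\sup_n\sup_{\zeta\in\Gamma}\|(I_{2r_n}-\mathcal M(\zeta)\mathcal K_n)^{-1}\|_{\mathrm{op}}<\infty$. A compact finite union $J\subset(b,\infty)$ of intervals (of positive length) is stable if the deterministic locations stay a fixed positive distance from $\partial J$ and there is a stable $\Gamma$ with $\Omega_\Gamma\cap\mathbb R=\operatorname{int}J$ whose enclosed positive roots are exactly those in $J$. If $\Theta_n$ is random, the separation and the inverse bound are required (with fixed constants and deterministic $\Gamma$) on events of probability tending to one, and conclusions are understood on those events. *)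

(* Defs.v *)
From HB Require Import structures.
From mathcomp Require Import all_boot all_order all_algebra.
From mathcomp Require Import spectral.
From mathcomp Require Import all_classical all_reals all_analysis.
From mathcomp Require Import complex.

Set Implicit Arguments.
Unset Strict Implicit.
Unset Printing Implicit Defensive.

Import Order.TTheory GRing.Theory Num.Theory.
Import numFieldNormedType.Exports.

Local Open Scope classical_set_scope.
Local Open Scope ring_scope.
Local Open Scope complex_scope.
Local Open Scope sesquilinear_scope.

(* Every matrix has entries in R[i]; the choice of the base field is a
   constraint on the entries. A unitary matrix over the reals is orthogonal,
   and the operator norm of a real matrix is the same over R and over R[i]. *)
Inductive base_field := over_reals | over_complexes.

Definition entries_in {R : realType} (F : base_field) {p q : nat}
    (A : 'M[R[i]]_(p, q)) : Prop :=
  match F with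
  | over_reals => forall i j, complex.Im (A i j) = 0
  | over_complexes => True
  end.

Section matrices.
Context {R : realType}.
Local Notation C := R[i].

Definition cabs (z : C) : R := ComplexField.Normc.normc z.

Definition l2norm {p : nat} (v : 'cV[C]_p) : R :=
  Num.sqrt (\sum_i cabs (v i 0) ^+ 2).

Definition opnorm {p q : nat} (A : 'M[C]_(p, q)) : R :=
  sup [set l2norm (A *m v) | v in [set v : 'cV[C]_q | l2norm v <= 1]].

Definition cmx {p q : nat} (A : 'M[R]_(p, q)) : 'M[C]_(p, q) :=
  map_mx (real_complex R) A.

(* [Q \in St(p, q)] *)
Definition stiefel (F : base_field) {p q : nat} (Q : 'M[C]_(p, q)) : Prop :=
  entries_in F Q /\ Q^t* *m Q = 1%:M.

Definition columns {p q : nat} (A : 'M[C]_(p, q)) (I : {set 'I_q}) :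
    'M[C]_(p, #|I|) :=
  colsub (@enum_val _ (mem I)) A.

(* [spectral_diag A] lists the eigenvalues of a normal matrix [A] with
   multiplicity; they are real when [A] is Hermitian. *)
Definition heigval {p : nat} (A : 'M[C]_p) (k : 'I_p) : R :=
  complex.Re (spectral_diag A 0 k).

Definition esm {p : nat} (A : 'M[C]_p) : {measure set R -> \bar R} :=
  mscale (p%:R^-1)%:nng
    (msum (fun k => \d_(nth 0 [seq heigval A j | j <- enum 'I_p] k)) p).

(* The [p] singular values, with multiplicity, of a [p x q] matrix, [p <= q]. *)
Definition singval {p q : nat} (W : 'M[C]_(p, q)) (k : 'I_p) : R :=
  Num.sqrt (heigval (W *m W^t*) k).

Definition nb_singval {p q : nat} (W : 'M[C]_(p, q)) (J : set R) : nat :=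
  #|[pred k : 'I_p | `[< J (singval W k) >]]|.

(* Since the same [s] is used on both sides, the freedom left in [(Uh, Vh)] is
   a permutation of the pairs and, inside a repeated positive singular value, a
   common unitary change of basis. When [nb_singval W J = q] and [J] contains
   only positive numbers, [s] lists all the singular values of [W] in [J]. *)
Definition paired_singular (F : base_field) {p q k : nat}
    (W : 'M[C]_(p, q)) (J : set R)
    (Uh : 'M[C]_(p, k)) (Vh : 'M[C]_(q, k)) : Prop :=
  [/\ stiefel F Uh, stiefel F Vh &
      exists s : 'rV[R]_k,
        [/\ forall j, J (s 0 j),
            W *m Vh = Uh *m diag_mx (cmx s) &
            W^t* *m Uh = Vh *m diag_mx (cmx s)]].

Definition thin_svd (F : base_field) {p q k : nat} (P : 'M[C]_(p, q))
    (U : 'M[C]_(p, k)) (th : 'rV[R]_k) (V : 'M[C]_(q, k)) : Prop :=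
  [/\ stiefel F U, stiefel F V,
      forall i j : 'I_k, (i <= j)%N -> th 0 j <= th 0 i,
      forall i, 0 < th 0 i &
      P = U *m diag_mx (cmx th) *m V^t*].

End matrices.

Section probability.
Context {d : measure_display} {T : measurableType d} {R : realType}.
Variable Pr : probability T R.
Local Notation C := R[i].

(* With probability tending to one. For measurable [A n] this says
   [Pr (A n) --> 1]; in general it bounds the inner probability. *)
Definition whp (A : nat -> T -> Prop) : Prop :=
  exists E : nat -> set T,
    [/\ forall n, measurable (E n),
        forall n, E n `<=` A n &
        Pr (E n) @[n --> \oo] --> 1%E].

Definition cvg_in_prob (Y : nat -> T -> R) (l : R) : Prop :=
  forall e : R, 0 < e -> whp (fun n w => `|Y n w - l| < e).

Definition entry {p q : nat} (A : 'M[C]_(p, q)) (i j : nat) : C :=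
  match insub i, insub j with
  | Some i', Some j' => A i' j'
  | _, _ => 0
  end.

(* Random matrix of possibly random size: measurability of the size and of the
   entries of its extension by zeros to an infinite array. *)
Definition random_mx (p q : T -> nat) (A : forall w, 'M[C]_(p w, q w)) : Prop :=
  [/\ forall k, measurable [set w | p w = k],
      forall k, measurable [set w | q w = k],
      forall i j, measurable_fun setT (fun w => complex.Re (entry (A w) i j)) &
      forall i j, measurable_fun setT (fun w => complex.Im (entry (A w) i j))].

Definition random_index_set (p : T -> nat) (I : forall w, {set 'I_(p w)}) :
    Prop :=
  forall k : nat, measurable [set w | exists2 i, i \in I w & nat_of_ord i = k].

End probability.

Section transforms.
Context {R : realType}.
Local Notation C := R[i].

Definition msupport (mu : {measure set R -> \bar R}) : set R :=
  [set x | forall A : set R, open A -> A x -> (0 < mu A)%E].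

Definition bulk_edge (mu : {measure set R -> \bar R}) : R :=
  Num.sqrt (sup (msupport mu)).

(* The segment [[-b, b]] of the complex plane. *)
Definition cut_segment (b : R) : set C^o :=
  [set z | complex.Im z = 0 /\ `|complex.Re z| <= b].

Section with_law.
Variables (mu : {measure set R -> \bar R}) (c : R).
Local Notation b := (bulk_edge mu).

Definition phi (z : C) : C :=
  (\int[mu]_x complex.Re (z / (z ^+ 2 - x%:C))) +i*
  (\int[mu]_x complex.Im (z / (z ^+ 2 - x%:C))).

Definition phit (z : C) : C := c%:C * phi z + (1 - c)%:C / z.

Definition dtrans (z : C) : C := phi z * phit z.

(* On the real half-line beyond [b] the three transforms are real. *)
Definition phiR (x : R) : R := complex.Re (phi x%:C).
Definition phitR (x : R) : R := complex.Re (phit x%:C).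
Definition dR (x : R) : R := complex.Re (dtrans x%:C).

Definition d_edge : R := lim (dR x @[x --> b^'+]).

Definition edge_condition : Prop :=
  cvg (dR x @[x --> b^'+]) /\ 0 < d_edge.

Definition theta_star : R := (Num.sqrt d_edge)^-1.

Definition rho (t : R) : R :=
  if theta_star < t
  then xget b [set z | b < z /\ dR z = t ^- 2]
  else b.

Definition kappaL (t : R) : R :=
  - (2 * phiR (rho t)) / (t ^+ 2 * derive1 dR (rho t)).
Definition kappaR (t : R) : R :=
  - (2 * phitR (rho t)) / (t ^+ 2 * derive1 dR (rho t)).

End with_law.
End transforms.

Section linearization.
Context {R : realType}.
Local Notation C := R[i].

Definition linX {p q : nat} (X : 'M[C]_(p, q)) : 'M[C]_(p + q) :=
  block_mx 0 X (X^t*) 0.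

Definition linE {p q k : nat} (U : 'M[C]_(p, k)) (V : 'M[C]_(q, k)) :
    'M[C]_(p + q, k + k) :=
  block_mx U 0 0 V.

Definition linK {k : nat} (th : 'rV[R]_k) : 'M[C]_(k + k) :=
  block_mx 0 (diag_mx (cmx th)) (diag_mx (cmx th)) 0.

Definition resolvent_defined {p q : nat} (X : 'M[C]_(p, q)) (z : C) : Prop :=
  z%:M - linX X \in unitmx.

Definition linG {p q k : nat} (X : 'M[C]_(p, q)) (U : 'M[C]_(p, k))
    (V : 'M[C]_(q, k)) (z : C) : 'M[C]_(k + k) :=
  (linE U V)^t* *m invmx (z%:M - linX X) *m linE U V.

Definition linM (mu : {measure set R -> \bar R}) (c : R) (k : nat) (z : C) :
    'M[C]_(k + k) :=
  block_mx (phi mu z)%:M 0 0 (phit mu c z)%:M.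

(* Supremum over [K] of a function which is only defined on [D]. *)
Definition sup_on (K : set C^o) (D : C -> Prop) (f : C -> R) : \bar R :=
  ereal_sup [set (if `[< D z >] then (f z)%:E else +oo%E) | z in K].

Definition law_gap (mu : {measure set R -> \bar R}) (c : R) {p q k : nat}
    (X : 'M[C]_(p, q)) (U : 'M[C]_(p, k)) (V : 'M[C]_(q, k)) (K : set C^o) :
    \bar R :=
  sup_on K (resolvent_defined X)
    (fun z => opnorm (linG X U V z - linM mu c k z)).

Definition weighted_gap (mu : {measure set R -> \bar R}) (c : R) {p q k : nat}
    (X : 'M[C]_(p, q)) (U : 'M[C]_(p, k)) (th : 'rV[R]_k) (V : 'M[C]_(q, k))
    (K : set C^o) : \bar R :=
  sup_on K (resolvent_defined X)
    (fun z => opnorm ((linG X U V z - linM mu c k z) *m linK th)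
            + opnorm (linK th *m (linG X U V z - linM mu c k z))).

End linearization.

Section contours.
Context {R : realType}.
Local Notation C := R[i].

Definition curve_trace (g : R -> C^o) : set C^o := [set g t | t in `[0, 1]].

Definition rectifiable_jordan (g : R -> C^o) : Prop :=
  [/\ {within `[0, 1], continuous g}, g 0 = g 1,
      {in `[0, 1[ &, injective g} &
      exists L : R, forall s : seq R, itv_partition 0 1 s ->
        \sum_(0 <= k < size s)
          cabs (g (nth 1 (0 :: s) k.+1) - g (nth 1 (0 :: s) k)) <= L].

Definition jordan_interior (g : R -> C^o) : set C^o :=
  [set z | ~ curve_trace g z /\
    exists M : R, forall w,
      connected_component (~` curve_trace g) z w -> cabs w <= M].

(* Winding number one about every interior point, through a continuous
   argument [a] along the curve. *)
Definition positively_oriented (g : R -> C^o) : Prop :=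
  forall z, jordan_interior g z ->
    exists a : R -> R,
      [/\ {within `[0, 1], continuous a},
          forall t, t \in `[0, 1] ->
            g t - z = (cabs (g t - z))%:C * (cos (a t) +i* sin (a t)) &
          a 1 = a 0 + 2 * pi].

Definition is_contour {N : nat} (g : 'I_N -> R -> C^o) : Prop :=
  forall k, rectifiable_jordan (g k) /\ positively_oriented (g k).

Definition contour_set {N : nat} (g : 'I_N -> R -> C^o) : set C^o :=
  \bigcup_k curve_trace (g k).

Definition Omega {N : nat} (g : 'I_N -> R -> C^o) : set C^o :=
  \bigcup_k jordan_interior (g k).

End contours.

Section assumptions.
Context {d : measure_display} {T : measurableType d} {R : realType}.
Variable Pr : probability T R.
Local Notation C := R[i].

Definition global_noise_law (mu : probability R R) (m : nat -> nat)
    (X : forall n, T -> 'M[C]_(n, m n)) : Prop :=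
  [/\ mu `[0, +oo[%classic = 1%E, compact (msupport mu),
      forall f : R -> R, continuous f -> (exists B, forall x, `|f x| <= B) ->
        cvg_in_prob Pr (fun n w => \int[esm (X n w *m (X n w)^t*)]_x f x)
          (\int[mu]_x f x) &
      cvg_in_prob Pr (fun n w => opnorm (X n w)) (bulk_edge mu)].

Section subspaces.
Variables (mu : {measure set R -> \bar R}) (c : R) (m : nat -> nat).
Variable X : forall n, T -> 'M[C]_(n, m n).
Variable r : nat -> T -> nat.
Variable U : forall n w, 'M[C]_(n, r n w).
Variable theta : forall n w, 'rV[R]_(r n w).
Variable V : forall n w, 'M[C]_(m n, r n w).
Local Notation b := (bulk_edge mu).

Definition subspace_local_law : Prop :=
  forall K : set C^o, compact K -> K `<=` ~` cut_segment b ->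
    exists eps : nat -> R, eps n @[n --> \oo] --> (0 : R) /\
      whp Pr (fun n w =>
        (law_gap mu c (X n w) (U n w) (V n w) K <= (eps n)%:E)%E).

Definition weighted_compatibility (K : set C^o) : Prop :=
  forall e : R, 0 < e -> whp Pr (fun n w =>
    (weighted_gap mu c (X n w) (U n w) (theta n w) (V n w) K <= e%:E)%E).

Definition stable_contour {N : nat} (g : 'I_N -> R -> C^o) : Prop :=
  [/\ is_contour g, compact (closure (Omega g)),
      closure (Omega g) `<=` ~` cut_segment b &
      exists B : R, whp Pr (fun n w => forall z, contour_set g z ->
        let A := 1%:M - linM mu c (r n w) z *m linK (theta n w) in
        A \in unitmx /\ opnorm (invmx A) <= B)].

Definition interval_union (J : set R) : Prop :=
  exists s : seq (R * R),
    (forall p, p \in s -> b < p.1 /\ p.1 < p.2) /\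
    J = \bigcup_(p in [set` s]) `[p.1, p.2]%classic.

(* [J] is stable, as witnessed by the stable contour [g]. *)
Definition stable_union (J : set R) {N : nat} (g : 'I_N -> R -> C^o) : Prop :=
  [/\ interval_union J,
      exists2 del : R, 0 < del & whp Pr (fun n w =>
        forall i x, (closure J `\` J°) x ->
          del <= `|rho mu c (theta n w 0 i) - x|),
      stable_contour g,
      forall x : R, Omega g x%:C <-> J° x &
      whp Pr (fun n w => forall i, theta_star mu c < theta n w 0 i ->
        (Omega g (rho mu c (theta n w 0 i))%:C <->
         J (rho mu c (theta n w 0 i))))].

End subspaces.
End assumptions.

(* Main.v *)
Require Import Defs.
From HB Require Import structures.
From mathcomp Require Import all_boot all_order all_algebra.
From mathcomp Require Import spectral.
From mathcomp Require Import all_classical all_reals all_analysis.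
From mathcomp Require Import complex.
From mathcomp Require Import ring lra.

Set Implicit Arguments.
Unset Strict Implicit.
Unset Printing Implicit Defensive.

Import Order.TTheory GRing.Theory Num.Theory.
Import numFieldNormedType.Exports.

Local Open Scope classical_set_scope.
Local Open Scope ring_scope.
Local Open Scope complex_scope.
Local Open Scope sesquilinear_scope.

(** Everything reduces to deterministic linear algebra, at real spectral parameters
   in [J], on an event of probability tending to one.

   A singular triple [(s, u, v)] of [W = X + U Theta V^*] solves
   [(s - calX) (u; v) = E y] with [y = K x] and [x = E^* (u; v)], where [calX] is
   the Hermitian dilation of [X]; hence [x = G(s) y].  The point is that [y] is
   bounded by [(s - calX) (u; v)], whatever the size of [Theta], so that the local
   law gives [x = M(s) y] up to a small error even though [x = M(s) K x] would not
   follow ([compressed_equation]).  Coordinatewise this reads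
   [(theta_i ^- 2 - d(s)) y_i = O(eps)], with constants that do not depend on the
   dimensions.

   - If no [theta_i ^- 2] is close to [d(s)] then [y = 0], which is absurd; as the
     indices outside the cluster are separated from [J], every singular value in
     [J] is close to [rho = rho(theta0)] ([outlier_location], [singular_location]).
   - Freezing [s] at [rho], an orthonormal family of pairs becomes a family of
     approximate solutions at one spectral parameter.  Outside the cluster [y] is
     negligible, and on the cluster [x] and [y] are fixed multiples of
     [a = U_C^* u]; in particular [V_C^* v] is a multiple of [a]
     ([overlap_right]).  The norm of [(u; v)] is
     [y^* E^* (rho - calX) ^- 2 E y], a divided difference of [G], hence of [M], at
     [rho]: it equals [- phi' |y_u|^2 - phit' |y_v|^2] up to a small error.  This
     turns [|(u; v)|^2 = 2 |alpha|^2] into [|a|^2 = kappa_L |alpha|^2]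
     ([overlap_gram]).
   - That identity makes [alpha |-> a] injective, so there are at most [q_n]
     singular values in [J].  If there were fewer, a forcing term [U_C s]
     orthogonal to their singular vectors would have a bounded response, although
     the cluster equations are resonant at [rho] ([forced_response]); so there are
     exactly [q_n] ([deterministic_cluster]).
   - [A = U_C^* Uh] is thus an approximate multiple of an isometry, and its polar
     factor is the required matrix; it is real when [A] is ([polar_factor]).
     Measurability is obtained by choosing the unitary matrix from a countable
     discretisation of the data ([measurable_best_unitary]).

   One small parameter [del] drives all the errors: the local law is used with
   precision [del ^+ 2], the cluster has radius [del], and the divided difference
   has step [del], so that every error is [O(del)]. *)

(** * The real inner product and the operator norm *)

Section inner_product.
Context {R : realType}.
Local Notation C := R[i].

(** Only the real part of the Hermitian product is kept: it gives the same norm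
   and makes all the estimates statements about a real Euclidean space. *)
Definition rdot {p : nat} (u v : 'cV[C]_p) : R :=
  complex.Re ((u^t* *m v) 0 0).

Lemma Re_sum (I : Type) (s : seq I) (Q : pred I) (f : I -> C) :
  complex.Re (\sum_(i <- s | Q i) f i) = \sum_(i <- s | Q i) complex.Re (f i).
Proof. by elim/big_rec2: _ => [|i y x _ <-] //; case: (f i) x => a b [c e]. Qed.

Lemma Im_sum (I : Type) (s : seq I) (Q : pred I) (f : I -> C) :
  complex.Im (\sum_(i <- s | Q i) f i) = \sum_(i <- s | Q i) complex.Im (f i).
Proof. by elim/big_rec2: _ => [|i y x _ <-] //; case: (f i) x => a b [c e]. Qed.

Lemma ReD (x y : C) : complex.Re (x + y) = complex.Re x + complex.Re y.
Proof. by case: x y => [a b] [e f]. Qed.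

Lemma ReZ (a : R) (x : C) : complex.Re (a%:C * x) = a * complex.Re x.
Proof. by case: x => [e f] /=; rewrite mul0r subr0. Qed.

Lemma rdotE p (u v : 'cV[C]_p) : rdot u v =
  \sum_i (complex.Re (u i 0) * complex.Re (v i 0)
          + complex.Im (u i 0) * complex.Im (v i 0)).
Proof.
rewrite /rdot mxE Re_sum; apply: eq_bigr => i _; rewrite !mxE.
by case: (u i 0) (v i 0) => [a b] [e f] /=; rewrite mulNr opprK.
Qed.

Lemma rdotC p (u v : 'cV[C]_p) : rdot u v = rdot v u.
Proof. by rewrite !rdotE; apply: eq_bigr => i _; ring. Qed.

Lemma rdotDr p (u v w : 'cV[C]_p) : rdot u (v + w) = rdot u v + rdot u w.
Proof. by rewrite /rdot mulmxDr mxE ReD. Qed.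

Lemma rdotDl p (u v w : 'cV[C]_p) : rdot (v + w) u = rdot v u + rdot w u.
Proof. by rewrite rdotC rdotDr !(rdotC u). Qed.

Lemma rdotZr p (a : R) (u v : 'cV[C]_p) : rdot u (a%:C *: v) = a * rdot u v.
Proof. by rewrite /rdot -scalemxAr mxE ReZ. Qed.

Lemma rdotZl p (a : R) (u v : 'cV[C]_p) : rdot (a%:C *: u) v = a * rdot u v.
Proof. by rewrite rdotC rdotZr rdotC. Qed.

Lemma rdotNr p (u v : 'cV[C]_p) : rdot u (- v) = - rdot u v.
Proof. by rewrite -scaleN1r -(rmorphN1 (real_complex R)) rdotZr mulN1r. Qed.

Lemma rdotNl p (u v : 'cV[C]_p) : rdot (- u) v = - rdot u v.
Proof. by rewrite rdotC rdotNr rdotC. Qed.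

Lemma rdotBr p (u v w : 'cV[C]_p) : rdot u (v - w) = rdot u v - rdot u w.
Proof. by rewrite rdotDr rdotNr. Qed.

Lemma rdotBl p (u v w : 'cV[C]_p) : rdot (v - w) u = rdot v u - rdot w u.
Proof. by rewrite rdotDl rdotNl. Qed.

Lemma adjmxM p q r (A : 'M[C]_(p, q)) (B : 'M[C]_(q, r)) :
  (A *m B)^t* = B^t* *m A^t*.
Proof. by rewrite trmx_mul map_mxM. Qed.

Lemma rdot_adj p q (A : 'M[C]_(p, q)) (u : 'cV[C]_q) (v : 'cV[C]_p) :
  rdot (A *m u) v = rdot u (A^t* *m v).
Proof. by rewrite /rdot adjmxM mulmxA. Qed.

Lemma rdot_col p q (u u' : 'cV[C]_p) (v v' : 'cV[C]_q) :
  rdot (col_mx u v) (col_mx u' v') = rdot u u' + rdot v v'.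
Proof.
rewrite !rdotE big_split_ord /=; congr (_ + _); apply: eq_bigr => i _;
  by rewrite ?col_mxEu ?col_mxEd.
Qed.

Lemma rdot_ge0 p (u : 'cV[C]_p) : 0 <= rdot u u.
Proof. by rewrite rdotE sumr_ge0// => i _; rewrite addr_ge0// -expr2 sqr_ge0. Qed.

Lemma cabs2 (z : C) : cabs z ^+ 2 = complex.Re z ^+ 2 + complex.Im z ^+ 2.
Proof. by case: z => a b /=; rewrite sqr_sqrtr// addr_ge0// sqr_ge0. Qed.

Lemma cabs_ge0 (z : C) : 0 <= cabs z.
Proof. by case: z => a b /=; rewrite sqrtr_ge0. Qed.

Lemma l2normE p (u : 'cV[C]_p) : l2norm u = Num.sqrt (rdot u u).
Proof.
by rewrite rdotE; congr Num.sqrt; apply: eq_bigr => i _; rewrite cabs2 !expr2.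
Qed.

Lemma l2norm2 p (u : 'cV[C]_p) : l2norm u ^+ 2 = rdot u u.
Proof. by rewrite l2normE sqr_sqrtr// rdot_ge0. Qed.

Lemma l2norm2E p (u : 'cV[C]_p) : l2norm u ^+ 2 = \sum_i cabs (u i 0) ^+ 2.
Proof. by rewrite sqr_sqrtr// sumr_ge0// => i _; rewrite sqr_ge0. Qed.

Lemma l2norm_ge0 p (u : 'cV[C]_p) : 0 <= l2norm u.
Proof. by rewrite sqrtr_ge0. Qed.

Lemma l2norm_eq p q (u : 'cV[C]_p) (v : 'cV[C]_q) :
  rdot u u = rdot v v -> l2norm u = l2norm v.
Proof. by rewrite !l2normE => ->. Qed.

Lemma l2norm_eq0 p (u : 'cV[C]_p) : l2norm u = 0 -> u = 0.
Proof.
move=> /(congr1 (fun x => x ^+ 2)); rewrite l2norm2E expr0n /=.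
move=> /eqP; rewrite psumr_eq0; last by move=> i _; rewrite sqr_ge0.
move=> /allP w0; apply/matrixP => i j; rewrite (ord1 j) mxE.
have := w0 i (mem_index_enum i); rewrite sqrf_eq0 => /eqP.
by move=> /ComplexField.Normc.eq0_normc.
Qed.

Lemma rdot_le p (u v : 'cV[C]_p) : rdot u v <= l2norm u * l2norm v.
Proof.
have := rdot_ge0 ((l2norm v)%:C *: u - (l2norm u)%:C *: v).
rewrite !(rdotBl, rdotBr, rdotZl, rdotZr) -!l2norm2 (rdotC v u).
set a := l2norm u; set b := l2norm v; set t := rdot u v.
have ha : 0 <= a by exact: l2norm_ge0. have hb : 0 <= b by exact: l2norm_ge0.
move=> h.
have h1 : 0 <= (a * b) * (a * b - t) by nra.
have [ab0|ab0] := eqVneq (a * b) 0; last first.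
  have : 0 < a * b by rewrite lt_neqAle eq_sym ab0 mulr_ge0.
  by move=> ab; rewrite -subr_ge0 -(pmulr_rge0 _ ab).
(* one factor vanishes, and then so does the inner product *)
move: ab0 => /eqP; rewrite mulf_eq0 => /orP[]/eqP /l2norm_eq0 uv0.
  by rewrite /t uv0 /rdot trmx0 map_mx0 mul0mx mxE mulr_ge0.
by rewrite /t uv0 /rdot mulmx0 mxE mulr_ge0.
Qed.

Lemma rdot_abs p (u v : 'cV[C]_p) : `|rdot u v| <= l2norm u * l2norm v.
Proof.
rewrite ler_norml rdot_le andbT lerNl -rdotNr.
by apply: le_trans (rdot_le _ _) _; rewrite (@l2norm_eq p p (- v) v)// rdotNr rdotNl opprK.
Qed.

Lemma l2norm_gt0 p (u : 'cV[C]_p) : u != 0 -> 0 < l2norm u.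
Proof.
move=> u0; rewrite lt_neqAle l2norm_ge0 andbT eq_sym.
by apply: contra_neq u0 => /l2norm_eq0.
Qed.

Lemma l2norm0 p : l2norm (0 : 'cV[C]_p) = 0.
Proof. by rewrite l2normE /rdot mulmx0 mxE sqrtr0. Qed.

Lemma l2normZ p (a : R) (u : 'cV[C]_p) : l2norm (a%:C *: u) = `|a| * l2norm u.
Proof. by rewrite !l2normE rdotZl rdotZr mulrA -expr2 sqrtrM ?sqr_ge0// sqrtr_sqr. Qed.

Lemma l2normN p (u : 'cV[C]_p) : l2norm (- u) = l2norm u.
Proof. by apply: l2norm_eq; rewrite rdotNr rdotNl opprK. Qed.

Lemma l2normD p (u v : 'cV[C]_p) : l2norm (u + v) <= l2norm u + l2norm v.
Proof.
rewrite -ler_sqr ?nnegrE ?addr_ge0 ?l2norm_ge0// l2norm2 !(rdotDl, rdotDr).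
rewrite (rdotC v u) -!l2norm2; have := rdot_le u v; nra.
Qed.

Lemma l2normB p (u v : 'cV[C]_p) : l2norm (u - v) <= l2norm u + l2norm v.
Proof. by rewrite -(l2normN v) l2normD. Qed.

Lemma l2norm_tri p (u v : 'cV[C]_p) : l2norm u <= l2norm v + l2norm (u - v).
Proof. by rewrite -{1}(subrK v u) addrC l2normD. Qed.

Lemma l2norm_col p q (u : 'cV[C]_p) (v : 'cV[C]_q) :
  l2norm (col_mx u v) ^+ 2 = l2norm u ^+ 2 + l2norm v ^+ 2.
Proof. by rewrite !l2norm2 rdot_col. Qed.

Lemma l2norm_col_le p q (u : 'cV[C]_p) (v : 'cV[C]_q) :
  l2norm (col_mx u v) <= l2norm u + l2norm v.
Proof.
rewrite -ler_sqr ?nnegrE ?addr_ge0 ?l2norm_ge0// l2norm_col.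
have := l2norm_ge0 u; have := l2norm_ge0 v; nra.
Qed.

Lemma l2norm_colu p q (u : 'cV[C]_p) (v : 'cV[C]_q) :
  l2norm u <= l2norm (col_mx u v).
Proof.
rewrite -ler_sqr ?nnegrE ?l2norm_ge0// l2norm_col; have := sqr_ge0 (l2norm v).
lra.
Qed.

Lemma l2norm_cold p q (u : 'cV[C]_p) (v : 'cV[C]_q) :
  l2norm v <= l2norm (col_mx u v).
Proof.
rewrite -ler_sqr ?nnegrE ?l2norm_ge0// l2norm_col; have := sqr_ge0 (l2norm u).
lra.
Qed.

Lemma isometryP p q (Q : 'M[C]_(p, q)) (v : 'cV[C]_q) :
  Q^t* *m Q = 1%:M -> l2norm (Q *m v) = l2norm v.
Proof. by move=> QQ; apply: l2norm_eq; rewrite rdot_adj mulmxA QQ mul1mx. Qed.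

(** Pair [A^* u] with itself and move one factor to the other side. *)
Lemma bound_adj p q (A : 'M[C]_(p, q)) (a : R) :
  0 <= a -> (forall v, l2norm (A *m v) <= a * l2norm v) ->
  forall u, l2norm (A^t* *m u) <= a * l2norm u.
Proof.
move=> a0 hA u; set w := A^t* *m u.
have [w0|w0] := eqVneq (l2norm w) 0.
  by rewrite w0 mulr_ge0// l2norm_ge0.
have wp : 0 < l2norm w by rewrite lt_neqAle eq_sym w0 l2norm_ge0.
rewrite -(ler_pM2l wp) -expr2 l2norm2 {2}/w -rdot_adj.
apply: le_trans (rdot_le _ _) _; rewrite mulrA.
by rewrite ler_wpM2r ?l2norm_ge0// mulrC hA.
Qed.

Lemma cabsM (x y : C) : cabs (x * y) = cabs x * cabs y.
Proof. exact: ComplexField.Normc.normcM. Qed.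

Lemma cabsD (x y : C) : cabs (x + y) <= cabs x + cabs y.
Proof. exact: (@le_normcD _ x y). Qed.

Lemma cabs_real (a : R) : cabs a%:C = `|a|.
Proof. by rewrite /cabs /= expr0n addr0 sqrtr_sqr. Qed.

Lemma l2normZc p (a : C) (u : 'cV[C]_p) : l2norm (a *: u) = cabs a * l2norm u.
Proof.
rewrite /l2norm (eq_bigr (fun i => cabs a ^+ 2 * cabs (u i 0) ^+ 2)).
  by rewrite -mulr_sumr sqrtrM ?sqr_ge0// sqrtr_sqr ger0_norm ?cabs_ge0.
by move=> i _; rewrite mxE cabsM exprMn.
Qed.

Lemma l2norm_sum p (I : Type) (s : seq I) (f : I -> 'cV[C]_p) :
  l2norm (\sum_(i <- s) f i) <= \sum_(i <- s) l2norm (f i).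
Proof.
elim/big_rec2: _ => [|i y x _ h]; first by rewrite l2norm0.
by apply: le_trans (l2normD _ _) _; rewrite lerD2l.
Qed.

Lemma cabs_le_l2norm p (v : 'cV[C]_p) i : cabs (v i 0) <= l2norm v.
Proof.
rewrite -ler_sqr ?nnegrE ?cabs_ge0 ?l2norm_ge0// l2norm2E (bigD1 i)//= lerDl.
by rewrite sumr_ge0// => j _; rewrite sqr_ge0.
Qed.

Lemma l2norm_mulmx p q (A : 'M[C]_(p, q)) (v : 'cV[C]_q) :
  l2norm (A *m v) <= (\sum_j l2norm (col j A)) * l2norm v.
Proof.
have -> : A *m v = \sum_j v j 0 *: col j A.
  apply/matrixP => i k; rewrite (ord1 k) mxE summxE; apply: eq_bigr => j _.
  by rewrite !mxE mulrC.
apply: le_trans (l2norm_sum _ _) _; rewrite mulr_suml; apply: ler_sum => j _.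
by rewrite l2normZc mulrC ler_wpM2l ?l2norm_ge0 ?cabs_le_l2norm.
Qed.

Lemma l2norm_le_sum p (v : 'cV[C]_p) : l2norm v <= \sum_i cabs (v i 0).
Proof.
have -> : v = \sum_i v i 0 *: delta_mx i 0.
  apply/matrixP => i k; rewrite (ord1 k) summxE (bigD1 i)//= big1.
    by rewrite !mxE !eqxx mulr1 addr0.
  by move=> j ji; rewrite !mxE eq_sym (negbTE ji) mulr0.
apply: le_trans (l2norm_sum _ _) _; apply: ler_sum => j _.
rewrite l2normZc (_ : l2norm _ = 1) ?mulr1; last first.
  rewrite /l2norm (bigD1 j)//= big1; last first.
    by move=> i ij; rewrite mxE (negbTE ij) cabs_real normr0 expr0n.
  by rewrite mxE !eqxx addr0 cabs_real normr1 expr1n sqrtr1.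
rewrite summxE (bigD1 j)//= big1 ?addr0.
  by rewrite !mxE !eqxx mulr1.
by move=> i ij; rewrite !mxE eq_sym (negbTE ij) mulr0.
Qed.

Let opset p q (A : 'M[C]_(p, q)) : set R :=
  [set l2norm (A *m v) | v in [set v : 'cV[C]_q | l2norm v <= 1]].

Let opset0 p q (A : 'M[C]_(p, q)) : opset A 0.
Proof. by exists (0 : 'cV_q) => /=; rewrite ?mulmx0 l2norm0 ?ler01. Qed.

Lemma opnorm_le p q (A : 'M[C]_(p, q)) (a : R) : 0 <= a ->
  (forall v, l2norm (A *m v) <= a * l2norm v) -> opnorm A <= a.
Proof.
move=> a0 hA; apply: ge_sup; first by exists (0 : R); exact: opset0.
by move=> _ [v /= v1 <-]; apply: le_trans (hA v) _; rewrite ler_piMr.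
Qed.

Let opset_sup p q (A : 'M[C]_(p, q)) : has_sup (opset A).
Proof.
split; first by exists (0:R); exact: opset0.
exists (\sum_j l2norm (col j A)) => _ [v /= v1 <-].
apply: le_trans (l2norm_mulmx _ _) _; rewrite ler_piMr//.
by rewrite sumr_ge0// => j _; rewrite l2norm_ge0.
Qed.

Lemma opnorm_ge0 p q (A : 'M[C]_(p, q)) : 0 <= opnorm A.
Proof. by apply: ub_le_sup (opset0 A); case: (opset_sup A). Qed.

Lemma opnormP p q (A : 'M[C]_(p, q)) (v : 'cV[C]_q) :
  l2norm (A *m v) <= opnorm A * l2norm v.
Proof.
have [->|v0] := eqVneq v 0; first by rewrite mulmx0 !l2norm0 mulr0.
have vp := l2norm_gt0 v0.
rewrite -ler_pdivrMr// mulrC.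
have -> : (l2norm v)^-1 * l2norm (A *m v) = l2norm (A *m ((l2norm v)^-1%:C *: v)).
  by rewrite -scalemxAr l2normZ ger0_norm// invr_ge0 ltW.
apply: ub_le_sup; first by case: (opset_sup A).
exists ((l2norm v)^-1%:C *: v) => //=.
by rewrite l2normZ ger0_norm ?invr_ge0 ?(ltW vp)// mulVf// gt_eqF.
Qed.

Lemma opnormD p q (A B : 'M[C]_(p, q)) : opnorm (A + B) <= opnorm A + opnorm B.
Proof.
apply: opnorm_le => [|v]; first by rewrite addr_ge0 ?opnorm_ge0.
rewrite mulmxDl mulrDl; apply: le_trans (l2normD _ _) _.
by rewrite lerD ?opnormP.
Qed.

Lemma opnorm_eq0_dim p (A : 'M[C]_(p, 0)) : opnorm A = 0.
Proof.
apply/le_anti; rewrite opnorm_ge0 andbT; apply: opnorm_le => // v.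
by rewrite [v]flatmx0 mulmx0 l2norm0 mul0r.
Qed.

Lemma opnorm_le_entries p q (A : 'M[C]_(p, q)) (a : R) : 0 <= a ->
  (forall i j, cabs (A i j) <= a) -> opnorm A <= (p * q)%:R * a.
Proof.
move=> a0 hA; apply: opnorm_le => [|v]; first by rewrite mulr_ge0.
apply: le_trans (l2norm_mulmx _ _) _; rewrite ler_wpM2r ?l2norm_ge0//.
apply: le_trans (_ : \sum_(j < q) \sum_(i < p) a <= _).
  apply: ler_sum => j _; apply: le_trans (l2norm_le_sum _) _.
  by apply: ler_sum => i _; rewrite mxE.
by rewrite !sumr_const !card_ord -mulrnA mulr_natl lexx.
Qed.

End inner_product.

(** * The support of the limiting law *)

Section support.
Context {R : realType}.
Variable mu : probability R R.

(** Every point off the support has a null neighbourhood with rational end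
   points, and there are countably many of those. *)
Lemma msupport_negligible : mu.-negligible (~` msupport mu).
Proof.
pose I (pq : rat * rat) : set R := `]ratr pq.1, ratr pq.2[%classic.
pose F (k : nat) : set R := if unpickle k is Some pq then
   (if `[< mu (I pq) = 0%E >] then I pq else set0) else set0.
have mF k : measurable (F k).
  by rewrite /F; case: unpickle => // pq; case: asboolP => // _; exact: measurable_itv.
have F0 k : mu (F k) = 0%E.
  by rewrite /F; case: unpickle => [pq|]; [case: asboolP => //|]; rewrite measure0.
apply: (@negligibleS _ _ _ mu (\bigcup_k F k)); last first.
  by apply: negligible_bigcup => k; exists (F k); split; [exact: mF|exact: F0|].
move=> x /existsNP[U] /not_implyP[oU] /not_implyP[Ux] /negP.
rewrite -leNgt measure_le0 => /eqP U0.
have [e e0 xeU] : exists2 e : R, 0 < e & ball x e `<=` U.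
  by move: (open_nbhs_nbhs (conj oU Ux)) => /nbhs_ballP[e /= e0 h]; exists e.
have [p] := @rat_in_itvoo R (x - e) x ltac:(lra); rewrite in_itv/= => /andP[xp px].
have [q] := @rat_in_itvoo R x (x + e) ltac:(lra); rewrite in_itv/= => /andP[xq qx].
exists (pickle (p, q)); first exact: Logic.I.
rewrite /F pickleK.
case: asboolP => [_|[]]; first by rewrite /I /= in_itv/= px xq.
apply/eqP; rewrite -measure_le0 -U0; apply: le_measure.
- by rewrite inE; exact: measurable_itv.
- by rewrite inE; exact: measurable_realfun.open_measurable.
move=> y; rewrite /I /= in_itv/= => /andP[py yq]; apply: xeU.
by rewrite /ball/= ltr_norml; lra.
Qed.

Hypothesis mu_ge0 : mu `[0, +oo[%classic = 1%E.
Hypothesis mu_cpt : compact (msupport mu).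

Lemma bulk_edge_ge0 : 0 <= bulk_edge mu.
Proof. exact: sqrtr_ge0. Qed.

Lemma bulk_mass : mu `[0, bulk_edge mu ^+ 2]%classic = 1%E.
Proof.
set D := `[0, _]%classic.
have mD : measurable D by exact: measurable_itv.
have supp0 x : msupport mu x -> 0 <= x.
  move=> sx; rewrite leNgt; apply/negP => x0.
  have NE : [set t : R | t < 0] = ~` `[0, +oo[%classic.
    by apply/seteqP; split => t; rewrite /= in_itv/= andbT ltNge => /negP.
  have N0 : mu [set t : R | t < 0] = 0%E.
    have := probability_setC mu (@measurable_itv R `[0, +oo[).
    by rewrite NE mu_ge0 subee.
  have : (0 < mu [set t : R | (t < 0)%R])%E by apply: sx => //; exact: open_lt.
  by rewrite N0 ltxx.
have suppD : msupport mu `<=` D.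
  move=> x sx; rewrite /D /= in_itv/= supp0//=.
  have xs : x <= sup (msupport mu).
    apply: ub_le_sup => //; have [M [_ hM]] := compact_bounded mu_cpt.
    by exists (M + 1) => y sy; apply: le_trans (ler_norm _) _; apply: (hM (M + 1) _ y sy); rewrite ltrDl.
  by rewrite sqr_sqrtr// (le_trans (supp0 _ sx)).
have /negligibleP : mu.-negligible (~` D).
  by apply: negligibleS msupport_negligible; exact: subsetC.
move=> /(_ (measurableC mD)) DC.
have := probability_setC mu (measurableC mD); rewrite setCK DC.
by rewrite sube0.
Qed.

End support.

(** * Integrals over the bulk *)

Section bulk_integral.
Context {R : realType}.
Variables (mu : probability R R) (B : R).
Hypothesis muB : mu `[0, B]%classic = 1%E.
Let D : set R := `[0, B]%classic.
Let mD : measurable D. Proof. exact: measurable_itv. Qed.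

Definition Ebulk (f : R -> R) : R := \int[mu]_(t in `[0, B]) f t.

Definition bulk_continuous (f : R -> R) : Prop := {in D, continuous f}.

Lemma bulk_continuous_integrable f : bulk_continuous f -> mu.-integrable D (EFin \o f).
Proof.
move=> cf; have wf : {within D, continuous f} by exact: continuous_in_subspaceT.
apply: measurable_bounded_integrable => //.
- have := ltry (1 : R); rewrite -muB; exact.
- exact: measurable_realfun.subspace_continuous_measurable_fun.
have cD : compact D by exact: segment_compact.
have [M [Mr hM]] := compact_bounded (continuous_compact wf cD).
exists M; split => // N MN t /= tD; apply: (hM N MN); by exists t.
Qed.

Lemma Ebulk_cst (k : R) : Ebulk (fun=> k) = k.
Proof. by rewrite /Ebulk Rintegral_cst// (congr1 fine muB) mulr1. Qed.

Lemma Ebulk_le f g : bulk_continuous f -> bulk_continuous g ->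
  (forall t, 0 <= t <= B -> f t <= g t) -> Ebulk f <= Ebulk g.
Proof.
move=> cf cg fg; apply: le_Rintegral => //; try exact: bulk_continuous_integrable.
Qed.

Lemma eq_Ebulk f g :
  (forall t, 0 <= t <= B -> f t = g t) -> Ebulk f = Ebulk g.
Proof. by move=> fg; apply: eq_Rintegral => t; rewrite inE/= in_itv/=; exact: fg. Qed.

Lemma EbulkB f g : bulk_continuous f -> bulk_continuous g ->
  Ebulk (fun t => f t - g t) = Ebulk f - Ebulk g.
Proof. by move=> cf cg; rewrite /Ebulk RintegralB//; exact: bulk_continuous_integrable. Qed.

Lemma EbulkZ k f : bulk_continuous f -> Ebulk (fun t => k * f t) = k * Ebulk f.
Proof. by move=> cf; rewrite /Ebulk RintegralZl//; exact: bulk_continuous_integrable. Qed.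

Lemma bulk_continuous_cst k : bulk_continuous (fun=> k).
Proof. by move=> t _; exact: cvg_cst. Qed.

Lemma bulk_continuous_id : bulk_continuous id.
Proof. by move=> t _; exact: cvg_id. Qed.

Lemma bulk_continuousD f g : bulk_continuous f -> bulk_continuous g -> bulk_continuous (fun t => f t + g t).
Proof. by move=> cf cg t tD; apply: cvgD; [exact: cf|exact: cg]. Qed.

Lemma bulk_continuousB f g : bulk_continuous f -> bulk_continuous g -> bulk_continuous (fun t => f t - g t).
Proof. by move=> cf cg t tD; apply: cvgB; [exact: cf|exact: cg]. Qed.

Lemma bulk_continuousM f g : bulk_continuous f -> bulk_continuous g -> bulk_continuous (fun t => f t * g t).
Proof. by move=> cf cg t tD; apply: cvgM; [exact: cf|exact: cg]. Qed.

Lemma bulk_continuousV f : bulk_continuous f -> (forall t, 0 <= t <= B -> f t != 0) ->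
  bulk_continuous (fun t => (f t)^-1).
Proof.
move=> cf f0 t tD; apply: cvgV; last exact: cf.
by apply: f0; move: tD; rewrite inE.
Qed.

(** The complement of the bulk is a null set, so that only the values on the
   bulk matter, even when the integrand has a pole outside of it. *)
Lemma Rintegral_bulk (f : R -> R) : measurable_fun setT f ->
  \int[mu]_t f t = Ebulk f.
Proof.
move=> mf; rewrite /Ebulk [RHS]Rintegral_mkcond /Rintegral; congr fine.
apply: (@ae_eq_integral _ _ _ mu setT (fun x => ((f \_ D) x)%:E) (fun x => (f x)%:E)) => //.
- exact/measurable_realfun.measurable_EFinP.
- apply/measurable_realfun.measurable_EFinP; apply/(measurable_restrictT f mD).
  exact: measurable_funTS.
have mDC : measurable (~` D) by exact: measurableC.
exists (~` D); split => //.
  have := probability_setC mu mD.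
  by rewrite muB subee.
move=> t /= /not_implyP[_ h] tD; apply: h.
by rewrite patchE mem_set.
Qed.

Lemma measurable_fun_pole (x y : R) : measurable_fun setT (fun t : R => x / (y - t)).
Proof.
have -> : [set: R] = [set y] `|` ~` [set y] by rewrite setUv.
apply/measurable_funU => //; first exact: measurableC.
split; first exact: measurable_fun_set1.
apply: measurable_realfun.open_continuous_measurable_fun.
  by apply: closed_openC; apply: closed_eq.
move=> t; rewrite inE/= => ty; apply: cvgM; first exact: cvg_cst.
apply: cvgV; last by apply: cvgB; [exact: cvg_cst|exact: cvg_id].
by rewrite subr_eq0 eq_sym; apply/eqP.
Qed.

End bulk_integral.

(** * Uniform first-order expansions *)

Section first_order.
Context {R : realType}.
Implicit Types f g : R -> R.

(** A first-order expansion with quadratic remainder, uniform on [a, M].  The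
   bounds on [f] and [f'] are included so that the notion is stable under
   products. *)
Definition taylor1 (a M : R) f f' : Prop :=
  exists C : R, [/\ 0 <= C, forall x, a <= x <= M -> `|f x| <= C,
    forall x, a <= x <= M -> `|f' x| <= C &
    forall x y, a <= x <= M -> a <= y <= M ->
      `|f y - f x - (y - x) * f' x| <= C * (y - x) ^+ 2].

Lemma taylor1_cst a M (k : R) : taylor1 a M (fun=> k) (fun=> 0).
Proof.
exists `|k|; split => // [x _|x y _ _]; first by rewrite normr0.
by rewrite subrr mulr0 subrr normr0 mulr_ge0// sqr_ge0.
Qed.

Lemma taylor1_inv a M : 0 < a ->
  taylor1 a M (fun x => x^-1) (fun x => - (x ^- 2)).
Proof.
move=> a0; set u := a^-1.
have u0 : 0 < u by rewrite invr_gt0.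
have xu x : a <= x <= M -> 0 < x^-1 <= u.
  move=> /andP[ax _]; have x0 := lt_le_trans a0 ax.
  by rewrite invr_gt0 x0 /u lef_pV2.
have u2 : 0 <= u ^+ 2 by rewrite sqr_ge0.
have u3 : 0 <= u ^+ 3 by rewrite exprn_ge0// ltW.
exists (u + u ^+ 2 + u ^+ 3); split.
- by rewrite !addr_ge0// ltW.
- by move=> x /xu /andP[x0 x1]; rewrite ger0_norm ?(ltW x0)//; lra.
- move=> x /xu /andP[x0 x1]; rewrite normrN -exprVn ger0_norm ?sqr_ge0//.
  have : x^-1 ^+ 2 <= u ^+ 2 by rewrite ler_sqr// nnegrE ltW.
  by lra.
- move=> x y xM yM; have /andP[x0 x1] := xu x xM; have /andP[y0 y1] := xu y yM.
  have -> : y^-1 - x^-1 - (y - x) * - x ^- 2 = (x^-1 ^+ 2 * y^-1) * (y - x) ^+ 2.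
    by field; apply/andP; split; rewrite -invr_eq0 gt_eqF.
  have xyp : 0 <= x^-1 ^+ 2 * y^-1 by rewrite mulr_ge0 ?sqr_ge0// ltW.
  have h2 : 0 <= (y - x) ^+ 2 by exact: sqr_ge0.
  rewrite ger0_norm; last exact: mulr_ge0.
  apply: ler_wpM2r => //; apply: le_trans (_ : u ^+ 3 <= _); last by lra.
  rewrite (exprSr u 2); apply: ler_pM; rewrite ?sqr_ge0 ?(ltW y0)//.
  by rewrite ler_sqr// nnegrE ltW.
Qed.

Lemma taylor1D a M f f' g g' : taylor1 a M f f' -> taylor1 a M g g' ->
  taylor1 a M (fun x => f x + g x) (fun x => f' x + g' x).
Proof.
move=> [C [C0 fC f'C fR]] [D [D0 gD g'D gR]]; exists (C + D); split.
- exact: addr_ge0.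
- by move=> x xM /=; apply: le_trans (ler_normD _ _) (lerD (fC x xM) (gD x xM)).
- by move=> x xM /=; apply: le_trans (ler_normD _ _) (lerD (f'C x xM) (g'D x xM)).
- move=> x y xM yM.
  rewrite [X in `|X|](_ : _ = (f y - f x - (y - x) * f' x)
    + (g y - g x - (y - x) * g' x)); last by ring.
  rewrite [leRHS]mulrDl.
  exact: le_trans (ler_normD _ _) (lerD (fR x y xM yM) (gR x y xM yM)).
Qed.

Lemma taylor1M a M f f' g g' : a <= M -> taylor1 a M f f' -> taylor1 a M g g' ->
  taylor1 a M (fun x => f x * g x) (fun x => f' x * g x + f x * g' x).
Proof.
move=> aM [C [C0 fC f'C fR]] [D [D0 gD g'D gR]].
have CD : 0 <= C * D by exact: mulr_ge0.
have aM0 : 0 <= M - a by rewrite subr_ge0.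
exists (C * D * (3 + (M - a))); split.
- by rewrite mulr_ge0// addr_ge0.
- move=> x xM; rewrite normrM; apply: le_trans (ler_pM _ _ (fC x xM) (gD x xM)) _ => //.
  by rewrite ler_peMr//; lra.
- move=> x xM; apply: le_trans (ler_normD _ _) _; rewrite !normrM.
  have := ler_pM (normr_ge0 _) (normr_ge0 _) (f'C x xM) (gD x xM).
  have := ler_pM (normr_ge0 _) (normr_ge0 _) (fC x xM) (g'D x xM).
  by nra.
- move=> x y xM yM; set h := y - x.
  have hM : `|h| <= M - a by rewrite ler_norml /h; lra.
  rewrite [X in `|X|](_ : _ = (f y - f x - h * f' x) * g y
    + (f x + h * f' x) * (g y - g x - h * g' x) + h ^+ 2 * (f' x * g' x)); last first.
    by ring.
  have A1 := ler_pM (normr_ge0 _) (normr_ge0 _) (fR x y xM yM) (gD y yM).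
  have A2 : `|(f x + h * f' x) * (g y - g x - h * g' x)|
      <= (C + (M - a) * C) * (D * h ^+ 2).
    rewrite normrM; apply: ler_pM => //; last exact: gR.
    apply: le_trans (ler_normD _ _) _; apply: lerD; first exact: fC.
    by rewrite normrM; apply: ler_pM => //; exact: f'C.
  have A3 : `|h ^+ 2 * (f' x * g' x)| <= h ^+ 2 * (C * D).
    rewrite normrM ger0_norm ?sqr_ge0// ler_wpM2l ?sqr_ge0// normrM.
    by apply: ler_pM => //; [exact: f'C|exact: g'D].
  rewrite -/h -normrM in A1.
  apply: le_trans (ler_normD _ _) _; apply: le_trans (lerD (ler_normD _ _) A3) _.
  apply: le_trans (lerD (lerD A1 A2) (lexx _)) _.
  by nra.
Qed.

Lemma taylor1_eq a M f f' g g' : (forall x, a <= x <= M -> f x = g x) ->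
  (forall x, a <= x <= M -> f' x = g' x) -> taylor1 a M f f' -> taylor1 a M g g'.
Proof.
move=> fg f'g' [C [C0 fC f'C fR]]; exists C; split => //.
- by move=> x xM; rewrite -fg// fC.
- by move=> x xM; rewrite -f'g'// f'C.
- by move=> x y xM yM; rewrite -!fg// -f'g'// fR.
Qed.

Lemma taylor1_continuous a M f f' x : taylor1 a M f f' -> a < x < M ->
  {for x, continuous f}.
Proof.
move=> [C [C0 fC f'C fR]] /andP[ax xM].
apply/cvgrPdist_le => e e0.
have [k [k0 ke]] : exists k : R, 0 < k /\ k * (C * (M - a) + C) <= e.
  exists (e / (C * (M - a) + C + 1)); split.
    by apply: divr_gt0 => //; nra.
  by rewrite -mulrA ler_piMr ?(ltW e0)// mulrC ler_pdivrMr; nra.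
near=> y.
have yaM : a <= y <= M.
  by apply/andP; split; apply: ltW; near: y; [exact: lt_nbhsr|exact: lt_nbhsl].
have yx : `|y - x| <= k.
  by rewrite distrC ltW//; near: y; exact: nbhsx_ballx.
have h := fR x y ltac:(lra) yaM.
have h2 := f'C x ltac:(lra).
rewrite distrC.
rewrite (_ : f y - f x = (f y - f x - (y - x) * f' x) + (y - x) * f' x); last by ring.
apply: le_trans (ler_normD _ _) _; apply: le_trans (lerD h (lexx _)) _.
rewrite normrM -[X in C * X]ger0_norm ?sqr_ge0// normrX.
have h3 : `|y - x| <= M - a by rewrite ler_norml; lra.
have := normr_ge0 (y - x); set t := `|y - x| in yx h3 *.
have := normr_ge0 (f' x); set s := `|f' x| in h2 *.
move=> s0 t0; apply: le_trans ke.
have := ler_pM t0 s0 yx h2.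
have tt : t * t <= k * (M - a) by rewrite ler_pM.
have := ler_wpM2l C0 tt.
by rewrite expr2; lra.
Unshelve. all: by end_near. Qed.

Lemma taylor1_derive1 a M f f' x : taylor1 a M f f' -> a < x < M ->
  derive1 f x = f' x.
Proof.
move=> [C [C0 fC f'C fR]] /andP[ax xM].
rewrite derive1E; apply: cvg_lim => //.
apply/cvgrPdist_le => e e0.
near=> h.
have h0 : h != 0 by near: h; exact: nbhs_dnbhs_neq.
have hk : `|h| <= e / (C + 1).
  by near: h; apply: dnbhs0_le; rewrite divr_gt0//; lra.
have h1 : `|h| <= Num.min (x - a) (M - x).
  by near: h; apply: dnbhs0_le; rewrite lt_min; lra.
have haM : a <= h + x <= M.
  by move: h1; rewrite le_min !ler_norml; lra.
rewrite /= [h *: 1]mulr1 distrC.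
have := fR x (h + x) ltac:(lra) haM; rewrite addrK => hR.
rewrite /GRing.scale /=.
have -> : h^-1 * (f (h + x) - f x) - f' x = h^-1 * (f (h + x) - f x - h * f' x).
  by field.
rewrite normrM normfV ler_pdivrMl ?normr_gt0//; apply: le_trans hR _.
rewrite -real_normK ?num_real// expr2 mulrCA ler_wpM2l//.
apply: le_trans (_ : C * (e / (C + 1)) <= _); first by rewrite ler_wpM2l.
by rewrite mulrCA ler_piMr ?(ltW e0)// ler_pdivrMr; lra.
Unshelve. all: by end_near. Qed.

End first_order.

(** * The transforms on the real half-line beyond the bulk *)

Section transforms.
Context {R : realType}.
Variables (mu : probability R R) (c : R).
Local Notation b := (bulk_edge mu).
Hypothesis muB : mu `[0, b ^+ 2]%classic = 1%E.
Hypothesis hc : 0 < c <= 1.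
Let b0 : 0 <= b. Proof. exact: bulk_edge_ge0. Qed.
Local Notation E := (Ebulk mu (b ^+ 2)).
Local Notation bulk_continuous := (bulk_continuous (b ^+ 2)).

Lemma off_bulk x t : b < x -> 0 <= t <= b ^+ 2 -> 0 < x ^+ 2 - t.
Proof. by have := b0; nra. Qed.

Lemma bulk_continuous_pole x : b < x -> bulk_continuous (fun t => (x ^+ 2 - t)^-1).
Proof.
move=> bx; apply: bulk_continuousV; first by apply: bulk_continuousB; [exact: bulk_continuous_cst|exact: bulk_continuous_id].
by move=> t tD; rewrite gt_eqF// off_bulk.
Qed.

Lemma bulk_continuous_phi x : b < x -> bulk_continuous (fun t => x / (x ^+ 2 - t)).
Proof. by move=> bx; apply: bulk_continuousM; [exact: bulk_continuous_cst|exact: bulk_continuous_pole]. Qed.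

Lemma phi_real x : b < x -> phi mu x%:C = (E (fun t => x / (x ^+ 2 - t)))%:C.
Proof.
move=> bx; rewrite /phi.
have e t : x%:C / (x%:C ^+ 2 - t%:C) = (x / (x ^+ 2 - t))%:C.
  by rewrite -rmorphXn -rmorphB -fmorphV -rmorphM.
rewrite (@eq_Rintegral _ _ _ mu setT (fun t : R => x / (x ^+ 2 - t))); last by move=> t _; rewrite e.
rewrite [X in _ +i* X](@eq_Rintegral _ _ _ mu setT (fun=> 0)); last by move=> t _; rewrite e.
rewrite (Rintegral_bulk muB); last exact: measurable_fun_pole.
by rewrite [X in _ +i* X]Rintegral_cst// mul0r.
Qed.

Lemma phiRE x : b < x -> phiR mu x = E (fun t => x / (x ^+ 2 - t)).
Proof. by move=> bx; rewrite /phiR phi_real. Qed.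

Lemma phi_phiR x : b < x -> phi mu x%:C = (phiR mu x)%:C.
Proof. by move=> bx; rewrite /phiR phi_real. Qed.

Lemma phit_real x : b < x ->
  phit mu c x%:C = (c * phiR mu x + (1 - c) / x)%:C.
Proof.
by move=> bx; rewrite /phit phi_phiR// -fmorphV -!rmorphM -rmorphD.
Qed.

Lemma phitRE x : b < x -> phitR mu c x = c * phiR mu x + (1 - c) / x.
Proof. by move=> bx; rewrite /phitR phit_real. Qed.

Lemma phit_phitR x : b < x -> phit mu c x%:C = (phitR mu c x)%:C.
Proof. by move=> bx; rewrite phitRE// phit_real. Qed.

Lemma dRE x : b < x -> dR mu c x = phiR mu x * phitR mu c x.
Proof. by move=> bx; rewrite /dR /dtrans phi_phiR// phit_phitR// -rmorphM. Qed.

Lemma phiR_ge x : b < x -> x^-1 <= phiR mu x.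
Proof.
move=> bx; have x0 := le_lt_trans b0 bx.
rewrite phiRE// -[leLHS](Ebulk_cst muB); apply: (Ebulk_le muB).
- exact: bulk_continuous_cst.
- exact: bulk_continuous_phi.
- move=> t tD; have := off_bulk bx tD => h.
  rewrite ler_pdivlMr// -ler_pdivlMl ?invr_gt0// invrK -expr2; lra.
Qed.

Lemma phiR_gt0 x : b < x -> 0 < phiR mu x.
Proof.
move=> bx; apply: lt_le_trans (phiR_ge bx).
by rewrite invr_gt0 (le_lt_trans b0 bx).
Qed.

Lemma phiR_le x : b < x -> phiR mu x <= x / (x ^+ 2 - b ^+ 2).
Proof.
move=> bx; have x0 := le_lt_trans b0 bx.
rewrite phiRE// -[leRHS](Ebulk_cst muB); apply: (Ebulk_le muB).
- exact: bulk_continuous_phi.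
- exact: bulk_continuous_cst.
- move=> t tD; rewrite ler_pM2l// lef_pV2 ?posrE ?off_bulk//; first by lra.
  by rewrite lexx sqr_ge0.
Qed.

(** The difference of the integrands is [(y - x) (x y + t) / ((x^2 - t) (y^2 - t))],
   which is smallest at [t = 0]: the bound is attained by a point mass at [0]. *)
Lemma phiRB x y : b < x -> x < y -> x^-1 - y^-1 <= phiR mu x - phiR mu y.
Proof.
move=> bx xy; have x0 := le_lt_trans b0 bx; have by_ := lt_trans bx xy.
have y0 := lt_trans x0 xy.
rewrite !phiRE// -(EbulkB muB); try exact: bulk_continuous_phi.
rewrite -[leLHS](Ebulk_cst muB); apply: (Ebulk_le muB).
- exact: bulk_continuous_cst.
- by apply: bulk_continuousB; exact: bulk_continuous_phi.
move=> t tD; have hx := off_bulk bx tD; have hy := off_bulk by_ tD.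
have -> : x / (x ^+ 2 - t) - y / (y ^+ 2 - t)
    = (y - x) * ((x * y + t) / ((x ^+ 2 - t) * (y ^+ 2 - t))).
  by field; rewrite !gt_eqF.
have -> : x^-1 - y^-1 = (y - x) * (x * y)^-1 by field; rewrite !gt_eqF.
rewrite ler_pM2l ?subr_gt0// ler_pdivlMr ?mulr_gt0// mulrC ler_pdivrMr ?mulr_gt0//.
by have : 0 < x * y by [exact: mulr_gt0]; nra.
Qed.

Lemma phitR_ge x : b < x -> x^-1 <= phitR mu c x.
Proof.
move=> bx; rewrite phitRE//; have := phiR_ge bx; set p := phiR mu x.
rewrite -(ler_pM2l (proj1 (andP hc))); set q := x^-1; lra.
Qed.

Lemma phitR_gt0 x : b < x -> 0 < phitR mu c x.
Proof.
move=> bx; apply: lt_le_trans (phitR_ge bx).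
by rewrite invr_gt0 (le_lt_trans b0 bx).
Qed.

Lemma phitRB x y : b < x -> x < y -> x^-1 - y^-1 <= phitR mu c x - phitR mu c y.
Proof.
move=> bx xy; rewrite !phitRE//; last exact: lt_trans xy.
have := phiRB bx xy; set p := phiR mu x; set q := phiR mu y.
rewrite -(ler_pM2l (proj1 (andP hc))); set u := x^-1; set v := y^-1; lra.
Qed.

Lemma dRB x y : b < x -> x < y -> x ^- 2 - y ^- 2 <= dR mu c x - dR mu c y.
Proof.
move=> bx xy; have by_ := lt_trans bx xy; rewrite !dRE//.
have x0 := le_lt_trans b0 bx; have y0 := lt_trans x0 xy.
have := phiRB bx xy; have := phitRB bx xy.
have := phiR_ge by_; have := phitR_ge bx.
have vu : 0 <= x^-1 - y^-1 by rewrite subr_ge0 lef_pV2// ltW.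
have v0 : 0 < y^-1 by rewrite invr_gt0.
have u0 : 0 < x^-1 by rewrite invr_gt0.
rewrite -!exprVn; move: vu v0 u0.
set p := phiR mu x; set q := phiR mu y; set p' := phitR _ _ x; set q' := phitR _ _ y.
set u := x^-1; set v := y^-1 => vu v0 u0 h1 h2 h3 h4.
rewrite [leRHS](_ : _ = (p - q) * p' + (p' - q') * q); last by ring.
have := ler_pM vu (ltW u0) h4 h1; have := ler_pM vu (ltW v0) h3 h2.
by nra.
Qed.

Lemma inv2_anti (x y : R) : 0 < x -> x < y -> y ^- 2 < x ^- 2.
Proof.
move=> x0 xy; have y0 := lt_trans x0 xy.
by rewrite ltf_pV2 ?posrE ?exprn_gt0// ltr_sqr// nnegrE ltW.
Qed.

Lemma dR_decr x y : b < x -> x < y -> dR mu c y < dR mu c x.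
Proof.
move=> bx xy; have := dRB bx xy; have := inv2_anti (le_lt_trans b0 bx) xy; lra.
Qed.

Lemma phiR_decr x y : b < x -> x <= y -> phiR mu y <= phiR mu x.
Proof.
move=> bx; rewrite le_eqVlt => /predU1P[->//|xy]; have := phiRB bx xy.
have : 0 <= x^-1 - y^-1; last by lra.
have x0 := le_lt_trans b0 bx.
by rewrite subr_ge0 lef_pV2// ?posrE ?(lt_trans x0 xy)// ltW.
Qed.

Lemma phitR_decr x y : b < x -> x <= y -> phitR mu c y <= phitR mu c x.
Proof.
move=> bx; rewrite le_eqVlt => /predU1P[->//|xy]; have := phitRB bx xy.
have : 0 <= x^-1 - y^-1; last by lra.
have x0 := le_lt_trans b0 bx.
by rewrite subr_ge0 lef_pV2// ?posrE ?(lt_trans x0 xy)// ltW.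
Qed.

Definition dphiR (x : R) : R :=
  - E (fun t => (x ^+ 2 + t) * ((x ^+ 2 - t)^-1 * (x ^+ 2 - t)^-1)).

Lemma bulk_continuous_dphi x : b < x ->
  bulk_continuous (fun t => (x ^+ 2 + t) * ((x ^+ 2 - t)^-1 * (x ^+ 2 - t)^-1)).
Proof.
move=> bx; apply: bulk_continuousM; first by apply: bulk_continuousD; [exact: bulk_continuous_cst|exact: bulk_continuous_id].
by apply: bulk_continuousM; exact: bulk_continuous_pole.
Qed.

(** The remainder is [(y - x) ^+ 2] times the integral of a rational function
   without poles on the bulk, bounded for [x, y] in [a, M]. *)
Lemma taylor1_phiR a M : b < a -> a <= M -> taylor1 a M (phiR mu) dphiR.
Proof.
move=> ba aM; have a0 := le_lt_trans b0 ba.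
set g := (a ^+ 2 - b ^+ 2)^-1.
have aB : 0 < a ^+ 2 - b ^+ 2 by apply: off_bulk => //; rewrite sqr_ge0 lexx.
have g0 : 0 < g by rewrite invr_gt0.
have B0 : 0 <= b ^+ 2 by exact: sqr_ge0.
have pole x t : a <= x <= M -> 0 <= t <= b ^+ 2 -> 0 < (x ^+ 2 - t)^-1 <= g.
  move=> /andP[ax _] tD; have bx := lt_le_trans ba ax.
  rewrite invr_gt0 off_bulk//= lef_pV2 ?posrE ?aB ?off_bulk//.
  by nra.
have M0 : 0 < M := lt_le_trans a0 aM.
have C1 : 0 <= M * g by rewrite mulr_ge0// ltW.
have C2 : 0 <= (M ^+ 2 + b ^+ 2) * (g * g).
  by apply: mulr_ge0; [rewrite addr_ge0// sqr_ge0|rewrite mulr_ge0// ltW].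
have C3 : 0 <= (M ^+ 3 + 3 * M * b ^+ 2) * (g * g * g).
  have gg : 0 <= g * g * g by rewrite ltW// !mulr_gt0.
  apply: mulr_ge0 => //; apply: addr_ge0; first by rewrite exprn_ge0// ltW.
  by apply: mulr_ge0 => //; rewrite mulr_ge0// ltW.
exists (M * g + (M ^+ 2 + b ^+ 2) * (g * g)
   + (M ^+ 3 + 3 * M * b ^+ 2) * (g * g * g)); split.
- by rewrite !addr_ge0.
- move=> x /andP[ax xM]; have bx := lt_le_trans ba ax.
  rewrite ger0_norm ?(ltW (phiR_gt0 _))//.
  apply: le_trans (_ : M * g <= _); last by lra.
  rewrite phiRE// -[leRHS](Ebulk_cst muB); apply: (Ebulk_le muB).
  + exact: bulk_continuous_phi.
  + exact: bulk_continuous_cst.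
  move=> t tD; have /andP[p0 pg] := pole x t ltac:(lra) tD.
  by apply: ler_pM => //; lra.
- move=> x /andP[ax xM]; have bx := lt_le_trans ba ax.
  rewrite normrN ger0_norm.
    apply: le_trans (_ : (M ^+ 2 + b ^+ 2) * (g * g) <= _); last by lra.
    rewrite -[leRHS](Ebulk_cst muB); apply: (Ebulk_le muB).
    + exact: bulk_continuous_dphi.
    + exact: bulk_continuous_cst.
    move=> t tD; have /andP[p0 pg] := pole x t ltac:(lra) tD.
    apply: ler_pM; [nra|nra|nra|].
    by apply: ler_pM => //; exact: ltW.
  rewrite -[leLHS](Ebulk_cst muB); apply: (Ebulk_le muB).
  + exact: bulk_continuous_cst.
  + exact: bulk_continuous_dphi.
  move=> t tD; have /andP[p0 pg] := pole x t ltac:(lra) tD.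
  by apply: mulr_ge0; nra.
- move=> x y /andP[ax xM] /andP[ay yM]; have bx := lt_le_trans ba ax.
  have by_ := lt_le_trans ba ay.
  pose r t := (x ^+ 2 * y + t * y + 2 * x * t)
     * ((x ^+ 2 - t)^-1 * (x ^+ 2 - t)^-1 * (y ^+ 2 - t)^-1).
  have ar : bulk_continuous r.
    apply: bulk_continuousM; last by apply: bulk_continuousM; [apply: bulk_continuousM|]; exact: bulk_continuous_pole.
    apply: bulk_continuousD; first apply: bulk_continuousD; try exact: bulk_continuous_cst.
      by apply: bulk_continuousM; [exact: bulk_continuous_id|exact: bulk_continuous_cst].
    by apply: bulk_continuousM; [exact: bulk_continuous_cst|exact: bulk_continuous_id].
  have -> : phiR mu y - phiR mu x - (y - x) * dphiR x = (y - x) ^+ 2 * E r.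
    rewrite !phiRE// /dphiR.
    rewrite (_ : (y - x) * - E _ = E (fun t => - (y - x) *
      ((x ^+ 2 + t) * ((x ^+ 2 - t)^-1 * (x ^+ 2 - t)^-1)))); last first.
      by rewrite (EbulkZ muB); [rewrite mulrN mulNr|exact: bulk_continuous_dphi].
    rewrite -(EbulkB muB); try exact: bulk_continuous_phi.
    rewrite -(EbulkB muB); last 2 first.
    - by apply: bulk_continuousB; exact: bulk_continuous_phi.
    - by apply: bulk_continuousM; [exact: bulk_continuous_cst|exact: bulk_continuous_dphi].
    rewrite -(EbulkZ muB)//; apply: eq_Ebulk => t tD.
    have hx := off_bulk bx tD; have hy := off_bulk by_ tD.
    by rewrite /r; field; rewrite !gt_eqF.
  have h2 : 0 <= (y - x) ^+ 2 by exact: sqr_ge0.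
  have r0 t : 0 <= t <= b ^+ 2 ->
      0 <= r t <= (M ^+ 3 + 3 * M * b ^+ 2) * (g * g * g).
    move=> tD; have /andP[p0 pg] := pole x t ltac:(lra) tD.
    have /andP[q0 qg] := pole y t ltac:(lra) tD.
    have x0 := lt_le_trans a0 ax; have y0 := lt_le_trans a0 ay.
    have xx : 0 <= x ^+ 2 <= M ^+ 2.
      by rewrite sqr_ge0 ler_sqr// nnegrE ltW.
    have h1 : 0 <= x ^+ 2 * y <= M ^+ 3.
      rewrite mulr_ge0 ?(ltW y0)//=; last by lra.
      by rewrite (exprSr M 2) ler_pM ?(ltW y0)//; lra.
    have h3 : 0 <= t * y <= M * b ^+ 2.
      by rewrite mulr_ge0 ?(ltW y0)//=; [rewrite mulrC ler_pM ?(ltW y0)//|]; lra.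
    have h4 : 0 <= x * t <= M * b ^+ 2.
      by rewrite mulr_ge0 ?(ltW x0)//=; [rewrite ler_pM ?(ltW x0)//|]; lra.
    have pp : 0 <= (x ^+ 2 - t)^-1 * (x ^+ 2 - t)^-1 <= g * g.
      by rewrite mulr_ge0 ?(ltW p0)//= ler_pM ?(ltW p0).
    rewrite /r; apply/andP; split.
      by rewrite mulr_ge0//; [lra|rewrite mulr_ge0 ?(ltW q0)//; lra].
    apply: ler_pM; [lra| |lra|].
      by rewrite mulr_ge0 ?(ltW q0)//; lra.
    by apply: ler_pM => //; [lra|exact: ltW|lra].
  have r1 : 0 <= E r.
    rewrite -[leLHS](Ebulk_cst muB); apply: (Ebulk_le muB) => //.
      exact: bulk_continuous_cst.
    by move=> t /r0 /andP[].
  have r2 : E r <= (M ^+ 3 + 3 * M * b ^+ 2) * (g * g * g).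
    rewrite -[leRHS](Ebulk_cst muB); apply: (Ebulk_le muB) => //.
      exact: bulk_continuous_cst.
    by move=> t /r0 /andP[].
  rewrite ger0_norm; last exact: mulr_ge0.
  by rewrite mulrC; apply: ler_wpM2r => //; lra.
Qed.

End transforms.

(** * Inverse squares and sets of intervals *)

Section inverse_squares.
Context {R : realType}.

Lemma inv2_lip (x y M : R) : 0 < x <= M -> 0 < y <= M ->
  `|x - y| <= M ^+ 3 * `|x ^- 2 - y ^- 2|.
Proof.
wlog xy : x y / x <= y.
  move=> h hx hy; have [xy|yx] := leP x y; first exact: h.
  by rewrite distrC (distrC (x ^- 2)); apply: h => //; exact: ltW.
move=> /andP[x0 xM] /andP[y0 yM].
have -> : x ^- 2 - y ^- 2 = (y - x) * ((x + y) / (x ^+ 2 * y ^+ 2)).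
  by field; rewrite !gt_eqF.
have h0 : 0 <= (x + y) / (x ^+ 2 * y ^+ 2).
  by apply: divr_ge0; [lra|rewrite -exprMn sqr_ge0].
rewrite distrC normrM (ger0_norm h0) mulrCA ler_peMr//.
rewrite mulrA ler_pdivlMr ?mulr_gt0 ?exprn_gt0// mul1r.
have h1 : x ^+ 2 * y <= M ^+ 3.
  rewrite (exprSr M 2) ler_pM ?sqr_ge0 ?(ltW y0)//.
  by rewrite ler_sqr// nnegrE ltW// (lt_le_trans x0).
apply: le_trans (_ : (x ^+ 2 * y) * (x + y) <= _).
  by rewrite expr2 [y ^+ 2]expr2; have := mulr_gt0 x0 y0; nra.
by rewrite ler_wpM2r// addr_ge0// ltW.
Qed.

Lemma inv2_close (t t0 : R) : 0 < t0 -> `|t - t0| <= t0 / 2 ->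
  `|t ^- 2 - t0 ^- 2| <= 10 / t0 ^+ 3 * `|t - t0|.
Proof.
move=> t00; rewrite ler_norml => tt0.
have tp : 0 < t by lra.
have -> : t ^- 2 - t0 ^- 2 = ((t0 + t) / (t ^+ 2 * t0 ^+ 2)) * (t0 - t).
  by field; rewrite !gt_eqF.
rewrite normrM (distrC t0) ler_wpM2r// ger0_norm; last first.
  by apply: divr_ge0; [lra|rewrite -exprMn sqr_ge0].
rewrite ler_pdivlMr ?exprn_gt0// mulrAC ler_pdivrMr ?mulr_gt0 ?exprn_gt0//.
rewrite (exprS t0 2) mulrA [leRHS]mulrA ler_wpM2r ?sqr_ge0//.
by nra.
Qed.

Lemma inv2_gap (x y del M : R) : 0 < x -> 0 < del -> x <= M -> x + del <= y ->
  del ^+ 2 / (M + del) ^+ 4 <= x ^- 2 - y ^- 2.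
Proof.
move=> x0 d0 xM xy; set z := x + del.
have z0 : 0 < z by rewrite /z; lra.
have Mz : 0 < M + del by lra.
have : z ^- 2 >= y ^- 2.
  by rewrite lef_pV2 ?posrE ?exprn_gt0//; [rewrite ler_sqr// nnegrE|]; lra.
suff : del ^+ 2 / (M + del) ^+ 4 <= x ^- 2 - z ^- 2 by lra.
have -> : x ^- 2 - z ^- 2 = (del * (x + z)) / (x ^+ 2 * z ^+ 2).
  by rewrite /z; field; rewrite -/z !gt_eqF.
apply: ler_pM; rewrite ?sqr_ge0 ?invr_ge0 ?exprn_ge0 ?(ltW Mz)//.
  by rewrite expr2 ler_pM2l// /z; lra.
rewrite lef_pV2 ?posrE ?mulr_gt0 ?exprn_gt0//.
rewrite (exprD (M + del) 2 2) ler_pM ?sqr_ge0// ler_sqr ?nnegrE; try exact: ltW.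
- by lra.
- by rewrite /z; lra.
Qed.

End inverse_squares.

Section interval_sets.
Context {R : realType}.

(** The segment between the two points avoids the boundary of [J], so its trace
   on [J] is open and closed, and the segment is connected. *)
Lemma boundary_separation (J : set R) (x y del : R) :
  (forall p, (closure J `\` J°) p -> del <= `|x - p|) -> `|x - y| < del ->
  J x <-> J y.
Proof.
move=> bd xy.
have del0 : 0 < del by apply: le_lt_trans xy.
pose S : set R := [set z | Num.min x y <= z <= Num.max x y].
have Sx : S x by rewrite /S /= ge_min le_max !lexx.
have Sy : S y by rewrite /S /= ge_min le_max !lexx !orbT.
have inS z : S z -> closure J z -> J° z.
  move=> Sz cz; apply: contrapT => nz; have := bd z (conj cz nz).
  rewrite leNgt => /negP; apply; apply: le_lt_trans xy.
  move: Sz; rewrite /S /=; case: (leP x y) => xy' /andP[z1 z2].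
    by rewrite !ler0_norm; lra.
  by rewrite !ger0_norm; lra.
have cS : connected S.
  apply/connected_intervalP => u v /andP[u1 u2] /andP[v1 v2] w /andP[uw wv].
  by rewrite /S /= (le_trans u1 uw) (le_trans wv v2).
have SJ : S `&` J° = S `&` closure J.
  apply/seteqP; split => z [Sz zJ]; split => //.
    by apply: subset_closure; exact: interior_subset.
  exact: inS.
have main u v : S u -> S v -> J u -> J v.
  move=> Su Sv Ju.
  have BS : S `&` J° = S.
    apply: cS.
    - by exists u; split => //; apply: inS => //; exact: subset_closure.
    - by exists J° => //; exact: open_interior.
    - by exists (closure J) => //; exact: closed_closure.
  by apply: interior_subset; move: Sv; rewrite -BS => -[].
by split; exact: main.
Qed.

Lemma interval_union_bounds (b : R) (J : set R) :
  (exists s : seq (R * R), (forall p, p \in s -> b < p.1 /\ p.1 < p.2) /\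
    J = \bigcup_(p in [set` s]) `[p.1, p.2]%classic) ->
  exists jm jM, [/\ b < jm, jm <= jM & forall x, J x -> jm <= x <= jM].
Proof.
move=> [s [hs ->]]; elim: s hs => [|p s ih] hs.
  by exists (b + 1), (b + 1); split => [||x [q]]; rewrite ?ltrDl//= in_nil.
have [|jm [jM [bj jj hJ]]] := ih; first by move=> q qs; apply: hs; rewrite inE qs orbT.
have [bp pp] := hs p (mem_head _ _).
exists (Num.min p.1 jm), (Num.max p.2 jM); split.
- by rewrite lt_min bp bj.
- by rewrite ge_min !le_max (ltW pp).
- move=> x [q]; rewrite /= inE => /orP[/eqP ->|qs]; rewrite in_itv/= => xq.
    by rewrite ge_min le_max; move: xq => /andP[-> ->].
  have /andP[h1 h2] : jm <= x <= jM by apply: hJ; exists q => //=; rewrite in_itv/=.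
  by rewrite ge_min le_max h1 h2 !orbT.
Qed.

End interval_sets.

(** * Outlier locations *)

Section locations.
Context {R : realType}.
Variables (mu : probability R R) (c : R).
Local Notation b := (bulk_edge mu).
Hypothesis muB : mu `[0, b ^+ 2]%classic = 1%E.
Hypothesis hc : 0 < c <= 1.
Let b0 : 0 <= b. Proof. exact: bulk_edge_ge0. Qed.
Local Notation d := (dR mu c).
Local Notation rho := (rho mu c).
Local Notation ts := (theta_star mu c).

Definition dphitR (x : R) : R := c * dphiR mu x + (1 - c) * - (x ^- 2).

Definition ddR (x : R) : R :=
  dphiR mu x * phitR mu c x + phiR mu x * dphitR x.

Lemma taylor1_phitR a M : b < a -> a <= M -> taylor1 a M (phitR mu c) dphitR.
Proof.
move=> ba aM; apply: (@taylor1_eq _ a M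
  (fun x => c * phiR mu x + (1 - c) * x^-1)
  (fun x => (0 * phiR mu x + c * dphiR mu x)
     + (0 * x^-1 + (1 - c) * - (x ^- 2)))).
- by move=> x /andP[ax _]; rewrite phitRE//; exact: lt_le_trans ax.
- by move=> x _; rewrite !mul0r !add0r.
- apply: taylor1D; apply: taylor1M => //.
  + exact: taylor1_cst.
  + exact: taylor1_phiR.
  + exact: taylor1_cst.
  + by apply: taylor1_inv; exact: le_lt_trans ba.
Qed.

Lemma taylor1_dR a M : b < a -> a <= M -> taylor1 a M d ddR.
Proof.
move=> ba aM; apply: (@taylor1_eq _ a M
  (fun x => phiR mu x * phitR mu c x) ddR) => //.
- by move=> x /andP[ax _]; rewrite dRE//; exact: lt_le_trans ax.
- by apply: taylor1M => //; [exact: taylor1_phiR|exact: taylor1_phitR].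
Qed.

Lemma derive1_dR x : b < x -> derive1 d x = ddR x.
Proof.
move=> bx; apply: (@taylor1_derive1 _ ((b + x) / 2) (x + 1)).
  by apply: taylor1_dR; lra.
by apply/andP; split; lra.
Qed.

Lemma dR_continuous x : b < x -> {for x, continuous d}.
Proof.
move=> bx; apply: (@taylor1_continuous _ ((b + x) / 2) (x + 1) _ ddR).
  by apply: taylor1_dR; lra.
by apply/andP; split; lra.
Qed.

Lemma dphiR_lt0 x : b < x -> dphiR mu x < 0.
Proof.
move=> bx; rewrite oppr_lt0; have x0 := le_lt_trans b0 bx.
apply: lt_le_trans (_ : x ^- 2 <= _); first by rewrite invr_gt0 exprn_gt0.
rewrite -[leLHS](Ebulk_cst muB); apply: (Ebulk_le muB).
- exact: bulk_continuous_cst.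
- exact: bulk_continuous_dphi.
move=> t tD; have h := off_bulk bx tD.
have t0 : 0 <= t by case/andP: tD.
rewrite -invfM ler_pdivlMr ?mulr_gt0// ler_pdivrMl ?exprn_gt0//.
by nra.
Qed.

Lemma dphitR_lt0 x : b < x -> dphitR x < 0.
Proof.
move=> bx; have := dphiR_lt0 bx; rewrite /dphitR.
have : 0 < x ^- 2 by rewrite invr_gt0 exprn_gt0// (le_lt_trans b0 bx).
by case/andP: hc => c0 c1; nra.
Qed.

Lemma ddR_lt0 x : b < x -> ddR x < 0.
Proof.
move=> bx; have := dphiR_lt0 bx; have := dphitR_lt0 bx.
by have := phiR_gt0 muB bx; have := phitR_gt0 muB hc bx; rewrite /ddR; nra.
Qed.

Hypothesis hedge : edge_condition mu c.

Lemma dR_le_edge x : b < x -> d x <= d_edge mu c.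
Proof.
move=> bx; apply: limr_ge; first by case: hedge.
near=> y; apply: ltW; apply: dR_decr => //.
Unshelve. all: by end_near. Qed.

Lemma theta_star_gt0 : 0 < ts.
Proof. by rewrite invr_gt0 sqrtr_gt0; case: hedge. Qed.

Lemma theta_star2 : ts ^- 2 = d_edge mu c.
Proof. by rewrite -exprVn invrK sqr_sqrtr// ltW//; case: hedge. Qed.

Lemma rho_spec t : ts < t -> b < rho t /\ d (rho t) = t ^- 2.
Proof.
move=> tst; have t0 := lt_trans theta_star_gt0 tst; have b0' := b0.
suff [x xP] : exists x, b < x /\ d x = t ^- 2.
  rewrite /Defs.rho tst.
  exact: (@xgetPex _ b [set z | b < z /\ d z = t ^- 2] (ex_intro _ x xP)).
have td : t ^- 2 < d_edge mu c.
  by rewrite -theta_star2; apply: inv2_anti => //; exact: theta_star_gt0.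
have [x1 [bx1 dx1]] : exists x1, b < x1 /\ t ^- 2 < d x1.
  apply: contrapT => /forallNP h.
  have : d_edge mu c <= t ^- 2.
    apply: limr_le; first by case: hedge.
    near=> y; have by_ : b < y by near: y; exact: nbhs_right_gt.
    by rewrite leNgt; apply/negP => dy; apply: (h y).
  by rewrite leNgt td.
have [x2 [x12 dx2]] : exists x2, x1 < x2 /\ d x2 < t ^- 2.
  pose M := x1 + 2 * b + 3 * t + 1.
  have Mb : b < M by rewrite /M; lra.
  exists M; split; first by rewrite /M; lra.
  have M0 : 0 < M by rewrite /M; lra.
  have p2 : phiR mu M <= 2 / M.
    apply: le_trans (phiR_le muB Mb) _.
    have Mb2 : 2 * b <= M by rewrite /M; lra.
    have h : 0 < M ^+ 2 - b ^+ 2 by nra.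
    by rewrite ler_pdivrMr// mulrAC ler_pdivlMr//; nra.
  have p3 : phitR mu c M <= 2 / M.
    rewrite phitRE//; have h : 0 < M^-1 by rewrite invr_gt0.
    by case/andP: hc => c0 c1; move: p2 h; set u := M^-1; nra.
  rewrite dRE//; apply: le_lt_trans (_ : 2 / M * (2 / M) < _).
    by apply: ler_pM => //; apply: ltW; [exact: phiR_gt0|exact: phitR_gt0].
  rewrite (_ : 2 / M * (2 / M) = (M / 2) ^- 2); last by field; rewrite gt_eqF.
  by apply: inv2_anti => //; rewrite /M; lra.
have [||x xx dx] := @IVT R d x1 x2 (t ^- 2) (ltW x12).
- apply: continuous_in_subspaceT => y; rewrite inE/= in_itv/= => /andP[y1 _].
  by apply: dR_continuous; exact: lt_le_trans y1.
- by rewrite ge_min le_max (ltW dx1) (ltW dx2) !orbT.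
exists x; split => //; move: xx; rewrite in_itv/= => /andP[x1x _].
exact: lt_le_trans x1x.
Unshelve. all: by end_near. Qed.

(** [rho] is locally Lipschitz, because [d] decreases at least as fast as the
   inverse square. *)
Lemma rho_close (t0 eta : R) : ts < t0 -> 0 < eta ->
  exists2 tau, 0 < tau & forall t, `|t - t0| <= tau ->
    ts < t /\ `|rho t - rho t0| <= eta.
Proof.
move=> tt0 eta0; have tsp := theta_star_gt0.
have t00 : 0 < t0 := lt_trans tsp tt0.
have [br0 dr0] := rho_spec tt0.
set r0 := rho t0 in br0 dr0 *; have r00 : 0 < r0 := le_lt_trans b0 br0.
set A := 10 / t0 ^+ 3.
have A0 : 0 < A by rewrite divr_gt0// exprn_gt0.
set q := r0 ^- 2; have q0 : 0 < q by rewrite invr_gt0 exprn_gt0.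
set M3 := (2 * r0) ^+ 3; have M30 : 0 < M3 by rewrite exprn_gt0// mulr_gt0.
have A2 : 0 < 2 * A by lra.
have MA : 0 < M3 * A by exact: mulr_gt0.
pose tau := Num.min (Num.min (t0 / 2) ((t0 - ts) / 2))
              (Num.min (q / (2 * A)) (eta / (M3 * A))).
have tau0 : 0 < tau.
  rewrite !lt_min; apply/andP; split; apply/andP; split.
  - by lra.
  - by lra.
  - by rewrite divr_gt0.
  - by rewrite divr_gt0.
exists tau => // t; rewrite /tau !le_min => /andP[/andP[h1 h2] /andP[h3 h4]].
have tst : ts < t by move: h2; rewrite ler_norml; lra.
split => //; have [br dr] := rho_spec tst.
set r := rho t in br dr *; have rp : 0 < r := le_lt_trans b0 br.
have H : `|r ^- 2 - r0 ^- 2| <= A * `|t - t0|.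
  apply: le_trans (inv2_close t00 h1); rewrite -dr -dr0.
  have [rr|rr|->] := ltgtP r r0; last by rewrite !subrr.
  - have := dRB muB hc br rr; have := inv2_anti rp rr => g1 g2.
    by rewrite !ger0_norm; lra.
  - have := dRB muB hc br0 rr; have := inv2_anti r00 rr => g1 g2.
    by rewrite !ler0_norm; lra.
have r2 : r <= 2 * r0.
  have : A * `|t - t0| <= q / 2.
    by move: h3; rewrite ler_pdivlMr//; lra.
  move=> h; have : (2 * r0) ^- 2 <= r ^- 2.
    move: (le_trans H h); rewrite -/q ler_norml => /andP[g _].
    rewrite exprMn invfM -/q; lra.
  rewrite lef_pV2 ?posrE ?exprn_gt0 ?mulr_gt0// ler_sqr// nnegrE; first exact: ltW.
  by rewrite mulr_ge0// ltW.
have r02 : r0 <= 2 * r0 by lra.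
apply: le_trans (@inv2_lip _ r r0 (2 * r0) _ _) _; rewrite ?rp ?r00//.
rewrite -/M3; apply: le_trans (_ : M3 * (A * `|t - t0|) <= _).
  by rewrite ler_pM2l.
by move: h4; rewrite ler_pdivlMr//; lra.
Qed.

(** Beyond the threshold [t ^- 2 = d (rho t)] and [d] is quantitatively strictly
   decreasing; below it [t ^- 2] is at least the edge value of [d], which exceeds
   [d z] by a fixed amount since [z] stays away from the edge. *)
Lemma secular_gap (jm jM del : R) : b < jm -> jm <= jM -> 0 < del ->
  exists2 eta, 0 < eta & forall t z, 0 < t -> jm <= z <= jM ->
    del <= `|rho t - z| \/ t <= ts -> eta <= `|t ^- 2 - d z|.
Proof.
move=> bj jj del0; have b0' := b0; set h := (b + jm) / 2.
have bh : b < h by rewrite /h; lra.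
have hj : h < jm by rewrite /h; lra.
have h0 := le_lt_trans b0 bh.
have jM0 : 0 < jM by lra.
set e1 := h ^- 2 - jm ^- 2; set e2 := del ^+ 2 / (jM + del) ^+ 4.
have e10 : 0 < e1 by rewrite subr_gt0; exact: inv2_anti.
have e20 : 0 < e2 by rewrite divr_gt0 ?exprn_gt0//; lra.
exists (Num.min e1 e2); first by rewrite lt_min e10.
move=> t z t0 /andP[jz zM] H.
have bz : b < z by lra.
have z0 : 0 < z by lra.
have [tst|tst] := leP t ts.
  have t2 : d_edge mu c <= t ^- 2.
    rewrite -theta_star2 lef_pV2 ?posrE ?exprn_gt0 ?theta_star_gt0//.
    by rewrite ler_sqr ?nnegrE// ltW// theta_star_gt0.
  have g1 := dR_le_edge bh; have g2 := dRB muB hc bh (lt_le_trans hj jz).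
  have g3 : z ^- 2 <= jm ^- 2.
    by rewrite lef_pV2 ?posrE ?exprn_gt0//; [rewrite ler_sqr ?nnegrE|]; lra.
  rewrite ge_min; apply/orP; left.
  apply: le_trans (ler_norm _); rewrite /e1; lra.
case: H => [H|]; last by rewrite leNgt tst.
have [br dr] := rho_spec tst; rewrite -dr.
set r := rho t in br dr H *; have rp : 0 < r := le_lt_trans b0 br.
rewrite ge_min; apply/orP; right.
have [rz|zr] := leP r z.
  move: H; rewrite ler0_norm ?subr_le0// opprB => H.
  have rz' : r < z by lra.
  have g1 := dRB muB hc br rz'.
  have g2 := @inv2_gap _ r z del jM rp del0 ltac:(lra) ltac:(lra).
  by apply: le_trans (ler_norm _); rewrite /e2; lra.
move: H; rewrite gtr0_norm ?subr_gt0// => H.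
have g1 := dRB muB hc bz zr.
have g2 := @inv2_gap _ z r del jM z0 del0 ltac:(lra) ltac:(lra).
by rewrite distrC; apply: le_trans (ler_norm _); rewrite /e2; lra.
Qed.

Lemma dR_inv_lip (x y M : R) : b < x <= M -> b < y <= M ->
  `|x - y| <= M ^+ 3 * `|d x - d y|.
Proof.
wlog xy : x y / x < y => [H|].
  have [xy|yx|->] := ltgtP x y; first exact: H.
    by move=> hx hy; rewrite distrC (distrC (d x)); exact: H.
  by rewrite !subrr normr0 mulr0.
move=> /andP[bx xM] /andP[by_ yM].
have x0 := le_lt_trans b0 bx; have y0 := lt_trans x0 xy.
apply: le_trans (@inv2_lip _ x y M _ _) _; rewrite ?x0 ?y0//.
rewrite ler_wpM2l ?exprn_ge0 ?(le_trans (ltW x0))//.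
have := dRB muB hc bx xy; have := inv2_anti x0 xy => g1 g2.
by rewrite !gtr0_norm; lra.
Qed.

End locations.

(** * Coordinates of the cluster *)

Section selection.
Context {R : realType}.
Local Notation C := R[i].

Definition sel {k : nat} (I : {set 'I_k}) : 'M[C]_(k, #|I|) := columns 1%:M I.

Definition restr {k : nat} (I : {set 'I_k}) (v : 'cV[C]_k) : 'cV[C]_k :=
  \col_i (if i \in I then v i 0 else 0).

Lemma columnsE p k (A : 'M[C]_(p, k)) (I : {set 'I_k}) :
  columns A I = A *m sel I.
Proof. by rewrite /sel /columns mulmx_colsub mulmx1. Qed.

Lemma sel_iso k (I : {set 'I_k}) : (sel I)^t* *m sel I = 1%:M.
Proof.
apply/matrixP => i j; rewrite !mxE (bigD1 (enum_val i))//= big1 ?addr0.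
  by rewrite !mxE eqxx rmorph1 mul1r (inj_eq enum_val_inj).
by move=> l li; rewrite !mxE (negbTE li) conjC0 mul0r.
Qed.

Lemma selK k (I : {set 'I_k}) (v : 'cV[C]_k) :
  sel I *m ((sel I)^t* *m v) = restr I v.
Proof.
apply/matrixP => i j; rewrite (ord1 j) !mxE.
have selT l : ((sel I)^t* *m v) l 0 = v (enum_val l) 0.
  rewrite mxE (bigD1 (enum_val l))//= big1 ?addr0.
    by rewrite !mxE eqxx rmorph1 mul1r.
  by move=> a al; rewrite !mxE (negbTE al) conjC0 mul0r.
have [iI|iI] := boolP (i \in I).
  rewrite (bigD1 (enum_rank_in iI i))//= big1 ?addr0.
    by rewrite selT !mxE enum_rankK_in// eqxx mul1r.
  move=> l li; rewrite !mxE (_ : i == enum_val l = false) ?mul0r//.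
  apply/negbTE; apply: contra li => /eqP il.
  by apply/eqP/enum_val_inj; rewrite enum_rankK_in.
rewrite big1// => l _; rewrite !mxE (_ : i == enum_val l = false) ?mul0r//.
by apply/negbTE; apply: contra iI => /eqP ->; exact: enum_valP.
Qed.

Lemma l2norm_sel k (I : {set 'I_k}) (s : 'cV[C]_#|I|) :
  l2norm (sel I *m s) = l2norm s.
Proof. exact: isometryP (sel_iso I). Qed.

Lemma l2norm_restr k (I : {set 'I_k}) (v : 'cV[C]_k) :
  l2norm (restr I v) = l2norm ((sel I)^t* *m v).
Proof. by rewrite -selK l2norm_sel. Qed.

Lemma restrD k (I : {set 'I_k}) (u v : 'cV[C]_k) :
  restr I (u + v) = restr I u + restr I v.
Proof. by rewrite -!selK !mulmxDr. Qed.

Lemma restrB k (I : {set 'I_k}) (u v : 'cV[C]_k) :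
  restr I (u - v) = restr I u - restr I v.
Proof. by rewrite -!selK !mulmxBr. Qed.

Lemma restrZ k (I : {set 'I_k}) (a : C) (v : 'cV[C]_k) :
  restr I (a *: v) = a *: restr I v.
Proof. by rewrite -!selK -!scalemxAr. Qed.

Lemma restr_sel k (I : {set 'I_k}) (s : 'cV[C]_#|I|) :
  restr I (sel I *m s) = sel I *m s.
Proof. by rewrite -selK (mulmxA ((sel I)^t*)) sel_iso mul1mx. Qed.

Lemma l2norm_le_pointwise k (v e f : 'cV[C]_k) (a : R) : 0 <= a ->
  (forall i, cabs (v i 0) <= a * (cabs (e i 0) + cabs (f i 0))) ->
  l2norm v <= 2 * a * (l2norm e + l2norm f).
Proof.
move=> a0 h; have ne := l2norm_ge0 e; have nf := l2norm_ge0 f.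
rewrite -ler_sqr ?nnegrE ?l2norm_ge0//; last by rewrite mulr_ge0// ?mulr_ge0 ?addr_ge0.
apply: le_trans (_ : 2 * a ^+ 2 * (l2norm e ^+ 2 + l2norm f ^+ 2) <= _); last first.
  by have := sqr_ge0 a; have := mulr_ge0 ne nf; nra.
rewrite !l2norm2E -big_split mulr_sumr; apply: ler_sum => i _ /=.
have c1 := cabs_ge0 (e i 0); have c2 := cabs_ge0 (f i 0).
have c3 := cabs_ge0 (v i 0); have h1 := h i.
apply: le_trans (_ : (a * (cabs (e i 0) + cabs (f i 0))) ^+ 2 <= _).
  by rewrite ler_sqr ?nnegrE// (le_trans c3).
have h2 : (cabs (e i 0) + cabs (f i 0)) ^+ 2
    <= 2 * (cabs (e i 0) ^+ 2 + cabs (f i 0) ^+ 2).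
  by have := sqr_ge0 (cabs (e i 0) - cabs (f i 0)); lra.
by rewrite exprMn; have := ler_wpM2l (sqr_ge0 a) h2; lra.
Qed.

Lemma restr_cabs k (I : {set 'I_k}) (v : 'cV[C]_k) i :
  cabs (restr I v i 0) = if i \in I then cabs (v i 0) else 0.
Proof.
by rewrite mxE; case: ifP => // _; rewrite /cabs /= !expr0n addr0 sqrtr0.
Qed.

Lemma l2norm_mono k (v w : 'cV[C]_k) (a : R) : 0 <= a ->
  (forall i, cabs (v i 0) <= a * cabs (w i 0)) -> l2norm v <= a * l2norm w.
Proof.
move=> a0 h; rewrite -ler_sqr ?nnegrE ?mulr_ge0 ?l2norm_ge0//.
rewrite exprMn !l2norm2E mulr_sumr; apply: ler_sum => i _.
by rewrite -exprMn ler_sqr ?nnegrE ?mulr_ge0 ?cabs_ge0.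
Qed.

Lemma l2norm_restr_le k (I : {set 'I_k}) (v : 'cV[C]_k) :
  l2norm (restr I v) <= l2norm v.
Proof.
rewrite -[leRHS]mul1r; apply: l2norm_mono => // i; rewrite restr_cabs mul1r.
by case: ifP => // _; exact: cabs_ge0.
Qed.

Lemma restr_split k (I : {set 'I_k}) (v : 'cV[C]_k) :
  v = restr I v + restr (~: I) v.
Proof.
apply/matrixP => i j; rewrite (ord1 j) !mxE inE.
by case: ifP => _; rewrite ?addr0 ?add0r.
Qed.

Definition scal {k : nat} (th : 'rV[R]_k) : 'M[C]_k := diag_mx (cmx th).

Lemma scalE k (th : 'rV[R]_k) (v : 'cV[C]_k) i :
  (scal th *m v) i 0 = (th 0 i)%:C * v i 0.
Proof. by rewrite mul_diag_mx !mxE. Qed.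

Lemma scal_adj k (th : 'rV[R]_k) : (scal th)^t* = scal th.
Proof.
rewrite /scal tr_diag_mx map_diag_mx; congr diag_mx.
by apply/matrixP => i j; rewrite !mxE; exact: (conjc_real (th i j)).
Qed.

Lemma restr_scal k (I : {set 'I_k}) (th : 'rV[R]_k) (t0 del : R) (v : 'cV[C]_k) :
  0 <= del -> (forall i, i \in I -> `|th 0 i - t0| <= del) ->
  l2norm (restr I (scal th *m v) - t0%:C *: restr I v) <= del * l2norm v.
Proof.
move=> d0 h; have := scalE th v; move: (scal th *m v) => w wE.
apply: l2norm_mono => // i; rewrite !mxE.
case: ifP => iI; last first.
  by rewrite mulr0 subrr /cabs /= !expr0n addr0 sqrtr0 mulr_ge0 ?cabs_ge0.
by rewrite wE -mulrBl -rmorphB cabsM cabs_real ler_wpM2r ?cabs_ge0 ?h.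
Qed.

End selection.

(** * The compressed resolvent of the noise *)

Section resolvent.
Context {R : realType}.
Local Notation C := R[i].
Variables (p q k : nat) (X : 'M[C]_(p, q)) (U : 'M[C]_(p, k)) (V : 'M[C]_(q, k)).
Variable beta : R.
Hypothesis beta0 : 0 <= beta.
Hypothesis hX : forall v, l2norm (X *m v) <= beta * l2norm v.
Hypothesis UU : U^t* *m U = 1%:M.
Hypothesis VV : V^t* *m V = 1%:M.

Definition shifted (x : R) : 'M[C]_(p + q) := x%:C%:M - linX X.

Lemma linX_col (u : 'cV_p) (v : 'cV_q) : linX X *m col_mx u v = col_mx (X *m v) (X^t* *m u).
Proof. by rewrite /linX mul_block_col !mul0mx add0r addr0. Qed.

Lemma linX_adj : (linX X)^t* = linX X.
Proof.
by rewrite /linX tr_block_mx map_block_mx !trmx0 !map_mx0 trmxCK.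
Qed.

Lemma linE_col (u v : 'cV[C]_k) : linE U V *m col_mx u v = col_mx (U *m u) (V *m v).
Proof. by rewrite /linE mul_block_col !mul0mx add0r addr0. Qed.

Lemma linE_adj_col (u : 'cV[C]_p) (v : 'cV[C]_q) :
  (linE U V)^t* *m col_mx u v = col_mx (U^t* *m u) (V^t* *m v).
Proof.
by rewrite /linE tr_block_mx map_block_mx !trmx0 !map_mx0 mul_block_col
  !mul0mx add0r addr0.
Qed.

Lemma linE_iso : (linE U V)^t* *m linE U V = 1%:M.
Proof.
rewrite /linE tr_block_mx map_block_mx !trmx0 !map_mx0 mulmx_block.
by rewrite !mul0mx !mulmx0 !addr0 add0r UU VV -scalar_mx_block.
Qed.

Lemma l2norm_linE (y : 'cV_(k + k)) : l2norm (linE U V *m y) = l2norm y.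
Proof. exact: isometryP linE_iso. Qed.

Lemma l2norm_linEadj (z : 'cV_(p + q)) : l2norm ((linE U V)^t* *m z) <= l2norm z.
Proof.
rewrite -[leRHS]mul1r; apply: (@bound_adj _ _ _ (linE U V) 1) => // v.
by rewrite l2norm_linE mul1r.
Qed.

Lemma l2norm_linX (z : 'cV_(p + q)) : l2norm (linX X *m z) <= beta * l2norm z.
Proof.
rewrite -[z]vsubmxK linX_col -ler_sqr ?nnegrE ?mulr_ge0 ?l2norm_ge0//.
rewrite exprMn !l2norm_col mulrDr -!exprMn addrC.
by apply: lerD; rewrite ler_sqr ?nnegrE ?mulr_ge0 ?l2norm_ge0//; exact: bound_adj.
Qed.

Lemma shiftedE x (z : 'cV_(p + q)) : shifted x *m z = x%:C *: z - linX X *m z.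
Proof. by rewrite /shifted mulmxBl mul_scalar_mx. Qed.

Lemma shifted_le x (z : 'cV_(p + q)) : 0 <= x -> l2norm (shifted x *m z) <= (x + beta) * l2norm z.
Proof.
move=> x0; rewrite shiftedE; apply: le_trans (l2normB _ _) _.
by rewrite l2normZ ger0_norm// mulrDl lerD2l l2norm_linX.
Qed.

Lemma shifted_ge x (z : 'cV_(p + q)) : 0 <= x -> (x - beta) * l2norm z <= l2norm (shifted x *m z).
Proof.
move=> x0; rewrite shiftedE mulrBl.
have := l2norm_tri (x%:C *: z) (linX X *m z); rewrite l2normZ ger0_norm//.
by have := l2norm_linX z; lra.
Qed.

Lemma shifted_sym x (u v : 'cV_(p + q)) : rdot (shifted x *m u) v = rdot u (shifted x *m v).
Proof.
rewrite !shiftedE rdotBl rdotBr rdotZl rdotZr; congr (_ - _).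
by rewrite rdot_adj linX_adj.
Qed.

Definition gap_at (M : 'M[C]_(k + k)) (eps x : R) : Prop :=
  shifted x \in unitmx /\
  forall y : 'cV_(k + k), l2norm (linG X U V x%:C *m y - M *m y) <= eps * l2norm y.

Lemma resolvent_le x (f : 'cV_(p + q)) : beta < x -> shifted x \in unitmx ->
  l2norm (invmx (shifted x) *m f) <= l2norm f / (x - beta).
Proof.
move=> bx ux; have xb : 0 < x - beta by rewrite subr_gt0.
rewrite ler_pdivlMr// mulrC; have x0 : 0 <= x := le_trans beta0 (ltW bx).
by apply: le_trans (shifted_ge _ x0) _; rewrite mulmxA mulmxV// mul1mx.
Qed.

Lemma resolvent_sym x (u v : 'cV_(p + q)) : shifted x \in unitmx ->
  rdot (invmx (shifted x) *m u) v = rdot u (invmx (shifted x) *m v).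
Proof.
move=> ux; rewrite -{1}[v]mul1mx -(mulmxV ux) -mulmxA -shifted_sym.
by rewrite mulmxA mulmxV// mul1mx.
Qed.

Lemma linG_E x (y : 'cV_(k + k)) : linG X U V x%:C *m y
  = (linE U V)^t* *m (invmx (shifted x) *m (linE U V *m y)).
Proof. by rewrite /linG -!mulmxA. Qed.

(** Apply the resolvent and compress: the local law replaces [G(x) y] by [M y]
   with an error controlled by [y], not by [K].  The last bound holds because
   [E] is an isometry. *)
Lemma compressed_equation M eps x (z : 'cV_(p + q)) y f : beta < x -> gap_at M eps x ->
  shifted x *m z = linE U V *m y + f ->
  [/\ l2norm ((linE U V)^t* *m z - M *m y)
        <= eps * l2norm y + l2norm f / (x - beta),
      l2norm z <= (l2norm y + l2norm f) / (x - beta) &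
      l2norm y <= (x + beta) * l2norm z + l2norm f].
Proof.
move=> bx [ux gx] ez; have x0 : 0 <= x := le_trans beta0 (ltW bx).
have zE : z = invmx (shifted x) *m (linE U V *m y) + invmx (shifted x) *m f.
  by rewrite -mulmxDr -ez mulmxA mulVmx// mul1mx.
split.
- rewrite {1}zE mulmxDr -linG_E addrAC; apply: le_trans (l2normD _ _) _.
  apply: lerD; first exact: gx.
  exact: le_trans (l2norm_linEadj _) (resolvent_le _ bx ux).
- rewrite mulrDl {1}zE; apply: le_trans (l2normD _ _) _.
  by rewrite -(l2norm_linE y) lerD ?resolvent_le.
- rewrite -(l2norm_linE y) -[linE U V *m y](addrK f) -ez.
  apply: le_trans (l2normB _ _) _; rewrite lerD2r; exact: shifted_le.
Qed.

(** By the first resolvent identity the left-hand side is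
   [- h^2 <z, (x + h - calX)^-1 z>] with [z = (x - calX)^-1 E y].  In this way the
   norm of [z], a second-order quantity, is read off from values of [G]. *)
Lemma resolvent_increment (x h : R) (y : 'cV[C]_(k + k)) : beta < x -> 0 < h ->
  shifted x \in unitmx -> shifted (x + h) \in unitmx ->
  `|rdot y (linG X U V x%:C *m y) - rdot y (linG X U V (x + h)%:C *m y)
    - h * l2norm (invmx (shifted x) *m (linE U V *m y)) ^+ 2|
  <= h ^+ 2 / (x - beta) * l2norm (invmx (shifted x) *m (linE U V *m y)) ^+ 2.
Proof.
move=> bx h0 ux uh.
set z := invmx (shifted x) *m (linE U V *m y).
set z' := invmx (shifted (x + h)) *m (linE U V *m y).
have xb : 0 < x - beta by lra.
have Ez : shifted x *m z = linE U V *m y by rewrite mulmxA mulmxV// mul1mx.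
have sxh (w : 'cV_(p + q)) : shifted (x + h) *m w = shifted x *m w + h%:C *: w.
  by rewrite !shiftedE rmorphD scalerDl addrAC.
have zz' : z = z' + h%:C *: (invmx (shifted (x + h)) *m z).
  rewrite scalemxAr -mulmxDr -Ez -sxh mulmxA mulVmx// mul1mx.
  by [].
rewrite !linG_E -/z -/z' -rdotBr -mulmxBr -rdot_adj.
have -> : z - z' = h%:C *: (invmx (shifted (x + h)) *m z) by rewrite {1}zz' addrC addKr.
rewrite rdotZr -resolvent_sym// -/z'.
have -> : rdot z' z = l2norm z ^+ 2 - h * rdot (invmx (shifted (x + h)) *m z) z.
  by rewrite l2norm2 {2}zz' rdotDl rdotZl addrK.
rewrite mulrBr addrAC subrr add0r normrN !normrM (gtr0_norm h0) mulrA -expr2 -mulrA.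
rewrite ler_wpM2l ?sqr_ge0//; apply: le_trans (rdot_abs _ _) _.
rewrite expr2 mulrA ler_wpM2r ?l2norm_ge0//.
apply: le_trans (resolvent_le _ _ uh) _; first by lra.
rewrite mulrC ler_wpM2r ?l2norm_ge0// lef_pV2 ?posrE//; lra.
Qed.

End resolvent.

(** * The secular equation and the location of singular values *)

Section secular.
Context {R : realType}.
Local Notation C := R[i].

(** It bounds [(ph + pt + t^-1) / |t ^- 2 - ph * pt|] over all [t > 0] for which
   the denominator is at least [eta]; for small [t] the denominator wins. *)
Definition secular_const (ph pt eta : R) : R := (ph + pt + 1 + ph * pt) / eta + 1.

Lemma secular_const_ge0 ph pt eta : 0 < ph -> 0 < pt -> 0 < eta ->
  0 <= secular_const ph pt eta.
Proof.
move=> p0 t0 e0; apply: addr_ge0 => //; apply: divr_ge0; last exact: ltW.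
by have := mulr_gt0 p0 t0; lra.
Qed.

(** Eliminating one unknown gives
   [(t ^- 2 - ph * pt) (t x1) = ph e2 + t^-1 e1]. *)
Lemma secular_scalar (ph pt eta t : R) (x1 x2 e1 e2 : C) :
  0 < ph -> 0 < pt -> 0 < t -> 0 < eta -> eta <= `|t ^- 2 - ph * pt| ->
  x1 = ph%:C * (t%:C * x2) + e1 -> x2 = pt%:C * (t%:C * x1) + e2 ->
  cabs (t%:C * x1) <= secular_const ph pt eta * (cabs e1 + cabs e2).
Proof.
move=> ph0 pt0 t0 eta0; set D := `|_| => etaD E1 E2.
have D0 : 0 < D by exact: lt_le_trans etaD.
set u := t^-1; have u0 : 0 < u by rewrite invr_gt0.
have c1 := cabs_ge0 e1; have c2 := cabs_ge0 e2.
have key : (t ^- 2 - ph * pt)%:C * (t%:C * x1) = ph%:C * e2 + u%:C * e1.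
  have tC : t%:C != 0 :> C by rewrite fmorph_eq0 gt_eqF.
  have ut : u%:C * t%:C = 1 :> C by rewrite -rmorphM mulVf ?gt_eqF.
  have -> : t ^- 2 = u * u by rewrite /u -invfM -expr2.
  rewrite rmorphB !rmorphM mulrBl.
  rewrite (_ : u%:C * u%:C * (t%:C * x1) = u%:C * x1); last first.
    by rewrite -mulrA (mulrA u%:C t%:C) ut mul1r.
  rewrite {1}E1 mulrDr (_ : u%:C * (ph%:C * (t%:C * x2)) = ph%:C * x2); last first.
    by rewrite mulrCA (mulrA u%:C) ut mul1r.
  by rewrite {1}E2; ring.
have keyn : D * cabs (t%:C * x1) <= (ph + pt + u) * (cabs e1 + cabs e2).
  have -> : D * cabs (t%:C * x1) = cabs (ph%:C * e2 + u%:C * e1).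
    by rewrite -key [RHS]cabsM cabs_real.
  apply: le_trans (cabsD _ _) _; rewrite !cabsM !cabs_real !gtr0_norm//.
  by nra.
have uD : ph + pt + u <= secular_const ph pt eta * D.
  have u2 : u ^+ 2 <= ph * pt + D.
    have := ler_norm (t ^- 2 - ph * pt); rewrite -/D -exprVn -/u; lra.
  have h1 : ph + pt + 1 + ph * pt <= (ph + pt + 1 + ph * pt) / eta * D.
    rewrite mulrAC ler_pdivlMr// ler_wpM2l//.
    by have := mulr_gt0 ph0 pt0; lra.
  have h2 : u <= 1 + u ^+ 2 by have := sqr_ge0 (u - 1); nra.
  by rewrite /secular_const; lra.
rewrite -(ler_pM2l D0); apply: le_trans keyn _.
by rewrite mulrA (mulrC D) ler_wpM2r// addr_ge0.
Qed.

Lemma secular_vector k (I : {set 'I_k}) (th : 'rV[R]_k) (ph pt eta : R)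
    (x1 x2 e1 e2 : 'cV[C]_k) :
  0 < ph -> 0 < pt -> 0 < eta ->
  (forall i, i \in I -> 0 < th 0 i /\ eta <= `|th 0 i ^- 2 - ph * pt|) ->
  x1 = ph%:C *: (scal th *m x2) + e1 -> x2 = pt%:C *: (scal th *m x1) + e2 ->
  l2norm (restr I (scal th *m x1))
    <= 2 * secular_const ph pt eta * (l2norm e1 + l2norm e2).
Proof.
move=> ph0 pt0 eta0 hI E1 E2.
have c0 := secular_const_ge0 ph0 pt0 eta0.
apply: l2norm_le_pointwise => // i; rewrite restr_cabs.
have e1c := cabs_ge0 (e1 i 0); have e2c := cabs_ge0 (e2 i 0).
case: ifP => iI; last by rewrite mulr_ge0// addr_ge0.
have [t0 te] := hI i iI; rewrite scalE.
apply: (@secular_scalar _ _ _ _ _ (x2 i 0)) => //.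
- move: (congr1 (fun v : 'cV_k => v i 0) E1); rewrite -scalE.
  by move: (scal th *m x2) => w; rewrite !mxE.
- move: (congr1 (fun v : 'cV_k => v i 0) E2); rewrite -scalE.
  by move: (scal th *m x1) => w; rewrite !mxE.
Qed.

End secular.

Lemma sum_bound (R : realType) (S n1 n2 a b t : R) : 0 <= S -> n1 <= t -> n2 <= t ->
  a <= 2 * S * (n2 + n1) -> b <= 2 * S * (n1 + n2) -> a + b <= 8 * (S * t).
Proof.
move=> S0 h1 h2 ha hb.
have h3 : n1 + n2 <= 2 * t by lra.
by have := ler_wpM2l S0 h3; lra.
Qed.

Section deterministic.
Context {R : realType}.
Local Notation C := R[i].
Variables (mu : probability R R) (c : R).
Local Notation b := (bulk_edge mu).
Hypothesis muB : mu `[0, b ^+ 2]%classic = 1%E.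
Hypothesis hc : 0 < c <= 1.
Let b0 : 0 <= b. Proof. exact: bulk_edge_ge0. Qed.
Local Notation ph := (phiR mu).
Local Notation pt := (phitR mu c).
Local Notation d := (dR mu c).

Lemma linM_col k (x : R) (y1 y2 : 'cV[C]_k) : b < x ->
  linM mu c k x%:C *m col_mx y1 y2
  = col_mx ((ph x)%:C *: y1) ((pt x)%:C *: y2).
Proof.
move=> bx; rewrite /linM mul_block_col !mul0mx add0r addr0 !mul_scalar_mx.
by rewrite phi_phiR// phit_phitR.
Qed.

Variables (p q k : nat) (X : 'M[C]_(p, q)) (U : 'M[C]_(p, k)) (V : 'M[C]_(q, k)).
Variables (th : 'rV[R]_k) (beta : R).
Hypothesis beta0 : 0 <= beta.
Hypothesis hX : forall v, l2norm (X *m v) <= beta * l2norm v.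
Hypothesis UU : U^t* *m U = 1%:M.
Hypothesis VV : V^t* *m V = 1%:M.
Hypothesis th0 : forall i, 0 < th 0 i.

Definition spiked : 'M[C]_(p, q) := X + U *m scal th *m V^t*.

Lemma spiked_adj : spiked^t* = X^t* + V *m scal th *m U^t*.
Proof.
by rewrite /spiked raddfD /= map_mxD -mulmxA !adjmxM trmxCK scal_adj.
Qed.

(** The spike is moved to the right-hand side, where it lies in the range of
   [E]; this holds for the singular system itself and also with forcing terms. *)
Lemma spiked_system (x : R) (u f1 : 'cV[C]_p) (v f2 : 'cV[C]_q) (a : 'cV[C]_k) :
  x%:C *: u - spiked *m v = U *m a + f1 ->
  x%:C *: v - spiked^t* *m u = f2 ->
  shifted X x *m col_mx u v =
    linE U V *m col_mx (a + scal th *m (V^t* *m v)) (scal th *m (U^t* *m u))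
    + col_mx f1 f2.
Proof.
rewrite spiked_adj /spiked => e1 e2.
rewrite shiftedE linX_col linE_col add_col_mx scale_col_mx opp_col_mx add_col_mx.
congr col_mx.
  rewrite mulmxDr addrAC -e1.
  have -> : (X + U *m scal th *m V^t*) *m v
      = X *m v + U *m (scal th *m (V^t* *m v)) by rewrite mulmxDl !mulmxA.
  by rewrite opprD addrA subrK.
rewrite -e2.
have -> : (X^t* + V *m scal th *m U^t*) *m u
    = X^t* *m u + V *m (scal th *m (U^t* *m u)) by rewrite mulmxDl !mulmxA.
by rewrite [RHS]addrC opprD [in RHS]addrA subrK.
Qed.

(** Otherwise all the coordinates of the source term [y] would be of order [eps]
   times its norm. *)
Lemma outlier_location (s eta eps : R) (u : 'cV[C]_p) (v : 'cV[C]_q) :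
  beta < s -> b < s -> gap_at X U V (linM mu c k s%:C) eps s ->
  spiked *m v = s%:C *: u -> spiked^t* *m u = s%:C *: v -> u != 0 ->
  0 < eta -> (forall i, eta <= `|th 0 i ^- 2 - d s|) ->
  1 <= 8 * secular_const (ph s) (pt s) eta * eps.
Proof.
move=> bs bs' hG e1 e2 u0 eta0 he.
set xu := U^t* *m u; set xv := V^t* *m v.
set y := col_mx (scal th *m xv) (scal th *m xu).
have ph0 := phiR_gt0 muB bs'; have pt0 := phitR_gt0 muB hc bs'.
have cc0 := secular_const_ge0 ph0 pt0 eta0.
have sys : shifted X s *m col_mx u v = linE U V *m y + 0.
  rewrite (@spiked_system s u 0 v 0 0); first by rewrite add0r col_mx0.
    by rewrite e1 subrr mulmx0 addr0.
  by rewrite e2 subrr.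
have [H1 H2 _] := compressed_equation beta0 hX UU VV bs hG sys.
rewrite l2norm0 mul0r addr0 in H1; rewrite l2norm0 addr0 in H2.
have y0 : 0 < l2norm y.
  have sb : 0 < (s - beta)^-1 by rewrite invr_gt0 subr_gt0.
  rewrite -(pmulr_lgt0 _ sb); apply: lt_le_trans H2.
  by apply: lt_le_trans (l2norm_colu _ _); exact: l2norm_gt0.
move: H1; rewrite linE_adj_col linM_col// -/xu -/xv opp_col_mx add_col_mx.
set e1' := xu - _; set e2' := xv - _ => H1.
have E1 : xu = (ph s)%:C *: (scal th *m xv) + e1' by rewrite /e1' addrC subrK.
have E2 : xv = (pt s)%:C *: (scal th *m xu) + e2' by rewrite /e2' addrC subrK.
have hd i : i \in [set: 'I_k]%SET -> 0 < th 0 i /\ eta <= `|th 0 i ^- 2 - ph s * pt s|.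
  by move=> _; rewrite -dRE.
have hd' i : i \in [set: 'I_k]%SET -> 0 < th 0 i /\ eta <= `|th 0 i ^- 2 - pt s * ph s|.
  by rewrite mulrC; exact: hd.
have B1 := secular_vector ph0 pt0 eta0 hd E1 E2.
have B2 := secular_vector pt0 ph0 eta0 hd' E2 E1.
have restrT w : restr [set: 'I_k]%SET w = w :> 'cV[C]_k.
  by apply/matrixP => i j; rewrite (ord1 j) mxE inE.
have secC : secular_const (pt s) (ph s) eta = secular_const (ph s) (pt s) eta.
  by rewrite /secular_const (mulrC (pt s)) (addrC (pt s)).
rewrite restrT in B1; rewrite restrT secC in B2.
have h1 : l2norm e1' <= eps * l2norm y := le_trans (l2norm_colu _ _) H1.
have h2 : l2norm e2' <= eps * l2norm y := le_trans (l2norm_cold _ _) H1.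
have yy := l2norm_col_le (scal th *m xv) (scal th *m xu).
rewrite -/y in yy.
rewrite -(ler_pM2r y0) mul1r; apply: le_trans yy _.
rewrite -!mulrA; exact: (sum_bound cc0 h1 h2 B2 B1).
Qed.

End deterministic.

(** Norms of matrix expressions enter the estimates only as real numbers, so they
   are generalized before the linear arithmetic. *)
Ltac gen_norms := repeat (match goal with
  | |- context [@l2norm ?R ?p ?v] => generalize (@l2norm R p v); intro
  | |- context [@rdot ?R ?p ?u ?v] => generalize (@rdot R p u v); intro
  | |- context [@secular_const ?R ?x ?y ?z] =>
      generalize (@secular_const R x y z); intro
  | |- context [@phiR ?R ?x ?y] => generalize (@phiR R x y); intro
  | |- context [@phitR ?R ?x ?z ?y] => generalize (@phitR R x z y); intro
  | |- context [@dphiR ?R ?x ?y] => generalize (@dphiR R x y); intro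
  | |- context [@dphitR ?R ?x ?z ?y] => generalize (@dphitR R x z y); intro
  end).
Ltac lra_norm := gen_norms; lra.

Lemma l2norm_sqr_dist (R : realType) k (u v : 'cV[R[i]]_k) (D A B : R) :
  l2norm (u - v) <= D -> l2norm u <= A -> l2norm v <= B ->
  `|l2norm u ^+ 2 - l2norm v ^+ 2| <= D * (A + B).
Proof.
move=> hD hA hB; have nu := l2norm_ge0 u; have nv := l2norm_ge0 v.
rewrite subr_sqr normrM; apply: ler_pM => //; last first.
  by rewrite ger0_norm ?addr_ge0// lerD.
rewrite ler_norml; have h1 := l2norm_tri u v; have h2 := l2norm_tri v u.
have e : l2norm (v - u) = l2norm (u - v) by rewrite -l2normN opprB.
by rewrite e in h2; lra.
Qed.

Lemma telescope_scale (K : pzRingType) (E : lmodType K) (y1 y2 x a : E) (t s : K) :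
  y1 + y2 - (t * s) *: a = y2 + ((y1 - t *: x) + t *: (x - s *: a)).
Proof. by rewrite scalerBr scalerA [X in y2 + X]addrA subrK addrA (addrC y2). Qed.

Lemma increment_numeric (R : realType) (h s s1 s2 F0 F1 p0 p1 t0 t1 dp dt a e f1 f2 : R) :
  `|F0 - F1 - h * s| <= a -> `|F0 - (p0 * s1 + t0 * s2)| <= e ->
  `|F1 - (p1 * s1 + t1 * s2)| <= e ->
  `|(p1 - p0 - h * dp) * s1| <= f1 -> `|(t1 - t0 - h * dt) * s2| <= f2 ->
  `|h * (s + (dp * s1 + dt * s2))| <= a + 2 * e + (f1 + f2).
Proof. by rewrite !ler_norml; lra. Qed.

Lemma gram_numeric (R : realType) (s s1 s2 A z2 dp dt Q t D1 D2 Z1 Z2 : R) :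
  `|dp * (s1 - Q * A)| <= D1 -> `|dt * (s2 - t * A)| <= D2 ->
  `|z2 - s| <= Z1 -> `|s + (dp * s1 + dt * s2)| <= Z2 ->
  `|- (dp * Q + dt * t) * A - z2| <= Z1 + Z2 + D1 + D2.
Proof. by rewrite !ler_norml; lra. Qed.

Lemma resonant_identity (K : comPzRingType) (x1 x2 x3 a w1 w2 w3 w4 : K) :
  x1 * x2 * x3 * x2 = 1 ->
  x1 * a = - (x1 * x2 * x3 * (w2 - x2 * w3)) - x1 * x2 * (w4 - x3 * w2)
    - x1 * (w1 - x2 * w4) - (w3 - x1 * (a + w1)).
Proof.
move=> res; rewrite [RHS](_ : _ = x1 * a + (x1 * x2 * x3 * x2 - 1) * w3); last by ring.
by rewrite res subrr mul0r addr0.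
Qed.

Lemma resonant_vector (R : realType) k (x1 x2 x3 x12 x123 : R[i])
    (a w1 w2 w3 w4 d1 d2 : 'cV[R[i]]_k) :
  x12 = x1 * x2 -> x123 = x12 * x3 -> x123 * x2 = 1 ->
  d1 = w3 - x1 *: (a + w1) -> d2 = w4 - x3 *: w2 ->
  x1 *: a = - (x123 *: (w2 - x2 *: w3)) - x12 *: d2
    - x1 *: (w1 - x2 *: w4) - d1.
Proof.
move=> -> -> res -> ->; apply/matrixP => i j; rewrite !mxE.
exact: resonant_identity.
Qed.

(** * The cluster equations *)

Section cluster.
Context {R : realType}.
Local Notation C := R[i].
Variables (mu : probability R R) (c : R).
Local Notation b := (bulk_edge mu).
Hypothesis muB : mu `[0, b ^+ 2]%classic = 1%E.
Hypothesis hc : 0 < c <= 1.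
Variables (rho0 theta0 beta : R).
Hypothesis beta0 : 0 <= beta.
Hypothesis brho0 : beta < rho0.
Hypothesis bulk_rho0 : b < rho0.
Hypothesis theta00 : 0 < theta0.
Hypothesis secular0 : dR mu c rho0 = theta0 ^- 2.
Local Notation ph := (phiR mu rho0).
Local Notation pt := (phitR mu c rho0).
Local Notation dph := (dphiR mu rho0).
Local Notation dpt := (dphitR mu c rho0).
Variables (kap eta CT : R).
Hypothesis kap0 : 0 <= kap.
Hypothesis eta0 : 0 < eta.
Hypothesis CT0 : 0 <= CT.
Local Notation g := ((rho0 - beta)^-1).

(** Dimension-free constants, for vectors of size [n] and the small parameter
   [del].  [source_const] bounds the source [y]; [defect_const], the defect
   [x - M y]; [off_cluster_const], the part of [y] outside the cluster;
   [right_source_const], [right_overlap_const] and [left_source_const], the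
   distances of [y_v], [x_v] and [y_u] from their multiples of [a];
   [response_const], the effect of freezing the spectral parameter; and
   [increment_const], that of the divided difference. *)
Definition source_const := (rho0 + beta) * 2 + kap.
Definition defect_const := source_const + kap * g.
Definition off_cluster_const := 2 * secular_const ph pt eta * (2 * defect_const).
Definition right_source_const := 2 + off_cluster_const.
Definition right_overlap_const := pt * 2 + defect_const.
Definition left_source_const := off_cluster_const + 2 + theta0 * right_overlap_const.
Definition source_ratio := pt * theta0 ^+ 2.
Definition response_const := kap * g * (2 + source_const * g).
Definition increment_const := g * (source_const * g) ^+ 2 + 2 * source_const ^+ 2 + CT * source_const ^+ 2.
Definition gram_const := response_const + increment_const + `|dph| * (left_source_const * (source_const + source_ratio * 2)) + `|dpt| * (right_source_const * (source_const + theta0 * 2)).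
(** The limit of [|(u; v)|^2 / |a|^2], obtained by inserting
   [y_u = pt * theta0^2 * a] and [y_v = theta0 * a] in
   [- phi' |y_u|^2 - phit' |y_v|^2]. *)
Definition gram := - (dph * source_ratio ^+ 2 + dpt * theta0 ^+ 2).

Variables (p q k : nat) (X : 'M[C]_(p, q)) (U : 'M[C]_(p, k)) (V : 'M[C]_(q, k)).
Variables (th : 'rV[R]_k) (I : {set 'I_k}) (del : R).
Hypothesis hX : forall v, l2norm (X *m v) <= beta * l2norm v.
Hypothesis UU : U^t* *m U = 1%:M.
Hypothesis VV : V^t* *m V = 1%:M.
Hypothesis th0 : forall i, 0 < th 0 i.
Hypothesis del0 : 0 < del.
Hypothesis del1 : del <= 1.
Hypothesis thI : forall i, i \in I -> `|th 0 i - theta0| <= del.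
Hypothesis gap0 : gap_at X U V (linM mu c k rho0%:C) (del ^+ 2) rho0.
Hypothesis gap1 : gap_at X U V (linM mu c k (rho0 + del)%:C) (del ^+ 2) (rho0 + del).

Let g0 : 0 < g. Proof. by rewrite invr_gt0 subr_gt0. Qed.
Let rho00 : 0 < rho0. Proof. exact: le_lt_trans brho0. Qed.
Let ph0 : 0 < ph. Proof. exact: phiR_gt0. Qed.
Let pt0 : 0 < pt. Proof. exact: phitR_gt0. Qed.
Let del2 : del ^+ 2 <= del.
Proof. by rewrite expr2 ler_piMl// ltW. Qed.

Section overlap.
Hypothesis thNI : forall i, i \notin I -> eta <= `|th 0 i ^- 2 - dR mu c rho0|.
Hypothesis taylor_ph : `|phiR mu (rho0 + del) - ph - del * dph| <= CT * del ^+ 2.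
Hypothesis taylor_pt : `|phitR mu c (rho0 + del) - pt - del * dpt| <= CT * del ^+ 2.

Variables (u f1 : 'cV[C]_p) (v f2 : 'cV[C]_q) (n : R).
Hypothesis n0 : 0 <= n.
Hypothesis un : l2norm u = n.
Hypothesis vn : l2norm v = n.
Hypothesis fn : l2norm (col_mx f1 f2) <= kap * del * n.
Hypothesis eqU : rho0%:C *: u - spiked X U V th *m v = f1.
Hypothesis eqV : rho0%:C *: v - (spiked X U V th)^t* *m u = f2.

Local Notation xu := (U^t* *m u).
Local Notation xv := (V^t* *m v).
Local Notation yu := (scal th *m xv).
Local Notation yv := (scal th *m xu).
Local Notation z := (col_mx u v).
Local Notation y := (col_mx yu yv).
Local Notation e1 := (xu - ph%:C *: yu).
Local Notation e2 := (xv - pt%:C *: yv).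
Local Notation A := (restr I xu).
Local Notation dn := (del * n).

Let dn0 : 0 <= dn. Proof. by rewrite mulr_ge0// ltW. Qed.

Let sys : shifted X rho0 *m z = linE U V *m y + col_mx f1 f2.
Proof.
rewrite (@spiked_system _ _ _ _ X U V th rho0 u f1 v f2 0) ?add0r//.
by rewrite mulmx0 add0r.
Qed.

Let Cy0 : 0 <= source_const. Proof. by rewrite /source_const; have := rho00; have := beta0; have := kap0; lra_norm. Qed.

Let zn : l2norm z <= 2 * n.
Proof. by apply: le_trans (l2norm_col_le _ _) _; rewrite un vn mulr2n mulrDl mul1r. Qed.

Let zn2 : l2norm z ^+ 2 = 2 * n ^+ 2.
Proof. by rewrite l2norm_col un vn mulr2n mulrDl mul1r. Qed.

Let core := compressed_equation beta0 hX UU VV brho0 gap0 sys.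

Let yn : l2norm y <= source_const * n.
Proof.
have [_ _ H] := core; apply: le_trans H _.
have h : kap * del * n <= kap * n by rewrite -mulrA ler_wpM2l// ler_piMl.
have h' : (rho0 + beta) * l2norm z <= (rho0 + beta) * (2 * n).
  by rewrite ler_wpM2l// addr_ge0// ltW.
by move: h h'; rewrite /source_const; have := fn; lra_norm.
Qed.

Let en : l2norm (col_mx e1 e2) <= defect_const * dn.
Proof.
have [H _ _] := core; move: H; rewrite linE_adj_col linM_col//.
rewrite opp_col_mx add_col_mx => H; apply: le_trans H _.
have h1 : del ^+ 2 * l2norm y <= del * (source_const * n).
  by apply: ler_pM => //; [exact: sqr_ge0|exact: l2norm_ge0].
have h2 : l2norm (col_mx f1 f2) * g <= kap * del * n * g by rewrite ler_wpM2r// ltW.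
by move: h1 h2; rewrite /defect_const; lra_norm.
Qed.

Let e1n : l2norm e1 <= defect_const * dn := le_trans (l2norm_colu _ _) en.
Let e2n : l2norm e2 <= defect_const * dn := le_trans (l2norm_cold _ _) en.
Let E1 : xu = ph%:C *: yu + e1. Proof. by rewrite addrC subrK. Qed.
Let E2 : xv = pt%:C *: yv + e2. Proof. by rewrite addrC subrK. Qed.

Let Ce0 : 0 <= defect_const.
Proof. by rewrite /defect_const; have := mulr_ge0 kap0 (ltW g0); have := Cy0; lra_norm. Qed.

Let sc0 : 0 <= secular_const ph pt eta. Proof. exact: secular_const_ge0. Qed.


Let yv_off : l2norm (restr (~: I)%SET yv) <= off_cluster_const * dn.
Proof.
apply: le_trans (secular_vector ph0 pt0 eta0 _ E1 E2) _.
  by move=> i; rewrite inE => iI; rewrite -dRE//; split => //; exact: thNI.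
rewrite /off_cluster_const -[leRHS]mulrA ler_wpM2l ?mulr_ge0//.
by have := e1n; have := e2n; lra_norm.
Qed.

Let yu_off : l2norm (restr (~: I)%SET yu) <= off_cluster_const * dn.
Proof.
apply: le_trans (secular_vector pt0 ph0 eta0 _ E2 E1) _.
  move=> i; rewrite inE => iI; rewrite mulrC -dRE//; split => //; exact: thNI.
have -> : secular_const pt ph eta = secular_const ph pt eta.
  by rewrite /secular_const (mulrC pt) (addrC pt).
rewrite /off_cluster_const -[leRHS]mulrA ler_wpM2l ?mulr_ge0//.
by have := e1n; have := e2n; lra_norm.
Qed.

Let xun : l2norm xu <= n.
Proof.
rewrite -un -[leRHS]mul1r; apply: bound_adj => // w.
by rewrite mul1r (isometryP _ UU).
Qed.

Let xvn : l2norm xv <= n.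
Proof.
rewrite -vn -[leRHS]mul1r; apply: bound_adj => // w.
by rewrite mul1r (isometryP _ VV).
Qed.

Let An : l2norm A <= n := le_trans (l2norm_restr_le _ _) xun.

Let yv_on : l2norm (restr I yv - theta0%:C *: A) <= dn.
Proof.
by apply: le_trans (restr_scal _ (ltW del0) thI) _; rewrite ler_wpM2l// ltW.
Qed.

Let yu_on : l2norm (restr I yu - theta0%:C *: restr I xv) <= dn.
Proof.
by apply: le_trans (restr_scal _ (ltW del0) thI) _; rewrite ler_wpM2l// ltW.
Qed.

Let yv_close : l2norm (yv - theta0%:C *: A) <= right_source_const * dn.
Proof.
rewrite {1}(restr_split I yv) addrAC; apply: le_trans (l2normD _ _) _; apply: le_trans (lerD yv_on yv_off) _.
by rewrite /right_source_const; have := dn0; lra.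
Qed.

(** This is the second cluster equation [x_v = pt * y_v] with
   [y_v = theta0 * x_u]. *)
Lemma overlap_right : l2norm (restr I xv - (pt * theta0)%:C *: A) <= right_overlap_const * dn.
Proof.
have -> : restr I xv - (pt * theta0)%:C *: A
    = pt%:C *: (restr I yv - theta0%:C *: A) + restr I e2.
  rewrite {1}E2 restrD restrZ scalerBr scalerA -rmorphM addrAC.
  by [].
apply: le_trans (l2normD _ _) _; rewrite l2normZ gtr0_norm//.
have h1 := ler_wpM2l (ltW pt0) yv_on.
have h2 := le_trans (l2norm_restr_le I e2) e2n.
apply: le_trans (lerD h1 h2) _.
by rewrite /right_overlap_const; have := mulr_ge0 (ltW pt0) dn0; lra_norm.
Qed.

Let yu_close : l2norm (yu - source_ratio%:C *: A) <= left_source_const * dn.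
Proof.
have -> : yu - source_ratio%:C *: A = restr (~: I)%SET yu
    + ((restr I yu - theta0%:C *: restr I xv)
       + theta0%:C *: (restr I xv - (pt * theta0)%:C *: A)).
  rewrite {1}(restr_split I yu) (_ : source_ratio = theta0 * (pt * theta0)); last by rewrite /source_ratio; ring.
  by rewrite rmorphM; exact: telescope_scale.
apply: le_trans (l2normD _ _) _; apply: le_trans (lerD yu_off (l2normD _ _)) _.
rewrite l2normZ gtr0_norm//.
have h := overlap_right; rewrite -(ler_pM2l theta00) in h.
apply: le_trans (lerD (lexx _) (lerD yu_on h)) _.
by rewrite /left_source_const; have := dn0; lra_norm.
Qed.

Let z0 := invmx (shifted X rho0) *m (linE U V *m y).

Let z0n : l2norm z0 <= source_const * g * n.
Proof.
have [ux _] := gap0.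
apply: le_trans (resolvent_le beta0 hX _ brho0 ux) _.
rewrite (l2norm_linE UU VV) mulrAC ler_wpM2r//; exact: ltW.
Qed.

Let zz0 : l2norm (z - z0) <= kap * g * dn.
Proof.
have [ux _] := gap0.
have -> : z - z0 = invmx (shifted X rho0) *m col_mx f1 f2.
  rewrite /z0 -[z](mulKmx ux) sys -mulmxBr.
  by congr (_ *m _); rewrite addrC addKr.
apply: le_trans (resolvent_le beta0 hX _ brho0 ux) _.
apply: le_trans (_ : kap * del * n * g <= _); last by lra_norm.
by rewrite ler_wpM2r// ltW.
Qed.

Let z0_sq : `|l2norm z ^+ 2 - l2norm z0 ^+ 2| <= response_const * del * n ^+ 2.
Proof.
apply: le_trans (l2norm_sqr_dist zz0 zn z0n) _.
by rewrite /response_const; lra_norm.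
Qed.

Let y2n : l2norm y ^+ 2 <= source_const ^+ 2 * n ^+ 2.
Proof. by rewrite -exprMn ler_sqr ?nnegrE ?mulr_ge0 ?l2norm_ge0. Qed.

Let form (M : 'M[C]_(k + k)) := rdot y (M *m y).

Let form_gap x : gap_at X U V (linM mu c k x%:C) (del ^+ 2) x ->
  `|form (linG X U V x%:C) - form (linM mu c k x%:C)| <= del ^+ 2 * (source_const ^+ 2 * n ^+ 2).
Proof.
move=> [_ H]; rewrite -rdotBr; apply: le_trans (rdot_abs _ _) _.
have h := ler_wpM2l (l2norm_ge0 y) (H y); apply: le_trans h _.
rewrite mulrCA -expr2 ler_wpM2l ?sqr_ge0//.
Qed.

Let form_M x : b < x -> form (linM mu c k x%:C)
  = phiR mu x * l2norm yu ^+ 2 + phitR mu c x * l2norm yv ^+ 2.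
Proof. by move=> bx; rewrite /form linM_col// rdot_col !rdotZr -!l2norm2. Qed.

Let z0_form : `|l2norm z0 ^+ 2 + (dph * l2norm yu ^+ 2 + dpt * l2norm yv ^+ 2)|
  <= increment_const * del * n ^+ 2.
Proof.
have [u0 _] := gap0; have [u1 _] := gap1.
have I1 := resolvent_increment U V beta0 hX y brho0 del0 u0 u1.
have G0 := form_gap gap0; have G1 := form_gap gap1.
have bd : b < rho0 + del by apply: lt_trans bulk_rho0 _; rewrite ltrDl.
rewrite form_M// in G0; rewrite form_M// in G1.
have z02 : l2norm z0 ^+ 2 <= (source_const * g) ^+ 2 * n ^+ 2.
  by rewrite -exprMn ler_sqr ?nnegrE ?l2norm_ge0 ?mulr_ge0// ltW.
have I2 : del ^+ 2 / (rho0 - beta) * l2norm z0 ^+ 2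
    <= del ^+ 2 * (g * (source_const * g) ^+ 2 * n ^+ 2).
  rewrite -mulrA; apply: ler_wpM2l; first exact: sqr_ge0.
  by rewrite -[leRHS]mulrA; apply: ler_wpM2l z02; exact: ltW.
have ysum : l2norm y ^+ 2 = l2norm yu ^+ 2 + l2norm yv ^+ 2 by exact: l2norm_col.
have yu0 := sqr_ge0 (l2norm yu); have yv0 := sqr_ge0 (l2norm yv).
have T1 : `|(phiR mu (rho0 + del) - ph - del * dph) * l2norm yu ^+ 2|
    <= CT * del ^+ 2 * l2norm yu ^+ 2.
  rewrite normrM (ger0_norm yu0); exact: (ler_wpM2r yu0 taylor_ph).
have T2 : `|(phitR mu c (rho0 + del) - pt - del * dpt) * l2norm yv ^+ 2|
    <= CT * del ^+ 2 * l2norm yv ^+ 2.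
  rewrite normrM (ger0_norm yv0); exact: (ler_wpM2r yv0 taylor_pt).
have T3 : CT * del ^+ 2 * l2norm yu ^+ 2 + CT * del ^+ 2 * l2norm yv ^+ 2
    <= del ^+ 2 * (CT * source_const ^+ 2 * n ^+ 2).
  rewrite -mulrDr -ysum.
  rewrite [leRHS](_ : _ = CT * del ^+ 2 * (source_const ^+ 2 * n ^+ 2)); last by ring.
  by apply: ler_wpM2l y2n; apply: mulr_ge0 => //; exact: sqr_ge0.
rewrite -(ler_pM2l del0) -[X in X * `|_| <= _](gtr0_norm del0) -normrM.
apply: le_trans (increment_numeric (le_trans I1 I2) G0 G1 T1 T2) _.
apply: le_trans (lerD (lexx _) T3) _.
by rewrite le_eqVlt /increment_const; apply/orP; left; apply/eqP; ring.
Qed.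

(** The norm of [(u; v)] is that of the response to [y] at [rho0], which the
   divided difference expresses through [|y_u|] and [|y_v|]; both are then
   replaced by their multiples of [|a|]. *)
Lemma overlap_gram : `|gram * l2norm A ^+ 2 - 2 * n ^+ 2| <= gram_const * del * n ^+ 2.
Proof.
have Q10 : 0 <= source_ratio by rewrite mulr_ge0 ?sqr_ge0// ltW.
have yun : l2norm yu <= source_const * n := le_trans (l2norm_colu _ _) yn.
have yvn : l2norm yv <= source_const * n := le_trans (l2norm_cold _ _) yn.
have QA : l2norm (source_ratio%:C *: A) <= source_ratio * 2 * n.
  by rewrite l2normZ ger0_norm// -mulrA ler_wpM2l//; have := An; have := n0; lra_norm.
have tA : l2norm (theta0%:C *: A) <= theta0 * 2 * n.
  by rewrite l2normZ gtr0_norm// -mulrA ler_wpM2l ?(ltW theta00)//; have := An; have := n0; lra_norm.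
have S1 := l2norm_sqr_dist yu_close yun QA.
have S2 := l2norm_sqr_dist yv_close yvn tA.
rewrite !l2normZ !exprMn !real_normK ?num_real// in S1 S2.
have D1 := ler_wpM2l (normr_ge0 dph) S1.
have D2 := ler_wpM2l (normr_ge0 dpt) S2.
rewrite -!normrM in D1 D2.
have Z1 := z0_sq; rewrite zn2 in Z1.
apply: le_trans (gram_numeric D1 D2 Z1 z0_form) _.
by rewrite le_eqVlt /gram_const; apply/orP; left; apply/eqP; ring.
Qed.

End overlap.

Section forced.
Variables (u : 'cV[C]_p) (v : 'cV[C]_q) (s : 'cV[C]_#|I|) (Cz : R).
Hypothesis Cz0 : 0 <= Cz.
Hypothesis zs : l2norm (col_mx u v) <= Cz * l2norm s.
Hypothesis eqU : rho0%:C *: u - spiked X U V th *m v = columns U I *m s.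
Hypothesis eqV : rho0%:C *: v - (spiked X U V th)^t* *m u = 0.

Local Notation xu := (U^t* *m u).
Local Notation xv := (V^t* *m v).
Local Notation a := (sel I *m s).
Local Notation n := (l2norm s).
Local Notation Cs := ((rho0 + beta) * Cz).
Local Notation e1 := (xu - ph%:C *: (a + scal th *m xv)).
Local Notation e2 := (xv - pt%:C *: (scal th *m xu)).
Local Notation r1 := (restr I (scal th *m xv) - theta0%:C *: restr I xv).
Local Notation r2 := (restr I (scal th *m xu) - theta0%:C *: restr I xu).

(** A forcing supported on the cluster resonates: the homogeneous part of the
   cluster equations is singular at [rho0], so that a bounded response is only
   possible when the forcing is negligible. *)
Lemma forced_response :
  ph * n <= (ph * theta0 * pt * Cz + ph * theta0 * Cs + ph * Cz + Cs) * (del * n).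
Proof.
have n0 : 0 <= n := l2norm_ge0 s.
have Cs0 : 0 <= Cs by rewrite mulr_ge0// addr_ge0// ltW.
have sys : shifted X rho0 *m col_mx u v
    = linE U V *m col_mx (a + scal th *m xv) (scal th *m xu) + col_mx 0 0.
  by apply: spiked_system; rewrite // eqU addr0 mulmxA columnsE.
have [H1 _ H2] := compressed_equation beta0 hX UU VV brho0 gap0 sys.
rewrite col_mx0 l2norm0 mul0r addr0 in H1; rewrite col_mx0 l2norm0 addr0 in H2.
have yn : l2norm (col_mx (a + scal th *m xv) (scal th *m xu)) <= Cs * n.
  apply: le_trans H2 _; rewrite -mulrA; apply: ler_wpM2l zs.
  by rewrite addr_ge0// ltW.
have en : l2norm (col_mx e1 e2) <= Cs * (del * n).
  move: H1; rewrite linE_adj_col linM_col// opp_col_mx add_col_mx => H1.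
  apply: le_trans H1 _; rewrite [leRHS]mulrCA.
  apply: ler_pM yn => //; [exact: sqr_ge0|exact: l2norm_ge0].
have e1n : l2norm (restr I e1) <= Cs * (del * n).
  exact: le_trans (l2norm_restr_le _ _) (le_trans (l2norm_colu _ _) en).
have e2n : l2norm (restr I e2) <= Cs * (del * n).
  exact: le_trans (l2norm_restr_le _ _) (le_trans (l2norm_cold _ _) en).
have xun : l2norm xu <= Cz * n.
  apply: le_trans zs; apply: le_trans (l2norm_colu _ _).
  rewrite -[leRHS]mul1r; apply: bound_adj => // w.
  by rewrite mul1r (isometryP _ UU).
have xvn : l2norm xv <= Cz * n.
  apply: le_trans zs; apply: le_trans (l2norm_cold _ _).
  rewrite -[leRHS]mul1r; apply: bound_adj => // w.
  by rewrite mul1r (isometryP _ VV).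
have r1n : l2norm r1 <= Cz * (del * n).
  apply: le_trans (restr_scal _ (ltW del0) thI) _; rewrite [leRHS]mulrCA.
  by apply: ler_wpM2l xvn; exact: ltW.
have r2n : l2norm r2 <= Cz * (del * n).
  apply: le_trans (restr_scal _ (ltW del0) thI) _; rewrite [leRHS]mulrCA.
  by apply: ler_wpM2l xun; exact: ltW.
have resonance : ph * theta0 * pt * theta0 = 1.
  rewrite (_ : ph * theta0 * pt * theta0 = ph * pt * theta0 ^+ 2); last by ring.
  by rewrite -dRE// secular0 mulVf// sqrf_eq0 gt_eqF.
have -> : ph * n = l2norm (ph%:C *: a) by rewrite l2normZ gtr0_norm// l2norm_sel.
have -> : ph%:C *: a = - ((ph * theta0 * pt)%:C *: r2) - (ph * theta0)%:C *: restr I e2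
    - ph%:C *: r1 - restr I e1.
  apply: (@resonant_vector _ _ ph%:C theta0%:C pt%:C).
  - by rewrite rmorphM.
  - by rewrite rmorphM.
  - by rewrite -rmorphM resonance.
  - by rewrite restrB restrZ restrD restr_sel.
  - by rewrite restrB restrZ.
apply: le_trans (l2normB _ _) _; apply: le_trans (lerD (l2normB _ _) e1n) _.
apply: le_trans (lerD (lerD (l2normB _ _) (lexx _)) (lexx _)) _.
rewrite l2normN !l2normZ !gtr0_norm ?mulr_gt0//.
have g1 := ler_wpM2l (ltW (mulr_gt0 (mulr_gt0 ph0 theta00) pt0)) r2n.
have g2 := ler_wpM2l (ltW (mulr_gt0 ph0 theta00)) e2n.
have g3 := ler_wpM2l (ltW ph0) r1n.
apply: le_trans (lerD (lerD (lerD g1 g2) g3) (lexx _)) _.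
by rewrite le_eqVlt; apply/orP; left; apply/eqP; ring.
Qed.

End forced.

End cluster.

(** * Singular values and the spectral theorem *)

Section singular_values.
Context {R : realType}.
Local Notation C := R[i].

Lemma l2norm_diag k (w : 'rV[R]_k) (a : R) (v : 'cV[C]_k) : 0 <= a ->
  (forall j, `|w 0 j| <= a) -> l2norm (scal w *m v) <= a * l2norm v.
Proof.
move=> a0 h; apply: l2norm_mono => // i.
by rewrite scalE cabsM cabs_real ler_wpM2r ?cabs_ge0.
Qed.

Variables (p q : nat) (W : 'M[C]_(p, q)).
Local Notation s2 := (\row_j (singval W j ^+ 2)).
Local Notation basis := ((spectralmx (W *m W^t*))^t*).

Lemma gram_hermitian : W *m W^t* \is hermsymmx.
Proof. by apply/is_hermitianmxP; rewrite expr0 scale1r adjmxM trmxCK. Qed.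

Lemma basis_isometry : basis^t* *m basis = 1%:M.
Proof. by rewrite trmxCK; apply/unitarymxP; exact: spectral_unitarymx. Qed.

Lemma basis_coisometry : basis *m basis^t* = 1%:M.
Proof.
rewrite trmxCK -invmx_unitary ?spectral_unitarymx// mulVmx//.
by rewrite unitarymx_unit ?spectral_unitarymx.
Qed.

Lemma gram_spectral :
  W *m W^t* *m basis = basis *m diag_mx (spectral_diag (W *m W^t*)).
Proof.
have nH : W *m W^t* \is normalmx by exact: hermitian_normalmx gram_hermitian.
have PP : spectralmx (W *m W^t*) *m basis = 1%:M.
  by apply/unitarymxP; exact: spectral_unitarymx.
have := orthomx_spectralP nH; rewrite invmx_unitary ?spectral_unitarymx// => {1}->.
by rewrite -[LHS]mulmxA PP mulmx1.
Qed.

Lemma spectral_diag_real j :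
  spectral_diag (W *m W^t*) 0 j = (heigval (W *m W^t*) j)%:C.
Proof.
rewrite /heigval RRe_real//.
by have /mxOverP := hermitian_spectral_diag_real gram_hermitian; exact.
Qed.

Lemma gram_eigen j : W *m (W^t* *m col j basis)
  = (heigval (W *m W^t*) j)%:C *: col j basis.
Proof.
rewrite mulmxA colE mulmxA gram_spectral -mulmxA -spectral_diag_real.
rewrite scalemxAr; congr (_ *m _); apply/matrixP => i l.
rewrite (ord1 l) mul_diag_mx !mxE eqxx andbT.
by case: eqP => [->|_]; rewrite ?mulr0.
Qed.

Lemma basis_col j : l2norm (col j basis) = 1.
Proof.
rewrite colE (isometryP _ basis_isometry) /l2norm (bigD1 j)//= big1.
  by rewrite mxE !eqxx addr0 cabs_real normr1 expr1n sqrtr1.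
by move=> i ij; rewrite mxE (negbTE ij) cabs_real normr0 expr0n.
Qed.

Lemma heigval_gram j :
  heigval (W *m W^t*) j = l2norm (W^t* *m col j basis) ^+ 2.
Proof.
rewrite l2norm2 rdot_adj trmxCK gram_eigen rdotZr -l2norm2 basis_col.
by rewrite expr1n mulr1.
Qed.

Lemma singval_ge0 j : 0 <= singval W j.
Proof. exact: sqrtr_ge0. Qed.

Lemma singval_sqr j : singval W j ^+ 2 = heigval (W *m W^t*) j.
Proof. by rewrite sqr_sqrtr// heigval_gram sqr_ge0. Qed.

Definition sing_set (J : set R) : {set 'I_p} := [set j | `[< J (singval W j) >]]%SET.

Lemma nb_singvalE J : nb_singval W J = #|sing_set J|.
Proof. by apply: eq_card => j; rewrite /sing_set !inE. Qed.

(** The left vectors are eigenvectors of [W W^*]; the right ones are their images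
   under [W^*], divided by the singular values. *)
Lemma paired_singular_ex (J : set R) : (forall x, J x -> 0 < x) ->
  exists Uh Vh, paired_singular over_complexes (k := #|sing_set J|) W J Uh Vh.
Proof.
move=> J0; pose I := sing_set J.
pose s : 'rV[R]_#|I| := \row_j singval W (enum_val j).
pose si : 'rV[R]_#|I| := \row_j (singval W (enum_val j))^-1.
have Js j : J (s 0 j).
  by rewrite mxE; have := enum_valP j; rewrite inE => /asboolP.
have s0 j : 0 < s 0 j by exact: J0.
pose Uh := columns basis I; pose Vh := W^t* *m Uh *m diag_mx (cmx si).
have diagM : diag_mx (cmx s) *m diag_mx (cmx si) = 1%:M :> 'M[C]_#|I|.
  apply/matrixP => i j; rewrite mul_diag_mx !mxE.
  case: eqP => [_|_]; rewrite ?mulr0//= !mulr1n -rmorphM mulfV//.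
  by have := s0 i; rewrite mxE => /lt0r_neq0.
have diagM' : diag_mx (cmx si) *m diag_mx (cmx s) = 1%:M :> 'M[C]_#|I|.
  by rewrite diag_mxC.
have HU : W *m (W^t* *m Uh) = Uh *m diag_mx (cmx s) *m diag_mx (cmx s).
  apply/matrixP => i j.
  have := congr1 (fun v : 'cV_p => v i 0) (gram_eigen (enum_val j)).
  rewrite -singval_sqr => e.
  have -> : (W *m (W^t* *m Uh)) i j = (W *m (W^t* *m col (enum_val j) basis)) i 0.
    rewrite (_ : col (enum_val j) basis = col j Uh); last first.
      by apply/matrixP => a b; rewrite !mxE.
    have -> : W *m (W^t* *m col j Uh) = col j (W *m (W^t* *m Uh)).
      by rewrite !colE !mulmxA.
    by rewrite [RHS]mxE.
  rewrite e !mul_mx_diag !mxE -mulrA -rmorphM -expr2 mulrC; congr (_ * _).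
have UhI : Uh^t* *m Uh = 1%:M.
  rewrite /Uh columnsE adjmxM -mulmxA (mulmxA (basis^t*)).
  by rewrite basis_isometry mul1mx sel_iso.
exists Uh, Vh; split.
- by split.
- split=> //; rewrite /Vh !adjmxM trmxCK -/(scal si) scal_adj /scal.
  rewrite (_ : _ *m _ = diag_mx (cmx si) *m (Uh^t* *m (W *m (W^t* *m Uh)))
     *m diag_mx (cmx si)); last by rewrite !mulmxA.
  by rewrite HU !mulmxA -(mulmxA _ (Uh^t*)) UhI mulmx1 diagM' mul1mx diagM.
- exists s; split => //.
    by rewrite /Vh !mulmxA -(mulmxA W) HU -[LHS]mulmxA diagM mulmx1.
  by rewrite /Vh -[RHS]mulmxA diagM' mulmx1.
Qed.

(** Eliminating [v] leaves [x^2 u - W W^* u = x f], which is solved in an eigenbasis;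
   the only small denominators belong to singular values in [J], and [f] has no
   component there.  The norm of [v = x^-1 W^* u] follows from the equation, with
   no bound on [W]. *)
Lemma bounded_response (J : set R) (x dl : R) (f : 'cV[C]_p) :
  0 < x -> 0 < dl ->
  (forall s, ~ J s -> dl <= `|s - x|) ->
  (forall j, j \in sing_set J -> (basis^t* *m f) j 0 = 0) ->
  exists (u : 'cV[C]_p) (v : 'cV[C]_q),
   [/\ x%:C *: u - W *m v = f, x%:C *: v - W^t* *m u = 0 &
       l2norm (col_mx u v) <= (2 / dl + 1 / x) * l2norm f].
Proof.
move=> x0 dl0 hJ hf.
pose w : 'rV[R]_p := \row_j (x / (x ^+ 2 - singval W j ^+ 2)).
pose co := basis^t* *m f.
pose u := basis *m (\col_j (if j \in sing_set J then 0 else (w 0 j)%:C * co j 0)).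
pose v := x^-1%:C *: (W^t* *m u).
have gap j : j \notin sing_set J -> dl <= `|singval W j - x|.
  by rewrite inE => /asboolPn; exact: hJ.
have un : l2norm u <= dl^-1 * l2norm f.
  rewrite (isometryP _ basis_isometry).
  have -> : l2norm f = l2norm co.
    rewrite /co; apply/esym/isometryP; rewrite trmxCK.
    by have := basis_coisometry; rewrite trmxCK.
  apply: l2norm_mono; first by rewrite invr_ge0 ltW.
  move=> j; rewrite mxE; case: ifPn => jJ.
    by rewrite /cabs /= !expr0n addr0 sqrtr0 mulr_ge0 ?cabs_ge0// invr_ge0 ltW.
  rewrite cabsM cabs_real ler_wpM2r ?cabs_ge0// mxE.
  have g := gap j jJ; have sj := singval_ge0 j.
  have sx : singval W j - x != 0 by rewrite -normr_gt0 (lt_le_trans dl0).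
  have -> : x ^+ 2 - singval W j ^+ 2 = - ((singval W j - x) * (singval W j + x)).
    by ring.
  have sxp : 0 < singval W j + x by rewrite ltr_wpDl.
  rewrite invrN mulrN normrN normrM normfV normrM (gtr0_norm x0) (gtr0_norm sxp).
  rewrite invfM mulrCA -[leRHS]mulr1; apply: ler_pM.
  - by rewrite invr_ge0.
  - by apply: divr_ge0; exact: ltW.
  - by rewrite lef_pV2// posrE// (lt_le_trans dl0).
  - by rewrite ler_pdivrMr// mul1r lerDr.
have fE : f = basis *m co by rewrite /co mulmxA basis_coisometry mul1mx.
have hco j : j \in sing_set J -> co j 0 = 0 by exact: hf.
clearbody co.
have gramu : W *m (W^t* *m u) = (x ^+ 2)%:C *: u - x%:C *: f.
  rewrite fE /u !mulmxA gram_spectral -[LHS]mulmxA !scalemxAr -mulmxBr.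
  congr (_ *m _); apply/matrixP => j l; rewrite (ord1 l) mul_diag_mx !mxE.
  rewrite spectral_diag_real -singval_sqr; case: ifPn => jJ.
    by rewrite hco// !mulr0 subrr.
  have g := gap j jJ; have sj := singval_ge0 j.
  have sx : singval W j - x != 0 by rewrite -normr_gt0 (lt_le_trans dl0).
  have d0 : x ^+ 2 - singval W j ^+ 2 != 0.
    rewrite subr_sqr mulf_neq0//; first by rewrite -opprB oppr_eq0.
    by rewrite gt_eqF// ltr_pwDl.
  rewrite !mulrA -!rmorphM -mulrBl -rmorphB; congr (_%:C * _).
  by field.
exists u, v; split.
- rewrite /v -scalemxAr gramu scalerBr !scalerA -!rmorphM.
  rewrite mulVf ?gt_eqF// scale1r expr2 mulKf ?gt_eqF//.
  by rewrite opprB addrCA subrr addr0.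
- by rewrite /v scalerA -rmorphM mulfV ?gt_eqF// scale1r subrr.
have f0 := l2norm_ge0 f; have u0 := l2norm_ge0 u.
have vn2 : l2norm v ^+ 2 <= (l2norm u + 1 / x * l2norm f) ^+ 2.
  rewrite l2norm2 /v rdotZl rdotZr rdot_adj trmxCK gramu rdotBr !rdotZr -l2norm2.
  rewrite (_ : _ * _ = l2norm u ^+ 2 - x^-1 * rdot u f); last first.
    by field; rewrite gt_eqF.
  have h := rdot_le (- u) f; rewrite rdotNl l2normN in h.
  have xi : 0 <= x^-1 by rewrite invr_ge0 ltW.
  have h1 := ler_wpM2l xi h; rewrite div1r.
  have h2 := mulr_ge0 (mulr_ge0 xi xi) (sqr_ge0 (l2norm f)).
  have h3 := mulr_ge0 xi (mulr_ge0 u0 f0).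
  move: h1 h2 h3; generalize (l2norm u) (l2norm f) (rdot u f) x^-1 => a b d e; nra.
have vn : l2norm v <= l2norm u + 1 / x * l2norm f.
  rewrite -ler_sqr// ?nnegrE ?l2norm_ge0//.
  by rewrite addr_ge0// mulr_ge0// divr_ge0// ltW.
apply: le_trans (l2norm_col_le _ _) _.
rewrite mulrDl; apply: le_trans (lerD un vn) _.
apply: le_trans (lerD (lexx _) (lerD un (lexx _))) _.
by rewrite addrA lerD2r -mulrDl ler_wpM2r//; lra.
Qed.

End singular_values.

Lemma kernel_vector (K : fieldType) a b (B : 'M[K]_(a, b)) : (a < b)%N ->
  exists2 v : 'cV[K]_b, v != 0 & B *m v = 0.
Proof.
move=> ab; have : kermx B^T != 0.
  rewrite -mxrank_eq0 mxrank_ker subn_eq0 -ltnNge.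
  exact: leq_ltn_trans (rank_leq_col _) ab.
move=> /rowV0Pn[v /sub_kermxP vB v0]; exists v^T.
  by rewrite -(inj_eq (@trmx_inj _ _ _)) trmxK trmx0.
by apply: trmx_inj; rewrite trmx_mul trmxK vB trmx0.
Qed.

(** * The overlap weights *)

Section weights.
Context {R : realType}.
Variables (mu : probability R R) (c : R).
Local Notation b := (bulk_edge mu).
Hypothesis muB : mu `[0, b ^+ 2]%classic = 1%E.
Hypothesis hc : 0 < c <= 1.
Hypothesis hedge : edge_condition mu c.
Variable theta0 : R.
Hypothesis htheta0 : theta_star mu c < theta0.
Local Notation r0 := (rho mu c theta0).
Local Notation ph := (phiR mu r0).
Local Notation pt := (phitR mu c r0).
Local Notation G := (gram mu c r0 theta0).

Lemma resonance : ph * pt * theta0 ^+ 2 = 1.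
Proof.
have [br dr] := rho_spec muB hc hedge htheta0.
rewrite -dRE// dr mulVf// sqrf_eq0 gt_eqF//.
exact: lt_trans (theta_star_gt0 hedge) htheta0.
Qed.

Lemma gram_ddR : ph * G = - theta0 ^+ 2 * ddR mu c r0.
Proof.
have := resonance; rewrite /gram /source_ratio /ddR.
generalize (dphiR mu r0) (dphitR mu c r0) ph pt => x1 x2 x3 x4 res.
have -> : x3 * - (x1 * (x4 * theta0 ^+ 2) ^+ 2 + x2 * theta0 ^+ 2)
  = - (x1 * x4 * theta0 ^+ 2 * (x3 * x4 * theta0 ^+ 2) + x3 * x2 * theta0 ^+ 2).
  by ring.
by rewrite res; ring.
Qed.

Lemma gram_gt0 : 0 < G.
Proof.
have [br _] := rho_spec muB hc hedge htheta0.
have ph0 := phiR_gt0 muB br; have D0 := ddR_lt0 muB hc br.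
rewrite -(pmulr_rgt0 _ ph0) gram_ddR mulNr oppr_gt0 pmulr_rlt0//.
by rewrite exprn_gt0// (lt_trans (theta_star_gt0 hedge) htheta0).
Qed.

Lemma kappaL_gram : kappaL mu c theta0 = 2 / G.
Proof.
have [br _] := rho_spec muB hc hedge htheta0.
have ph0 := phiR_gt0 muB br; have D0 := ddR_lt0 muB hc br.
have t0 : theta0 != 0 by rewrite gt_eqF// (lt_trans (theta_star_gt0 hedge) htheta0).
have G0 := gram_gt0.
rewrite /kappaL derive1_dR//; have := gram_ddR.
move: ph0 D0 G0; generalize ph (ddR mu c r0) G => x y z x0 y0 z0 e.
apply/eqP; rewrite eqr_div ?mulf_neq0 ?sqrf_eq0 ?(gt_eqF z0) ?(lt_eqF y0)//.
by rewrite mulNr -mulrA e; apply/eqP; ring.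
Qed.

Lemma kappaL_gt0 : 0 < kappaL mu c theta0.
Proof. by rewrite kappaL_gram divr_gt0// gram_gt0. Qed.

Lemma sqrt_kappaR : Num.sqrt (kappaR mu c theta0)
  = pt * theta0 * Num.sqrt (kappaL mu c theta0).
Proof.
have [br _] := rho_spec muB hc hedge htheta0.
have ph0 := phiR_gt0 muB br; have pt0 := phitR_gt0 muB hc br.
have t0 : 0 < theta0 := lt_trans (theta_star_gt0 hedge) htheta0.
have -> : kappaR mu c theta0 = (pt * theta0) ^+ 2 * kappaL mu c theta0.
  rewrite /kappaR /kappaL mulrA; congr (_ / _).
  rewrite mulrN; congr (- _).
  rewrite (_ : (pt * theta0) ^+ 2 * (2 * ph) = 2 * pt * (ph * pt * theta0 ^+ 2)).
    by rewrite resonance mulr1.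
  by ring.
by rewrite sqrtrM ?sqr_ge0// sqrtr_sqr gtr0_norm// mulr_gt0.
Qed.

End weights.

(** * The deterministic theorem *)

Lemma midpoint_range (R : realType) (x y t : R) : x < y -> 0 <= t <= 1 ->
  (x + y) / 2 <= y + t <= y + 1.
Proof. by move=> xy /andP[t0 t1]; apply/andP; split; lra. Qed.

Section deterministic_cluster.
Context {R : realType}.
Local Notation C := R[i].
Variables (mu : probability R R) (c : R).
Local Notation b := (bulk_edge mu).
Hypothesis muB : mu `[0, b ^+ 2]%classic = 1%E.
Hypothesis hc : 0 < c <= 1.
Hypothesis hedge : edge_condition mu c.
Variable theta0 : R.
Hypothesis htheta0 : theta_star mu c < theta0.
Variables (jm jM dl : R).
Hypothesis bjm : b < jm.
Hypothesis jmM : jm <= jM.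
Hypothesis dl0 : 0 < dl.
Local Notation r0 := (rho mu c theta0).
Local Notation beta := ((b + jm) / 2).
Local Notation ph := (phiR mu r0).
Local Notation pt := (phitR mu c r0).

(** The deterministic content of the event on which the theorem is proved, with
   [dl] the separation of the locations from the boundary of [J]. *)
Definition clustered (J : set R) p q k (X : 'M[C]_(p, q)) (U : 'M[C]_(p, k))
    (th : 'rV[R]_k) (V : 'M[C]_(q, k)) (I : {set 'I_k}) (del : R) : Prop :=
  [/\ forall x, J x -> jm <= x <= jM,
      forall v, l2norm (X *m v) <= beta * l2norm v,
      U^t* *m U = 1%:M /\ V^t* *m V = 1%:M &
      [/\ forall i, 0 < th 0 i,
          forall i, i \in I -> `|th 0 i - theta0| <= del,
          forall i, i \in I <-> J (rho mu c (th 0 i)),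
          forall i x, (closure J `\` J°) x -> dl <= `|rho mu c (th 0 i) - x| &
          forall x, jm <= x <= jM + 1 ->
            gap_at X U V (linM mu c k x%:C) (del ^+ 2) x]].

Let b0 : 0 <= b. Proof. exact: bulk_edge_ge0. Qed.
Let beta0 : 0 <= beta. Proof. by have := b0; have := bjm; lra. Qed.
Let t0 : 0 < theta0. Proof. exact: lt_trans (theta_star_gt0 hedge) htheta0. Qed.
Let jm0 : 0 < jm. Proof. exact: le_lt_trans bjm. Qed.

(** The cluster being nonempty, one of its locations lies in [J] and close to
   [r0]; the separation then applies to [r0] as well. *)
Lemma cluster_location : exists2 d0, 0 < d0 &
  forall J p q k (X : 'M[C]_(p, q)) U th (V : 'M[C]_(q, k)) I del,
    0 < del <= d0 -> clustered J X U th V I del -> I != finset.set0 ->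
    jm <= r0 <= jM /\ forall s, ~ J s -> dl / 2 <= `|s - r0|.
Proof.
have [//|tau tau0 htau] := rho_close muB hc hedge htheta0 (_ : 0 < dl / 2).
  by rewrite divr_gt0.
exists tau => // J p q k X U th V I del /andP[d0 d1] [JM _ _ [_ thI IJ sep _]].
move=> /finset.set0Pn[i iI].
have [_ ri] : theta_star mu c < th 0 i /\ `|rho mu c (th 0 i) - r0| <= dl / 2.
  by apply: htau; apply: le_trans d1; exact: thI.
have Ji : J (rho mu c (th 0 i)) by apply/IJ.
split.
  apply: JM; apply/(boundary_separation (sep i) _) => //.
  by have := dl0; lra.
move=> s Js; rewrite leNgt; apply/negP => sr; apply: Js.
apply/(boundary_separation (sep i) _) => //.
rewrite (_ : _ - s = (rho mu c (th 0 i) - r0) - (s - r0)); last by ring.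
by apply: le_lt_trans (ler_normB _ _) _; lra.
Qed.

Lemma cluster_isolated : exists2 eta, 0 < eta &
  forall J p q k (X : 'M[C]_(p, q)) U th (V : 'M[C]_(q, k)) I del,
    clustered J X U th V I del -> forall i z, i \notin I -> J z ->
    eta <= `|th 0 i ^- 2 - dR mu c z|.
Proof.
have [eta eta0 heta] := secular_gap muB hc hedge bjm jmM dl0.
exists eta => // J p q k X U th V I del [JM _ _ [th0 _ IJ sep _]] i z iI Jz.
apply: heta; [exact: th0|exact: JM|left].
rewrite leNgt; apply/negP => iz; move/negP: iI; apply; apply/IJ.
exact/(boundary_separation (sep i) iz).
Qed.

(** [outlier_location] is used with the gap [del] itself: as the precision of the
   local law is [del ^+ 2], the product of the two constants is still small. *)
Lemma singular_location : exists K d0, [/\ 0 <= K, 0 < d0 &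
  forall J p q k (X : 'M[C]_(p, q)) U th (V : 'M[C]_(q, k)) I del,
    0 < del <= d0 -> clustered J X U th V I del -> jm <= r0 <= jM ->
    forall s (u : 'cV_p) (v : 'cV_q), J s -> u != 0 -> spiked X U V th *m v = s%:C *: u ->
      (spiked X U V th)^t* *m u = s%:C *: v -> `|s - r0| <= K * del].
Proof.
have [eta eta0 heta] := cluster_isolated.
have [br dr] := rho_spec muB hc hedge htheta0.
pose Phi := phiR mu jm + phitR mu c jm + 2 + phiR mu jm * phitR mu c jm.
have phj := phiR_gt0 muB bjm; have ptj := phitR_gt0 muB hc bjm.
have Phi0 : 0 < Phi by have := mulr_gt0 phj ptj; rewrite /Phi; lra.
pose K1 := 10 / theta0 ^+ 3 + 1.
have t30 : 0 < 10 / theta0 ^+ 3 by rewrite divr_gt0// exprn_gt0.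
pose K := (jM + 1) ^+ 3 * K1.
have jM10 : 0 < jM + 1 by have := jm0; have := jmM; lra.
pose d0 := Num.min (Num.min 1 (theta0 / 2)) (Num.min eta (1 / (9 * Phi))).
exists K, d0; split.
- by rewrite mulr_ge0 ?exprn_ge0 ?(ltW jM10)// /K1; lra.
- have g1 : 0 < theta0 / 2 by exact: divr_gt0.
  have g2 : 0 < 1 / (9 * Phi) by rewrite divr_gt0// mulr_gt0.
  by rewrite !lt_min ltr01 eta0 g1 g2.
move=> J p q k X U th V I del /andP[del0].
rewrite !le_min => /andP[/andP[del1 delt] /andP[dele delP]] hcl r0J s u v Js u0 e1 e2.
have [JM hX [UU VV] [th0 thI IJ sep gap]] := hcl.
have sJ := JM s Js.
have /andP[js sM] := sJ.
have bs : b < s by exact: lt_le_trans js.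
rewrite leNgt; apply/negP => sr.
have d1 : K1 * del < `|theta0 ^- 2 - dR mu c s|.
  have h : `|s - r0| <= (jM + 1) ^+ 3 * `|dR mu c s - dR mu c r0|.
    by apply: (dR_inv_lip muB hc); rewrite ?bs ?br /=; lra.
  rewrite -dr distrC -(ltr_pM2l (exprn_gt0 3 jM10)) mulrA; exact: lt_le_trans h.
have hth i : del <= `|th 0 i ^- 2 - dR mu c s|.
  have [iI|iI] := boolP (i \in I); last first.
    by apply: le_trans dele _; apply: heta hcl _ _ iI Js.
  have h1 := thI i iI.
  have h2 := inv2_close t0 (le_trans h1 delt).
  have h3 : 10 / theta0 ^+ 3 * `|th 0 i - theta0| <= 10 / theta0 ^+ 3 * del.
    by rewrite ler_pM2l.
  have h4 : `|theta0 ^- 2 - dR mu c s| <= `|th 0 i ^- 2 - dR mu c s|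
      + `|th 0 i ^- 2 - theta0 ^- 2|.
    rewrite (_ : _ - dR mu c s = (th 0 i ^- 2 - dR mu c s)
      - (th 0 i ^- 2 - theta0 ^- 2)); last by ring.
    exact: ler_normB.
  move: d1; rewrite /K1 mulrDl mul1r => d1.
  move: (le_trans h2 h3) h4 d1.
  generalize `|th 0 i ^- 2 - theta0 ^- 2| `|theta0 ^- 2 - dR mu c s|.
  by generalize (10 / theta0 ^+ 3 * del) `|th 0 i ^- 2 - dR mu c s|; intros; lra.
have gs : gap_at X U V (linM mu c k s%:C) (del ^+ 2) s.
  by apply: gap; rewrite js /= (le_trans sM)// lerDl.
have bes : beta < s by have := bjm; lra.
have := outlier_location muB hc beta0 hX UU VV th0 bes bs gs e1 e2 u0 del0 hth.
apply/negP; rewrite -ltNge.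
have phs := phiR_decr muB bjm js; have pts := phitR_decr muB hc bjm js.
have ph0 := phiR_gt0 muB bs; have pt0 := phitR_gt0 muB hc bs.
have pp := ler_pM (ltW ph0) (ltW pt0) phs pts.
rewrite /secular_const.
have -> : 8 * ((phiR mu s + phitR mu c s + 1 + phiR mu s * phitR mu c s) / del + 1)
    * del ^+ 2 = 8 * ((phiR mu s + phitR mu c s + 1 + phiR mu s * phitR mu c s)
    + del) * del by field; rewrite gt_eqF.
move: delP; rewrite ler_pdivlMr ?mulr_gt0// => delP.
apply: le_lt_trans (_ : 8 * Phi * del < 1).
  rewrite ler_pM2r// ler_pM2l// /Phi.
  have num (x y z x' y' z' e : R) : x <= x' -> y <= y' -> z <= z' -> e <= 1 ->
      x + y + 1 + z + e <= x' + y' + 2 + z' by move=> *; lra.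
  exact: num phs pts pp del1.
by have := mulr_gt0 Phi0 del0; lra.
Qed.

Lemma column_pair p q l (W : 'M[C]_(p, q)) (Uh : 'M[C]_(p, l)) (Vh : 'M[C]_(q, l))
    (s : 'rV[R]_l) j :
  W *m Vh = Uh *m diag_mx (cmx s) ->
  W *m col j Vh = (s 0 j)%:C *: col j Uh.
Proof.
move=> e; have -> : W *m col j Vh = col j (W *m Vh) by rewrite !colE mulmxA.
by rewrite e; apply/matrixP => i o; rewrite mul_mx_diag !mxE mulrC.
Qed.

(** The number of pairs is arbitrary here; the bound on it is a consequence. *)
Lemma pairs_estimate : exists K d0, [/\ 0 <= K, 0 < d0 &
  forall J p q k (X : 'M[C]_(p, q)) U th (V : 'M[C]_(q, k)) I del,
    0 < del <= d0 -> clustered J X U th V I del -> I != finset.set0 ->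
    forall l F (Uh : 'M[C]_(p, l)) (Vh : 'M[C]_(q, l)),
      paired_singular F (spiked X U V th) J Uh Vh ->
    forall a : 'cV_l,
      `|kappaL mu c theta0 * l2norm a ^+ 2
        - l2norm ((columns U I)^t* *m (Uh *m a)) ^+ 2| <= K * del * l2norm a ^+ 2
      /\ l2norm ((columns V I)^t* *m (Vh *m a)
           - (pt * theta0)%:C *: ((columns U I)^t* *m (Uh *m a))) <= K * del * l2norm a].
Proof.
have [br dr] := rho_spec muB hc hedge htheta0.
have [d1 d10 loc] := cluster_location.
have [r0J|r0J] := boolP (jm <= r0 <= jM); last first.
  exists 0, d1; split => // J p q k X U th V I del dd hcl I0.
  by have [] := loc _ _ _ _ _ _ _ _ _ _ dd hcl I0; rewrite (negbTE r0J).
have [eta eta0 heta] := cluster_isolated.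
have [Kl [d2 [Kl0 d20 hKl]]] := singular_location.
have ba : b < (b + r0) / 2 by lra.
have aM : (b + r0) / 2 <= r0 + 1 by have := b0; lra.
have [C1 [C10 _ _ T1]] := taylor1_phiR muB ba aM.
have [C2 [C20 _ _ T2]] := taylor1_phitR c muB ba aM.
have bmr : beta < r0 by case/andP: r0J => h _; have := bjm; lra.
set kap := 2 * Kl; have kap0 : 0 <= kap by rewrite mulr_ge0.
set CT := C1 + C2; have CT0 : 0 <= CT by exact: addr_ge0.
have G0 := gram_gt0 muB hc hedge htheta0.
set kl := kappaL mu c theta0; have klE : kl = 2 / gram mu c r0 theta0 by exact: kappaL_gram.
have kl0 : 0 < kl by exact: kappaL_gt0.
pose K := `|kl / 2 * gram_const mu c r0 theta0 beta kap eta CT| + `|right_overlap_const mu c r0 beta kap|.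
exists K, (Num.min 1 (Num.min d1 d2)); split.
- exact: addr_ge0.
- by rewrite !lt_min ltr01 d10.
move=> J p q k X U th V I del /andP[del0]; rewrite !le_min => /and3P[del1 hd1 hd2] hcl I0.
move=> l F Uh Vh [[_ UhI] [_ VhI] [s [sJ e1 e2]]] a.
have [JM hX [UU VV] [th0 thI IJ sep gap]] := hcl.
have [_ hJ] := loc _ _ _ _ _ _ _ _ _ _ (introT andP (conj del0 hd1)) hcl I0.
have dd2 : 0 < del <= d2 by rewrite del0.
have sl j : `|r0 - s 0 j| <= Kl * del.
  rewrite distrC.
  apply: (hKl _ _ _ _ _ _ _ _ _ _ dd2 hcl r0J (s 0 j) (col j Uh) (col j Vh)).
  - exact: sJ.
  - apply/eqP => u0; have := isometryP (delta_mx j 0) UhI.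
    rewrite -colE u0 l2norm0 => /esym/l2norm_eq0 /matrixP /(_ j 0).
    by rewrite !mxE !eqxx => /eqP; rewrite oner_eq0.
  - exact: column_pair.
  - exact: column_pair.
pose w : 'rV[R]_l := \row_j (r0 - s 0 j).
pose n := l2norm a.
have n0 : 0 <= n by exact: l2norm_ge0.
have wa : l2norm (scal w *m a) <= Kl * del * n.
  apply: l2norm_diag; first by rewrite mulr_ge0// ltW.
  by move=> j; rewrite mxE.
have wE : scal w *m a = r0%:C *: a - diag_mx (cmx s) *m a.
  apply/matrixP => i o; rewrite (ord1 o) scalE.
  rewrite [RHS]mxE [X in _ + X]mxE [X in X - _]mxE -/(scal s) scalE.
  by rewrite mxE rmorphB mulrBl.
have E1 : r0%:C *: (Uh *m a) - spiked X U V th *m (Vh *m a) = Uh *m (scal w *m a).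
  by rewrite wE mulmxBr -scalemxAr !mulmxA e1.
have E2 : r0%:C *: (Vh *m a) - (spiked X U V th)^t* *m (Uh *m a) = Vh *m (scal w *m a).
  by rewrite wE mulmxBr -scalemxAr !mulmxA e2.
have un : l2norm (Uh *m a) = n by exact: isometryP.
have vn : l2norm (Vh *m a) = n by exact: isometryP.
have fn : l2norm (col_mx (Uh *m (scal w *m a)) (Vh *m (scal w *m a))) <= kap * del * n.
  apply: le_trans (l2norm_col_le _ _) _.
  rewrite (isometryP _ UhI) (isometryP _ VhI); apply: le_trans (lerD wa wa) _.
  by rewrite /kap le_eqVlt; apply/orP; left; apply/eqP; ring.
have gap0 : gap_at X U V (linM mu c k r0%:C) (del ^+ 2) r0.
  by apply: gap; case/andP: r0J => h1 h2; rewrite h1 /= (le_trans h2)// lerDl.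
have gap1 : gap_at X U V (linM mu c k (r0 + del)%:C) (del ^+ 2) (r0 + del).
  apply: gap; case/andP: r0J => h1 h2; rewrite (le_trans h1) ?lerDl ?(ltW del0)//=.
  exact: lerD.
have r0a : (b + r0) / 2 <= r0 <= r0 + 1.
  by have := midpoint_range br (introT andP (conj (lexx 0) ler01)); rewrite addr0.
have r0a' := midpoint_range br (introT andP (conj (ltW del0) del1)).
have del20 : 0 <= del ^+ 2 by exact: sqr_ge0.
have TP : `|phiR mu (r0 + del) - ph - del * dphiR mu r0| <= CT * del ^+ 2.
  have := T1 _ _ r0a r0a'; rewrite (addrC r0) addrK => h; apply: le_trans h _.
  by rewrite /CT ler_wpM2r// lerDl.
have TT : `|phitR mu c (r0 + del) - pt - del * dphitR mu c r0| <= CT * del ^+ 2.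
  have := T2 _ _ r0a r0a'; rewrite (addrC r0) addrK => h; apply: le_trans h _.
  by rewrite /CT ler_wpM2r// lerDr.
have [i iI] := finset.set0Pn _ I0.
have rJ : J r0.
  apply: contrapT => /hJ; rewrite subrr normr0; apply/negP.
  by rewrite -ltNge divr_gt0.
have thNI i' : i' \notin I -> eta <= `|th 0 i' ^- 2 - dR mu c r0|.
  by move=> h; exact: heta hcl _ _ h rJ.
have colA (A : 'M[C]_(p, k)) x : l2norm ((columns A I)^t* *m x) = l2norm (restr I (A^t* *m x)).
  by rewrite columnsE adjmxM -mulmxA l2norm_restr.
have Gm := overlap_gram muB hc beta0 bmr br t0 kap0 eta0 CT0 hX UU VV th0 del0
  del1 thI gap0 gap1 thNI TP TT n0 un vn fn E1 E2.
have Rt := overlap_right muB hc beta0 bmr br kap0 hX UU VV del0 del1 thI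
  gap0 n0 un vn fn E1 E2.
split.
- rewrite colA -/n; set x := l2norm (restr I _) in Gm *.
  have -> : kl * n ^+ 2 - x ^+ 2 = - (kl / 2 * (gram mu c r0 theta0 * x ^+ 2 - 2 * n ^+ 2)).
    by rewrite klE; move: G0; generalize (gram mu c r0 theta0) => y y0; field; rewrite ?gt_eqF.
  rewrite normrN normrM (gtr0_norm (divr_gt0 kl0 _))//.
  apply: le_trans (ler_wpM2l (ltW (divr_gt0 kl0 _)) Gm) _ => //.
  rewrite [leLHS](_ : _ = kl / 2 * gram_const mu c r0 theta0 beta kap eta CT
    * (del * n ^+ 2)); last by ring.
  rewrite -[leRHS]mulrA; apply: ler_wpM2r.
    by apply: mulr_ge0; [exact: ltW|exact: sqr_ge0].
  by apply: le_trans (ler_norm _) _; rewrite /K lerDl.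
- rewrite !columnsE !adjmxM -!mulmxA scalemxAr -mulmxBr.
  rewrite -l2norm_restr restrB restrZ -/n; apply: le_trans Rt _.
  rewrite -[leRHS]mulrA; apply: ler_wpM2r.
    by apply: mulr_ge0 n0; exact: ltW.
  by apply: le_trans (ler_norm _) _; rewrite /K lerDr.
Qed.

(** With more than [#|I|] pairs, some combination of left vectors would be
   orthogonal to the columns of [U] in the cluster. *)
Lemma cluster_count_le : exists2 d0, 0 < d0 &
  forall J p q k (X : 'M[C]_(p, q)) U th (V : 'M[C]_(q, k)) I del,
    0 < del <= d0 -> clustered J X U th V I del -> I != finset.set0 ->
    (nb_singval (spiked X U V th) J <= #|I|)%N.
Proof.
have [K [d0 [K0 d00 H]]] := pairs_estimate.
have kl0 := kappaL_gt0 muB hc hedge htheta0.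
pose d1 := kappaL mu c theta0 / (K + 1) / 2.
have K1 : 0 < K + 1 by lra.
have d10 : 0 < d1 by apply: divr_gt0 => //; exact: divr_gt0.
exists (Num.min d0 d1); first by rewrite lt_min d00.
move=> J p q k X U th V I del /andP[del0]; rewrite le_min => /andP[h0 h1] hcl I0.
have J0 x : J x -> 0 < x.
  by case: hcl => JM _ _ _ /JM /andP[jx _]; exact: lt_le_trans jm0 jx.
have [Uh [Vh pr]] := paired_singular_ex (spiked X U V th) J0.
rewrite leqNgt nb_singvalE; apply/negP => lt.
have [a a0 Ba] := kernel_vector ((columns U I)^t* *m Uh) lt.
have dd : 0 < del <= d0 by rewrite del0.
have [E _] := H _ _ _ _ _ _ _ _ _ _ dd hcl I0 _ _ _ _ pr a.
move: E; rewrite mulmxA Ba l2norm0 expr0n subr0 normrM (gtr0_norm kl0).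
rewrite ger0_norm ?sqr_ge0// ler_pM2r ?exprn_gt0 ?l2norm_gt0//.
apply/negP; rewrite -ltNge.
apply: le_lt_trans (_ : K * d1 < _); first by rewrite ler_wpM2l.
rewrite /d1; move: kl0; generalize (kappaL mu c theta0) => kl kl0.
rewrite !mulrA ltr_pdivrMr// ltr_pdivrMr//.
by have := mulr_gt0 kl0 K1; have := mulr_ge0 (ltW kl0) K0; lra.
Qed.

(** With fewer singular values, some combination of the columns of [U] in the
   cluster would be orthogonal to all their left vectors. *)
Lemma cluster_count_ge : exists2 d0, 0 < d0 &
  forall J p q k (X : 'M[C]_(p, q)) U th (V : 'M[C]_(q, k)) I del,
    0 < del <= d0 -> clustered J X U th V I del -> I != finset.set0 ->
    (#|I| <= nb_singval (spiked X U V th) J)%N.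
Proof.
have [br dr] := rho_spec muB hc hedge htheta0.
have [d1 d10 loc] := cluster_location.
have r00 : 0 < r0 by exact: le_lt_trans br.
have ph0 := phiR_gt0 muB br; have pt0 := phitR_gt0 muB hc br.
pose Cz := 2 / (dl / 2) + 1 / r0.
have Cz0 : 0 <= Cz by rewrite addr_ge0// divr_ge0// ?divr_ge0// ltW.
pose Cs := (r0 + beta) * Cz.
have Cs0 : 0 <= Cs by rewrite mulr_ge0// addr_ge0// ltW.
pose Cr := ph * theta0 * pt * Cz + ph * theta0 * Cs + ph * Cz + Cs.
have Cr0 : 0 <= Cr.
  have a1 := mulr_ge0 (ltW (mulr_gt0 (mulr_gt0 ph0 t0) pt0)) Cz0.
  have a2 := mulr_ge0 (ltW (mulr_gt0 ph0 t0)) Cs0.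
  have a3 := mulr_ge0 (ltW ph0) Cz0.
  by rewrite /Cr; apply: addr_ge0 Cs0; apply: addr_ge0 a3; exact: addr_ge0.
have Cr1 : 0 < Cr + 1 by lra.
pose d2 := ph / (Cr + 1) / 2.
have d20 : 0 < d2 by apply: divr_gt0 => //; exact: divr_gt0.
exists (Num.min 1 (Num.min d1 d2)); first by rewrite !lt_min ltr01 d10.
move=> J p q k X U th V I del /andP[del0]; rewrite !le_min => /and3P[del1 h1 h2] hcl I0.
have dd : 0 < del <= d1 by rewrite del0.
have [r0J hJ] := loc _ _ _ _ _ _ _ _ _ _ dd hcl I0.
have [JM hX [UU VV] [th0 thI IJ sep gap]] := hcl.
have bmr : beta < r0 by case/andP: r0J => h _; have := bjm; lra.
set W := spiked X U V th; rewrite leqNgt nb_singvalE; apply/negP => lt.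
pose basis := (spectralmx (W *m W^t*))^t*.
have [s s0 Bs] := kernel_vector ((columns basis (sing_set W J))^t* *m columns U I) lt.
pose f := columns U I *m s.
have fn : l2norm f = l2norm s.
  by rewrite /f columnsE -mulmxA (isometryP _ UU) l2norm_sel.
have orth j : j \in sing_set W J -> (basis^t* *m f) j 0 = 0.
  move=> jJ; have : restr (sing_set W J) (basis^t* *m f) = 0.
    apply: l2norm_eq0; rewrite l2norm_restr mulmxA -adjmxM -columnsE /f.
    by rewrite mulmxA Bs l2norm0.
  move=> /(congr1 (fun v : 'cV_p => v j 0)); rewrite mxE jJ => ->; exact: mxE.
have dl20 : 0 < dl / 2 by rewrite divr_gt0.
have [u [v [e1 e2 zn]]] := bounded_response r00 dl20 hJ orth.
have gap0 : gap_at X U V (linM mu c k r0%:C) (del ^+ 2) r0.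
  by apply: gap; case/andP: r0J => g1 g2; rewrite g1 /= (le_trans g2)// lerDl.
rewrite fn -/Cz in zn.
have := forced_response muB hc beta0 bmr br t0 dr hX UU VV del0 del1 thI gap0
  Cz0 zn e1 e2.
rewrite -/Cs -/Cr mulrA ler_pM2r ?l2norm_gt0//; apply/negP; rewrite -ltNge.
apply: le_lt_trans (_ : Cr * d2 < _); first by rewrite ler_wpM2l.
rewrite /d2; move: ph0; generalize ph => x x0.
rewrite !mulrA ltr_pdivrMr// ltr_pdivrMr//.
by have := mulr_gt0 x0 Cr1; have := mulr_ge0 (ltW x0) Cr0; lra.
Qed.

Theorem deterministic_cluster : exists K d0, [/\ 0 <= K, 0 < d0 &
  forall J p q k (X : 'M[C]_(p, q)) U th (V : 'M[C]_(q, k)) I del,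
    0 < del <= d0 -> clustered J X U th V I del -> I != finset.set0 ->
    nb_singval (spiked X U V th) J = #|I| /\
    forall F (Uh : 'M[C]_(p, #|I|)) (Vh : 'M[C]_(q, #|I|)),
      paired_singular F (spiked X U V th) J Uh Vh ->
    forall a : 'cV[C]_#|I|,
      `|kappaL mu c theta0 * l2norm a ^+ 2
        - l2norm ((columns U I)^t* *m Uh *m a) ^+ 2| <= K * del * l2norm a ^+ 2
      /\ l2norm (((columns V I)^t* *m Vh
           - (pt * theta0)%:C *: ((columns U I)^t* *m Uh)) *m a)
         <= K * del * l2norm a].
Proof.
have [K [d0 [K0 d00 H]]] := pairs_estimate.
have [d1 d10 H1] := cluster_count_le.
have [d2 d20 H2] := cluster_count_ge.
exists K, (Num.min d0 (Num.min d1 d2)); split => //.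
  by rewrite !lt_min d00 d10.
move=> J p q k X U th V I del /andP[del0]; rewrite !le_min => /and3P[g0 g1 g2] hcl I0.
split.
  apply/eqP; rewrite eqn_leq; apply/andP; split.
  - by apply: H1 hcl I0; rewrite del0.
  - by apply: H2 hcl I0; rewrite del0.
move=> F Uh Vh pr a.
have dd : 0 < del <= d0 by rewrite del0.
have [E1 E2] := H _ _ _ _ _ _ _ _ _ _ dd hcl I0 _ _ _ _ pr a.
by split; [rewrite -mulmxA|rewrite mulmxBl -scalemxAl -!mulmxA].
Qed.

End deterministic_cluster.

(** * The polar factor *)

Section polar.
Context {R : realType}.
Local Notation C := R[i].

(** A diagonalisation of a real Hermitian matrix need not be real, but any
   function of the matrix is: the conjugate eigenbasis differs from the given
   one by a matrix commuting with the eigenvalues. *)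
Lemma functional_calculus_real q (H B : 'M[C]_q) (d g : 'rV[R]_q) :
  H^t* = H -> map_mx Num.conj H = H -> B *m B^t* = 1%:M ->
  H *m B = B *m scal d -> (forall i j, d 0 i = d 0 j -> g 0 i = g 0 j) ->
  map_mx Num.conj (B *m scal g *m B^t*) = B *m scal g *m B^t*.
Proof.
move=> HH Hr BB HB dg; pose B' := map_mx Num.conj B.
have scr (w : 'rV[R]_q) : map_mx Num.conj (scal w) = scal w.
  rewrite /scal map_diag_mx; congr diag_mx.
  by apply/matrixP => i j; rewrite !mxE; exact: (conjc_real (w i j)).
have conjK (A : 'M[C]_q) : map_mx Num.conj (map_mx Num.conj A) = A.
  by apply/matrixP => i j; rewrite !mxE conjCK.
have B'B' : B' *m B'^t* = 1%:M.
  have := congr1 (map_mx Num.conj) BB; rewrite map_mxM map_mx1 => <-.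
  by congr (_ *m _); rewrite /B' map_trmx.
have HB' : H *m B' = B' *m scal d.
  by have := congr1 (map_mx Num.conj) HB; rewrite !map_mxM Hr scr.
pose O := B'^t* *m B.
have OD : O *m scal d = scal d *m O.
  rewrite /O -mulmxA -HB mulmxA.
  have -> : B'^t* *m H = (B' *m scal d)^t* by rewrite -HB' adjmxM HH.
  by rewrite adjmxM scal_adj mulmxA.
have Og : O *m scal g = scal g *m O.
  apply/matrixP => i j; have := congr1 (fun M : 'M[C]_q => M i j) OD.
  rewrite !mul_mx_diag !mul_diag_mx !mxE mulrC => /eqP.
  rewrite -subr_eq0 -mulrBl mulf_eq0 => /orP[|/eqP ->]; last by rewrite mulr0 mul0r.
  by rewrite -rmorphB fmorph_eq0 subr_eq0 => /eqP /dg ->; rewrite mulrC.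
rewrite !map_mxM scr -/B'.
have -> : map_mx Num.conj (B^t*) = B'^t* by rewrite /B' map_trmx.
have B'E : B'^t* = O *m B^t* by rewrite /O -mulmxA BB mulmx1.
have BE : B = B' *m O by rewrite /O mulmxA B'B' mul1mx.
by rewrite B'E -mulmxA (mulmxA (scal g)) -Og {2}BE !mulmxA.
Qed.

Lemma sqrt_close (x k e : R) : 0 <= x -> 0 < k -> `|k - x| <= e ->
  `|Num.sqrt x - Num.sqrt k| <= e / Num.sqrt k.
Proof.
move=> x0 k0 h; have sk : 0 < Num.sqrt k by rewrite sqrtr_gt0.
have sx : 0 <= Num.sqrt x by exact: sqrtr_ge0.
rewrite ler_pdivlMr//; apply: le_trans h; rewrite distrC.
have -> : k - x = (Num.sqrt k - Num.sqrt x) * (Num.sqrt k + Num.sqrt x).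
  by rewrite -subr_sqr !sqr_sqrtr// ltW.
rewrite normrM ler_wpM2l//.
by rewrite ger0_norm ?lerDl// addr_ge0// ltW.
Qed.

(** [Q = A (A^* A)^(-1/2)].  The estimate is independent of the dimension, since
   it only concerns the eigenvalues of [A^* A]. *)
Lemma polar_factor F q (A : 'M[C]_q) (k e : R) : 0 < k -> 0 <= e < k ->
  entries_in F A ->
  (forall a, `|k * l2norm a ^+ 2 - l2norm (A *m a) ^+ 2| <= e * l2norm a ^+ 2) ->
  exists Q : 'M[C]_q, [/\ entries_in F Q, Q \is unitarymx &
    opnorm (A - (Num.sqrt k)%:C *: Q) <= e / Num.sqrt k].
Proof.
move=> k0 /andP[e0 ek] Ar hA.
pose H := A^t* *m A.
pose B := (spectralmx (A^t* *m A))^t*.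
have BsB : B^t* *m B = 1%:M by have := basis_isometry (A^t*); rewrite /B !trmxCK.
have BBs : B *m B^t* = 1%:M by have := basis_coisometry (A^t*); rewrite /B !trmxCK.
pose d : 'rV[R]_q := \row_j heigval (A^t* *m A) j.
have dE j : d 0 j = l2norm (A *m col j B) ^+ 2.
  by rewrite /d mxE; have := heigval_gram (A^t*) j; rewrite trmxCK.
have dk j : `|k - d 0 j| <= e.
  have := hA (col j B); have := basis_col (A^t*) j; rewrite trmxCK -/B => ->.
  by rewrite expr1n !mulr1 -dE.
have d0 j : 0 < d 0 j by have := dk j; rewrite ler_norml; lra.
have HB : H *m B = B *m scal d.
  have := gram_spectral (A^t*); rewrite trmxCK -/B -/H => ->.
  congr (_ *m _); apply/matrixP => i j; rewrite !mxE.
  by have := spectral_diag_real (A^t*) i; rewrite trmxCK => ->.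
pose g : 'rV[R]_q := \row_j (Num.sqrt (d 0 j))^-1.
pose h : 'rV[R]_q := \row_j Num.sqrt (d 0 j).
have sd0 j : Num.sqrt (d 0 j) != 0 by rewrite gt_eqF// sqrtr_gt0.
have scalM (u v w : 'rV[R]_q) : (forall j, u 0 j * v 0 j = w 0 j) ->
    scal u *m scal v = scal w.
  move=> uv; apply/matrixP => i j; rewrite /scal mul_diag_mx !mxE.
  by rewrite mulrnAr -rmorphM uv.
have scal1 : scal (\row__ 1) = 1%:M :> 'M[C]_q.
  by apply/matrixP => i j; rewrite !mxE.
pose T := B *m scal g *m B^t*; pose Q := A *m T.
have TT : T^t* = T by rewrite /T !adjmxM trmxCK scal_adj mulmxA.
have gdg : scal g *m scal d *m scal g = 1%:M.
  rewrite (scalM _ _ h); last first.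
    move=> j; rewrite [g 0 j]mxE [h 0 j]mxE -[X in _ * X](sqr_sqrtr (ltW (d0 j))) expr2.
    by rewrite mulKf ?sd0.
  rewrite (scalM _ _ (\row__ 1)) ?scal1// => j.
  by rewrite [h 0 j]mxE [g 0 j]mxE [RHS]mxE mulfV ?sd0.
have QQ : Q^t* *m Q = 1%:M.
  have -> : Q^t* *m Q = T *m (H *m T) by rewrite /Q adjmxM TT !mulmxA.
  have -> : H *m T = B *m (scal d *m (scal g *m B^t*)) by rewrite /T !mulmxA HB.
  rewrite /T -(mulmxA _ (B^t*)) (mulmxA (B^t*) B) BsB mul1mx.
  rewrite -mulmxA (mulmxA (scal g) (scal d)) (mulmxA (scal g *m _)) gdg.
  by rewrite mul1mx BBs.
exists Q; split.
- case: F Ar => // Ar i j.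
  have Ac : map_mx Num.conj A = A.
    apply/matrixP => a b; rewrite mxE; move: (Ar a b).
    by case: (A a b) => x y /= ->; rewrite /Num.conj /= oppr0.
  have Hr : map_mx Num.conj H = H by rewrite /H map_mxM -!map_trmx !Ac.
  have HH : H^t* = H by rewrite /H adjmxM trmxCK.
  have Tr : map_mx Num.conj T = T.
    apply: functional_calculus_real HH Hr BBs HB _.
    by move=> a b ab; rewrite [g 0 a]mxE [g 0 b]mxE ab.
  have : map_mx Num.conj Q = Q by rewrite /Q map_mxM Ac Tr.
  move=> /matrixP /(_ i j); rewrite mxE; case: (Q i j) => x y.
  by rewrite /Num.conj /= => -[] /eqP; rewrite eq_sym -addr_eq0 -mulr2n mulrn_eq0 => /= /eqP.
- by apply/unitarymxP; exact: mulmx1C QQ.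
have AE : A = Q *m (B *m scal h *m B^t*).
  rewrite /Q /T -!mulmxA (mulmxA (B^t*)) BsB mul1mx (mulmxA (scal g)).
  rewrite (scalM _ _ (\row__ 1)) => [|j]; last first.
    by rewrite [h 0 j]mxE [g 0 j]mxE [RHS]mxE mulVf ?sd0.
  by rewrite scal1 mul1mx BBs mulmx1.
clearbody Q.
pose w : 'rV[R]_q := \row_j (Num.sqrt (d 0 j) - Num.sqrt k).
apply: opnorm_le => [|a]; first by rewrite divr_ge0// sqrtr_ge0.
have -> : (A - (Num.sqrt k)%:C *: Q) *m a = Q *m (B *m (scal w *m (B^t* *m a))).
  have sw : scal w = scal h - (Num.sqrt k)%:C *: 1%:M.
    apply/matrixP => i j; rewrite !mxE rmorphB mulrnBl.
    by rewrite mulr_natr.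
  have wE : B *m (scal w *m B^t*) = B *m scal h *m B^t* - (Num.sqrt k)%:C *: 1%:M.
    by rewrite mulmxA sw mulmxBr mulmxBl -scalemxAr mulmx1 -scalemxAl BBs.
  have QE : Q *m (B *m scal h *m B^t* - (Num.sqrt k)%:C *: 1%:M) = A - (Num.sqrt k)%:C *: Q.
    by rewrite mulmxBr -scalemxAr mulmx1 -AE.
  by rewrite (mulmxA (scal w)) (mulmxA B) wE mulmxA QE.
rewrite (isometryP _ QQ) (isometryP _ BsB).
have <- : l2norm (B^t* *m a) = l2norm a by apply: isometryP; rewrite trmxCK.
apply: l2norm_diag; first by rewrite divr_ge0// sqrtr_ge0.
by move=> j; rewrite mxE; apply: sqrt_close => //; exact: ltW.
Qed.

End polar.

(** * Countable discretisation of random matrices *)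

Section countable_codes.
Context {d : measure_display} {T : measurableType d} {R : realType}.
Local Notation C := R[i].

Lemma measurable_code_comp (K : countType) (g : T -> K) (A : set K) :
  (forall k, measurable [set w | g w = k]) -> measurable [set w | A (g w)].
Proof.
move=> mg.
pose F (n : nat) : set T := if unpickle n is Some k then
  (if `[< A k >] then [set w | g w = k] else set0) else set0.
have -> : [set w | A (g w)] = \bigcup_n F n.
  apply/seteqP; split => [w Aw|w [n _]].
    exists (pickle (g w)); first exact: Logic.I.
    by rewrite /F pickleK asboolT.
  rewrite /F; case: unpickle => [k|//]; case: asboolP => // Ak /= gk.
  by rewrite gk.
apply: bigcupT_measurable => n; rewrite /F; case: unpickle => [k|//].
by case: asboolP => // _; exact: mg.
Qed.

Lemma measurable_fun_code (K : countType) (g : T -> K) (h : K -> R) :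
  (forall k, measurable [set w | g w = k]) -> measurable_fun setT (fun w => h (g w)).
Proof.
move=> mg _ Y mY; rewrite setTI.
exact: (@measurable_code_comp _ g [set k | Y (h k)]).
Qed.

Lemma measurable_floor_fiber (N : R) (x : T -> R) (m : int) :
  measurable_fun setT x -> measurable [set w | Num.floor (N * x w) = m].
Proof.
move=> mx.
have -> : [set w | Num.floor (N * x w) = m]
    = setT `&` (fun w => N * x w) @^-1` `[m%:~R, (m + 1)%:~R[%classic.
  rewrite setTI; apply/seteqP; split => w /=; rewrite in_itv/= -floor_eq.
    by move=> ->.
  by move=> /eqP.
apply: (measurable_realfun.measurable_funM (measurable_cst N) mx) => //.
Qed.

Definition round (N : nat) (z : C) : int * int :=
  (Num.floor (N%:R * complex.Re z), Num.floor (N%:R * complex.Im z)).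

Definition unround (N : nat) (m : int * int) : C :=
  (m.1%:~R / N%:R) +i* (m.2%:~R / N%:R).

Lemma round_close N z : (0 < N)%N ->
  cabs (z - unround N (round N z)) <= 2 / N%:R.
Proof.
move=> N0; have N0' : 0 < N%:R :> R by rewrite ltr0n.
have fl (x : R) : 0 <= x - (Num.floor (N%:R * x))%:~R / N%:R <= 1 / N%:R.
  have := floor_itv (N%:R * x); rewrite intrD => /andP[h1 h2].
  rewrite subr_ge0 lerBlDr -mulrDl ler_pdivrMr// ler_pdivlMr// (mulrC x) h1 /=.
  by rewrite addrC ltW.
case: z => x y; rewrite /unround /round /=.
have := fl x; have := fl y; set a := _ - _; set e := _ - _.
move=> /andP[a0 a1] /andP[e0 e1].
rewrite -[2 / _]ger0_norm ?divr_ge0// -sqrtr_sqr ler_wsqrtr//.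
rewrite (_ : 2 / N%:R = 1 / N%:R + 1 / N%:R :> R); last by rewrite -mulrDl.
move: a e (1 / N%:R) a0 a1 e0 e1 => a e f; nra.
Qed.

Definition grid_code (n N : nat) (M : nat -> nat -> C) : {ffun 'I_n * 'I_n -> int * int} :=
  [ffun ab : 'I_n * 'I_n => round N (M ab.1 ab.2)].

Definition grid_point (n N : nat) (c : {ffun 'I_n * 'I_n -> int * int}) (i j : nat) : C :=
  if insub i is Some i' then
    if insub j is Some j' then unround N (c (i', j')) else 0
  else 0.

Lemma grid_point_code n N M i j : (0 < N)%N -> (i < n)%N -> (j < n)%N ->
  cabs (M i j - grid_point N (grid_code n N M) i j) <= 2 / N%:R.
Proof.
move=> N0 ni nj; rewrite /grid_point !insubT /grid_code ffunE /=; exact: round_close.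
Qed.

Lemma measurable_grid_code n N (M : T -> nat -> nat -> C) :
  (forall i j, measurable_fun setT (fun w => complex.Re (M w i j))) ->
  (forall i j, measurable_fun setT (fun w => complex.Im (M w i j))) ->
  forall c, measurable [set w | grid_code n N (M w) = c].
Proof.
move=> mR mI c.
have -> : [set w | grid_code n N (M w) = c] =
    \bigcap_(ab in [set: 'I_n * 'I_n])
      ([set w | Num.floor (N%:R * complex.Re (M w ab.1 ab.2)) = (c ab).1] `&`
       [set w | Num.floor (N%:R * complex.Im (M w ab.1 ab.2)) = (c ab).2]).
  apply/seteqP; split => [w /= <- ab _|w h]; first by rewrite ffunE.
  apply/ffunP => ab; rewrite ffunE; have [/= h1 h2] := h ab Logic.I.
  by rewrite /round h1 h2; case: (c ab).
apply: fin_bigcap_measurable => [|ab _]; first exact: finite_finset.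
by apply: measurableI; apply: measurable_floor_fiber.
Qed.

End countable_codes.

(** * Measurable choice of the unitary matrix *)

Section near_best.
Context {R : realType}.
Local Notation C := R[i].

Definition near_best F q (k e : R) (B Q : 'M[C]_q) : Prop :=
  [/\ entries_in F Q, Q \is unitarymx & forall Q' : 'M[C]_q,
      entries_in F Q' -> Q' \is unitarymx ->
      opnorm (B - (Num.sqrt k)%:C *: Q) <= opnorm (B - (Num.sqrt k)%:C *: Q') + e].

Lemma entries_in1 F q : entries_in F (1%:M : 'M[C]_q).
Proof. by case: F => // i j; rewrite mxE; case: (i == j). Qed.

Lemma near_best_ex F q (k e : R) (B : 'M[C]_q) : 0 < e ->
  exists Q, near_best F k e B Q.
Proof.
move=> e0.
pose E : set R := [set x | exists Q : 'M[C]_q, [/\ entries_in F Q, Q \is unitarymx &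
  x = opnorm (B - (Num.sqrt k)%:C *: Q)]].
have Elb : lbound E 0 by move=> _ [Q [_ _ ->]]; exact: opnorm_ge0.
have Ei : has_inf E.
  split; last by exists 0.
  exists (opnorm (B - (Num.sqrt k)%:C *: 1%:M)), 1%:M; split => //.
    exact: entries_in1.
  by apply/unitarymxP; rewrite trmx1 map_mx1 mulmx1.
have [_ [Q [Qr Qu ->]] hQ] := inf_adherent e0 Ei.
exists Q; split => // Q' Q'r Q'u; apply: ltW; apply: lt_le_trans hQ _.
by rewrite lerD2r; apply: ge_inf; [exists 0|exists Q'].
Qed.

Definition best_unitary F q (k e : R) (B : 'M[C]_q) : 'M[C]_q :=
  xget 1%:M [set Q | near_best F k e B Q].

Lemma best_unitaryP F q (k e : R) (B : 'M[C]_q) : 0 < e ->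
  near_best F k e B (best_unitary F k e B).
Proof. by move=> e0; exact: xgetPex (near_best_ex F k B e0). Qed.

Lemma isometry_dim p q (Q : 'M[C]_(p, q)) : Q^t* *m Q = 1%:M -> (q <= p)%N.
Proof.
move=> QQ; rewrite -[X in (X <= _)%N](mxrank1 C q) -QQ.
exact: leq_trans (mulmx_max_rank _ _) (leqnn _).
Qed.

Lemma isometry_entry p q (Q : 'M[C]_(p, q)) i j : Q^t* *m Q = 1%:M ->
  cabs (Q i j) <= 1.
Proof.
move=> QQ; have := cabs_le_l2norm (col j Q) i.
rewrite mxE colE (isometryP _ QQ); move=> h; apply: le_trans h _.
apply: le_trans (l2norm_le_sum _) _; rewrite (bigD1 j)//= big1.
  by rewrite mxE !eqxx addr0 cabs_real normr1.
by move=> l lj; rewrite mxE (negbTE lj) cabs_real normr0.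
Qed.

Lemma entryE p q (A : 'M[C]_(p, q)) (i : 'I_p) (j : 'I_q) : entry A i j = A i j.
Proof. by rewrite /entry !valK. Qed.

Lemma cabs_conj (z : C) : cabs (Num.conj z) = cabs z.
Proof. by case: z => x y; rewrite /cabs /Num.conj /= sqrrN. Qed.

(** The matrix [(columns U I)^* Uh], computed from the discretised entries. *)
Definition approx_overlap n N (t : {r : nat & {set 'I_r}})
    (cU cH : {ffun 'I_n * 'I_n -> int * int}) : 'M[C]_#|tagged t| :=
  \matrix_(i, j) \sum_(l < n)
    (Num.conj (grid_point N cU l (@enum_val _ (mem (tagged t)) i)) * grid_point N cH l j).

Lemma approx_overlap_close n N r (U : 'M[C]_(n, r)) (I : {set 'I_r})
    (Uh : 'M[C]_(n, #|I|)) : (0 < N)%N ->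
  U^t* *m U = 1%:M -> Uh^t* *m Uh = 1%:M ->
  opnorm ((columns U I)^t* *m Uh
    - approx_overlap N (Tagged (fun r => {set 'I_r}) I)
        (grid_code n N (entry U)) (grid_code n N (entry Uh)))
  <= (n * n)%:R * (n%:R * (8 / N%:R)).
Proof.
move=> N0 UU HH; have N0' : 0 < N%:R :> R by rewrite ltr0n.
have In := isometry_dim HH; have rn := isometry_dim UU.
have N2 : 0 <= 2 / N%:R :> R by rewrite divr_ge0// ltW.
have N1 : 2 / N%:R <= 2 :> R by rewrite ler_pdivrMr// ler_peMr// ler1n.
apply: le_trans (opnorm_le_entries (a := n%:R * (8 / N%:R)) _ _) _.
- by rewrite mulr_ge0// divr_ge0// ltW.
- move=> i j; rewrite !mxE -sumrB.
  apply: le_trans (_ : \sum_(l < n) 8 / N%:R <= _); last first.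
    by rewrite sumr_const card_ord -[leLHS]mulr_natl lexx.
  elim/big_ind2: _ => [|x x' y y' hx hy|l _].
  + by rewrite /cabs /= !expr0n addr0 sqrtr0.
  + by apply: le_trans (cabsD _ _) _; exact: lerD.
  rewrite !mxE -!entryE.
  set a := entry U _ _; set e := entry Uh _ _.
  set a' := grid_point _ _ _ _; set e' := grid_point _ _ _ _.
  have ha : cabs (a - a') <= 2 / N%:R.
    by apply: grid_point_code => //; exact: leq_trans rn.
  have he : cabs (e - e') <= 2 / N%:R.
    by apply: grid_point_code => //; exact: leq_trans In.
  have a1 : cabs a <= 1 by rewrite /a entryE; exact: isometry_entry.
  have e1 : cabs e <= 1 by rewrite /e entryE; exact: isometry_entry.
  have e'3 : cabs e' <= 3.
    rewrite (_ : e' = e - (e - e')); last by ring.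
    apply: le_trans (cabsD _ _) _; rewrite (_ : cabs (- (e - e')) = cabs (e - e')).
      by lra.
    by rewrite -[LHS]normcN opprK.
  rewrite (_ : _ - _ = Num.conj a * (e - e') + Num.conj (a - a') * e'); last first.
    by rewrite rmorphB; ring.
  apply: le_trans (cabsD _ _) _; rewrite !cabsM !cabs_conj.
  have h1 := ler_pM (cabs_ge0 a) (cabs_ge0 (e - e')) a1 he.
  have h2 := ler_pM (cabs_ge0 (a - a')) (cabs_ge0 e') ha e'3.
  by apply: le_trans (lerD h1 h2) _; lra.
- rewrite ler_wpM2r ?mulr_ge0 ?divr_ge0 ?(ltW N0')//.
  by rewrite ler_nat leq_mul.
Qed.

End near_best.

Section selection_of_unitary.
Context {d : measure_display} {T : measurableType d} {R : realType}.
Local Notation C := R[i].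

Lemma tagged_set_eq (t t' : {r : nat & {set 'I_r}}) :
  (tag t = tag t' /\ forall k : nat,
    (exists2 i, i \in tagged t & nat_of_ord i = k) <->
    (exists2 i, i \in tagged t' & nat_of_ord i = k)) -> t = t'.
Proof.
case: t t' => r S [r' S'] /= [e]; subst r' => h; congr existT.
apply/setP => i; apply/idP/idP => iS.
- have /h [j jS /ord_inj <-] : exists2 j, j \in S & nat_of_ord j = i by exists i.
  by [].
- have /h [j jS /ord_inj <-] : exists2 j, j \in S' & nat_of_ord j = i by exists i.
  by [].
Qed.

Lemma measurable_tagged_fiber (r : T -> nat) (Cl : forall w, {set 'I_(r w)}) :
  (forall k, measurable [set w | r w = k]) -> random_index_set Cl ->
  forall t, measurable [set w | Tagged (fun r => {set 'I_r}) (Cl w) = t].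
Proof.
move=> mr mC t.
pose M (k : nat) := [set w | exists2 i, i \in Cl w & nat_of_ord i = k].
pose E (k : nat) : set T :=
  if `[< exists2 i, i \in tagged t & nat_of_ord i = k >] then M k else ~` M k.
have -> : [set w | Tagged (fun r => {set 'I_r}) (Cl w) = t]
    = [set w | r w = tag t] `&` \bigcap_k E k.
  apply/seteqP; split => [w /= tE|w [/= rt h] /=].
    split=> [|k _]; first by rewrite -tE.
    by rewrite /E; case: asboolP; rewrite -tE /= => h; exact: h.
  apply: (@tagged_set_eq (Tagged (fun r => {set 'I_r}) (Cl w)) t); split => // k; have := h k Logic.I; rewrite /E.
  by case: asboolP => h1 h2; split => // h3.
apply: measurableI; first exact: mr.
apply: bigcapT_measurable => k; rewrite /E; case: asboolP => _.
  exact: mC.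
by apply: measurableC; exact: mC.
Qed.

Lemma three_errors (x y : R) : y + (y + x + y) = x + (y + y + y).
Proof. by ring. Qed.

(** A near-optimal unitary matrix can be selected measurably, since it may be
   made to depend on the data only through a countable discretisation. *)
Lemma measurable_best_unitary (F : base_field) (k : R) (n : nat) (r : T -> nat)
    (U : forall w, 'M[C]_(n, r w)) (Cl : forall w, {set 'I_(r w)})
    (Uh : forall w, 'M[C]_(n, #|Cl w|)) :
  random_mx (p := fun=> n) U -> random_index_set Cl -> random_mx (p := fun=> n) Uh ->
  exists Q : forall w, 'M[C]_#|Cl w|,
    [/\ random_mx Q, forall w, entries_in F (Q w) /\ Q w \is unitarymx &
      forall w, (U w)^t* *m U w = 1%:M -> (Uh w)^t* *m Uh w = 1%:M ->
      forall Q' : 'M[C]_#|Cl w|, entries_in F Q' -> Q' \is unitarymx ->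
        opnorm ((columns (U w) (Cl w))^t* *m Uh w - (Num.sqrt k)%:C *: Q w)
        <= opnorm ((columns (U w) (Cl w))^t* *m Uh w - (Num.sqrt k)%:C *: Q')
           + 3 / n.+1%:R].
Proof.
move=> [mn mr mUR mUI] mC [_ mq mHR mHI].
pose N := (8 * n.+1 ^ 4)%N.
have N0 : (0 < N)%N by rewrite muln_gt0 expn_gt0.
pose e : R := 1 / n.+1%:R.
have e0 : 0 < e by rewrite divr_gt0// ltr0n.
pose K : countType := ({r : nat & {set 'I_r}} *
  ({ffun 'I_n * 'I_n -> int * int} * {ffun 'I_n * 'I_n -> int * int}))%type.
pose f (x : K) : 'M[C]_#|tagged x.1| :=
  best_unitary F k e (approx_overlap N x.1 x.2.1 x.2.2).
pose g (w : T) : K := (Tagged (fun r => {set 'I_r}) (Cl w),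
  (grid_code n N (entry (U w)), grid_code n N (entry (Uh w)))).
have mg x : measurable [set w | g w = x].
  case: x => t [c1 c2].
  have -> : [set w | g w = (t, (c1, c2))]
    = [set w | Tagged (fun r => {set 'I_r}) (Cl w) = t] `&`
      ([set w | grid_code n N (entry (U w)) = c1] `&`
       [set w | grid_code n N (entry (Uh w)) = c2]).
    by apply/seteqP; split => [w /= [<- <- <-]//|w /= [<- [<- <-]]].
  apply: measurableI; first exact: measurable_tagged_fiber.
  by apply: measurableI; apply: measurable_grid_code.
exists (fun w => f (g w)); split.
- split.
  + move=> j; exact: (@measurable_code_comp _ _ _ g (fun x => #|tagged x.1| = j) mg).
  + move=> j; exact: (@measurable_code_comp _ _ _ g (fun x => #|tagged x.1| = j) mg).
  + move=> i j.
    exact: (@measurable_fun_code _ _ _ _ g (fun x => complex.Re (entry (f x) i j)) mg).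
  + move=> i j.
    exact: (@measurable_fun_code _ _ _ _ g (fun x => complex.Im (entry (f x) i j)) mg).
- move=> w; have [h1 h2 _] := best_unitaryP F k
    (approx_overlap N (g w).1 (g w).2.1 (g w).2.2) e0.
  by split.
move=> w UU HH Q' Q'r Q'u.
have [_ _ h] := best_unitaryP F k (approx_overlap N (g w).1 (g w).2.1 (g w).2.2) e0.
have close := approx_overlap_close N0 UU HH.
have small : (n * n)%:R * (n%:R * (8 / N%:R)) <= e.
  have -> : N%:R = 8 * n.+1%:R ^+ 4 :> R by rewrite natrM natrX.
  rewrite natrM /e; have xm : n%:R <= n.+1%:R :> R by rewrite ler_nat.
  have x0 : 0 <= n%:R :> R by [].
  have m0 : 0 < n.+1%:R :> R by rewrite ltr0n.
  move: (n%:R) (n.+1%:R) xm x0 m0 => x m xm x0 m0.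
  rewrite (_ : x * x * (x * (8 / (8 * m ^+ 4))) = (x / m) ^+ 3 * (1 / m)).
    rewrite ler_piMl ?divr_ge0 ?(ltW m0)// exprn_ile1 ?divr_ge0 ?(ltW m0)//.
    by rewrite ler_pdivrMr// mul1r.
  by field; rewrite gt_eqF.
have c1 := le_trans close small.
have tri (A B Z : 'M[C]_#|Cl w|) : opnorm (A - Z) <= opnorm (A - B) + opnorm (B - Z).
  by rewrite -{1}(subrK B A) -addrA; exact: opnormD.
have sym (A B : 'M[C]_#|Cl w|) : opnorm (A - B) <= opnorm (B - A).
  by apply: opnorm_le => [|v]; rewrite ?opnorm_ge0// -opprB mulNmx l2normN opnormP.
have h1 := h Q' Q'r Q'u.
have -> : 3 / n.+1%:R = e + e + e by rewrite /e -!mulrDl; congr (_ / _); ring.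
apply: le_trans (tri _ (approx_overlap N (g w).1 (g w).2.1 (g w).2.2) _) _.
apply: le_trans (lerD c1 h1) _.
apply: le_trans (lerD (lexx e) (lerD (tri _ ((columns (U w) (Cl w))^t* *m Uh w) _) (lexx e))) _.
apply: le_trans (lerD (lexx e) (lerD (lerD (le_trans (sym _ _) c1) (lexx _)) (lexx e))) _.
by rewrite le_eqVlt three_errors eqxx.
Qed.

End selection_of_unitary.

(** * Events of probability tending to one *)

Section high_probability.
Context {d : measure_display} {T : measurableType d} {R : realType}.
Variable Pr : probability T R.

Lemma whp_mono (A B : nat -> T -> Prop) :
  (forall n w, A n w -> B n w) -> whp Pr A -> whp Pr B.
Proof. by move=> AB [E [mE EA cE]]; exists E; split => // n w /EA /AB. Qed.

Lemma whp_near (A B : nat -> T -> Prop) :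
  (\forall n \near \oo, forall w, A n w -> B n w) -> whp Pr A -> whp Pr B.
Proof.
move=> [n0 _ AB] [E [mE EA cE]].
exists (fun n => if (n0 <= n)%N then E n else set0); split.
- by move=> n; case: ifP.
- by move=> n w; case: ifP => // nn /EA; exact: AB.
- apply: cvg_trans cE; apply: near_eq_cvg; exists n0 => // n /= nn.
  by rewrite nn.
Qed.

Lemma probability_fine (A : set T) : measurable A -> Pr A = (fine (Pr A))%:E.
Proof. by move=> mA; rewrite fineK// fin_num_measure. Qed.

Lemma probabilityI_ge (A B : set T) : measurable A -> measurable B ->
  fine (Pr A) + fine (Pr B) - 1 <= fine (Pr (A `&` B)).
Proof.
move=> mA mB; have mAB := measurableI _ _ mA mB; have mD := measurableD mA mB.
have e1 : Pr A = (Pr (A `\` B) + Pr (A `&` B))%E by exact: measureDI.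
have e2 : Pr (~` B) = (1 - Pr B)%E by exact: probability_setC.
have e3 : (Pr (A `\` B) <= Pr (~` B))%E.
  by apply: le_measure; rewrite ?inE//; exact: measurableC.
move: e1 e2 e3; rewrite (probability_fine mA) (probability_fine mAB).
rewrite (probability_fine mD) (probability_fine (measurableC mB)) (probability_fine mB).
rewrite -EFinD -EFinB lee_fin => -[e1] [e2] e3; move: e1 e2 e3 => /=.
by move: (fine _) (fine _) (fine _) (fine _) (fine _) => *; lra.
Qed.

Lemma whp_and (A B : nat -> T -> Prop) :
  whp Pr A -> whp Pr B -> whp Pr (fun n w => A n w /\ B n w).
Proof.
move=> [E [mE EA cE]] [F [mF FB cF]].
have mEF n : measurable (E n `&` F n) by exact: measurableI.
exists (fun n => E n `&` F n); split => //.
  by move=> n w [/EA ? /FB].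
have cE' : fine (Pr (E n)) @[n --> \oo] --> (1 : R) by exact: fine_cvg cE.
have cF' : fine (Pr (F n)) @[n --> \oo] --> (1 : R) by exact: fine_cvg cF.
have -> : (fun n => Pr (E n `&` F n)) = (fun n => (fine (Pr (E n `&` F n)))%:E).
  by apply/funext => n; exact: probability_fine.
apply: cvg_EFin; first by near=> n.
apply: (@squeeze_cvgr _ _ _ _ (fun n => fine (Pr (E n)) + fine (Pr (F n)) - 1)
  (fun=> 1)).
- near=> n; rewrite probabilityI_ge//= -lee_fin -probability_fine//.
  exact: probability_le1.
- rewrite [X in _ --> X](_ : 1 = 1 + 1 - 1); last by ring.
  by apply: cvgB; [exact: cvgD|exact: cvg_cst].
- exact: cvg_cst.
Unshelve. all: by end_near. Qed.

End high_probability.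

(** * The local law on a real segment *)

Section real_axis.
Context {R : realType}.
Local Notation C := R[i].

Lemma continuous_real_complex : continuous (fun x : R => x%:C : C^o).
Proof.
move=> x; apply/cvgrPdist_lt => e; rewrite ltcE => /andP[/eqP ie re].
near=> y; rewrite -rmorphB normc_def /= expr0n addr0 sqrtr_sqr.
rewrite ltcE /= ie eqxx /=; near: y.
by exists (complex.Re e) => /=.
Unshelve. all: by end_near. Qed.

Definition real_segment (a e : R) : set C^o := [set x%:C | x in `[a, e]%classic].

Lemma compact_real_segment (a e : R) : compact (real_segment a e).
Proof.
apply: continuous_compact; last exact: segment_compact.
by apply: continuous_subspaceT; exact: continuous_real_complex.
Qed.

Lemma real_segment_off_cut (b a e : R) : 0 <= b -> b < a ->
  real_segment a e `<=` ~` cut_segment b.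
Proof.
move=> b0 ba _ [x xa <-] [_]; move: xa; rewrite /= in_itv/= => /andP[ax _].
by rewrite ler_norml; lra.
Qed.

Lemma law_gap_at (mu : {measure set R -> \bar R}) (c : R) p q k
    (X : 'M[C]_(p, q)) (U : 'M[C]_(p, k)) (V : 'M[C]_(q, k)) (a b eps : R) :
  (law_gap mu c X U V (real_segment a b) <= eps%:E)%E ->
  forall x, a <= x <= b -> gap_at X U V (linM mu c k x%:C) eps x.
Proof.
move=> h x xab.
have : ((if `[< resolvent_defined X x%:C >] then
   (opnorm (linG X U V x%:C - linM mu c k x%:C))%:E else +oo) <= eps%:E)%E.
  apply: le_trans h; apply: ereal_sup_ubound.
  by exists x%:C => //; exists x => //=; rewrite in_itv.
case: asboolP => [ux|_]; last by rewrite leNgt ltry.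
rewrite lee_fin => hx; split => // y; rewrite -mulmxBl.
by apply: le_trans (opnormP _ _) _; rewrite ler_wpM2r ?l2norm_ge0.
Qed.

Lemma opnorm_dim0 p q (A : 'M[C]_(p, q)) : q = 0 -> opnorm A = 0.
Proof. by move=> q0; subst q; exact: opnorm_eq0_dim. Qed.

End real_axis.

(** * Passage to probability *)

Section entries.
Context {R : realType}.
Local Notation C := R[i].

Lemma entries_inM F p q r (A : 'M[C]_(p, q)) (B : 'M[C]_(q, r)) :
  entries_in F A -> entries_in F B -> entries_in F (A *m B).
Proof.
case: F => //= hA hB i j; rewrite mxE Im_sum big1// => l _.
by move: (hA i l) (hB l j); case: (A i l) (B l j) => a a' [e e'] /= -> ->; ring.
Qed.

Lemma entries_in_adj F p q (A : 'M[C]_(p, q)) :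
  entries_in F A -> entries_in F (A^t*).
Proof.
case: F => //= hA i j; rewrite !mxE; move: (hA j i).
by case: (A j i) => a a' /= ->; rewrite oppr0.
Qed.

Lemma entries_in_columns F p q (A : 'M[C]_(p, q)) (I : {set 'I_q}) :
  entries_in F A -> entries_in F (columns A I).
Proof. by case: F => //= hA i j; rewrite mxE. Qed.

Lemma opnormZ_le p q (a : R) (A : 'M[C]_(p, q)) : 0 <= a ->
  opnorm (a%:C *: A) <= a * opnorm A.
Proof.
move=> a0; apply: opnorm_le => [|v]; first by rewrite mulr_ge0// opnorm_ge0.
by rewrite -scalemxAl l2normZ ger0_norm// -mulrA ler_wpM2l// opnormP.
Qed.

End entries.

Lemma small_parameter (R : realType) (K b1 sk kl d0 e : R) :
  0 <= K -> 0 < b1 -> 0 < sk -> 0 < kl -> 0 < d0 -> 0 < e ->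
  exists del, [/\ 0 < del <= d0, 0 <= K * del < kl, K * del / sk <= e / 4 &
    K * del + b1 * (K * del / sk) <= e / 4].
Proof.
move=> K0 b10 sk0 kl0 d00 e0.
have Ks : 0 <= K / sk by rewrite divr_ge0// ltW.
pose B := K / sk + K + b1 * (K / sk) + 1.
have bK : 0 <= b1 * (K / sk) by rewrite mulr_ge0// ltW.
have B0 : 0 < B by rewrite /B; lra.
have K1 : 0 < K + 1 by lra.
pose del := Num.min d0 (Num.min (e / (4 * B)) (kl / (K + 1) / 2)).
have del0 : 0 < del.
  rewrite !lt_min d00 /=; apply/andP; split.
    by apply: divr_gt0 => //; exact: mulr_gt0.
  by apply: divr_gt0 => //; exact: divr_gt0.
have : del <= del by []. rewrite {2}/del !le_min => /and3P[h1 h2 h3].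
have Bd : B * del <= e / 4.
  move: h2; rewrite ler_pdivlMr ?mulr_gt0// => h2; lra.
exists del; split.
- by rewrite del0.
- rewrite mulr_ge0 ?(ltW del0)//=.
  move: h3; rewrite -mulrA -invfM ler_pdivlMr ?mulr_gt0// => h3; nra.
- rewrite mulrAC; apply: le_trans Bd; rewrite ler_pM2r// /B; lra.
- rewrite (_ : K * del + b1 * (K * del / sk) = (K + b1 * (K / sk)) * del); last by ring.
  by apply: le_trans Bd; rewrite ler_pM2r// /B; lra.
Qed.

Lemma tail_bound (R : realType) (b1 e : R) (n : nat) : 0 < b1 -> 0 < e ->
  3 * (1 + b1) / (e / 2) <= n%:R -> 3 / n.+1%:R * (1 + b1) < e / 2.
Proof.
move=> b10 e0; rewrite ler_pdivrMr ?divr_gt0// => nb.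
rewrite mulrAC ltr_pdivrMr ?ltr0n// -[n.+1]addn1 natrD mulrDr mulr1.
by move: nb; rewrite mulrC; generalize (e / 2 * n%:R) => x; lra.
Qed.

Lemma midpoint_bound (R : realType) (x a j : R) :
  `|x - a| < (j - a) / 2 -> x <= (a + j) / 2.
Proof. by rewrite ltr_norml => /andP[_ h]; lra. Qed.

Lemma total_error_left (R : realType) (x y b1 e : R) : 0 < b1 -> 0 < e -> 0 < y ->
  x <= e / 4 -> y * (1 + b1) < e / 2 -> x + y < e.
Proof. by move=> b10 e0 y0 h1 h2; have := mulr_gt0 b10 y0; lra. Qed.

Lemma total_error_right (R : realType) (k x y b1 e : R) : 0 < e -> 0 < y ->
  k + b1 * x <= e / 4 -> y * (1 + b1) < e / 2 -> k + b1 * (x + y) < e.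
Proof. by move=> e0 y0 h1 h2; lra. Qed.

Theorem corollary3p10
  (R : realType) (F : base_field)
  (d : measure_display) (T : measurableType d) (Pr : probability T R)
  (m : nat -> nat) (c : R)
  (hm : forall n, (n <= m n)%N) (hc : 0 < c <= 1)
  (hmc : (n%:R / (m n)%:R : R) @[n --> \oo] --> c)
  (X P : forall n, T -> 'M[R[i]]_(n, m n))
  (hX : forall n, random_mx (p := fun=> n) (q := fun=> m n) (X n))
  (hXF : forall n w, entries_in F (X n w))
  (r : nat -> T -> nat)
  (U : forall n w, 'M[R[i]]_(n, r n w))
  (theta : forall n w, 'rV[R]_(r n w))
  (V : forall n w, 'M[R[i]]_(m n, r n w))
  (hU : forall n, random_mx (p := fun=> n) (U n))
  (htheta : forall n, random_mx (p := fun=> 1%N) (fun w => cmx (theta n w)))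
  (hV : forall n, random_mx (p := fun=> m n) (V n))
  (hrank : forall n w, \rank (P n w) = r n w)
  (hsvd : forall n w, thin_svd F (P n w) (U n w) (theta n w) (V n w))
  (mu : probability R R)
  (hnoise : global_noise_law Pr mu X)
  (hedge : edge_condition mu c)
  (hlaw : subspace_local_law Pr mu c X U V)
  (J : set R) (N : nat) (Gamma : 'I_N -> R -> R[i]^o)
  (hJ : stable_union Pr mu c theta J Gamma)
  (Cl : forall n w, {set 'I_(r n w)})
  (hC : forall n, random_index_set (Cl n))
  (hCJ : whp Pr (fun n w =>
     forall i, (i \in Cl n w) <-> J (rho mu c (theta n w 0 i))))
  (hcompat : exists K : set R[i]^o,
     [/\ compact K, K `<=` ~` cut_segment (bulk_edge mu),
         contour_set Gamma `<=` K° &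
         weighted_compatibility Pr mu c X U theta V K])
  (theta0 : R) (htheta0 : theta_star mu c < theta0)
  (hcluster : cvg_in_prob Pr
     (fun n w => \big[Num.max/0]_(i in Cl n w) `|theta n w 0 i - theta0|) 0)
  (Uh : forall n w, 'M[R[i]]_(n, #|Cl n w|))
  (Vh : forall n w, 'M[R[i]]_(m n, #|Cl n w|))
  (hUh : forall n, random_mx (p := fun=> n) (Uh n))
  (hVh : forall n, random_mx (p := fun=> m n) (Vh n))
  (hpair : forall n w, nb_singval (X n w + P n w) J = #|Cl n w| ->
     paired_singular F (X n w + P n w) J (Uh n w) (Vh n w)) :
  exists Q : forall n w, 'M[R[i]]_#|Cl n w|,
    [/\ forall n, random_mx (Q n),
        forall n w, entries_in F (Q n w) /\ Q n w \is unitarymx,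
        cvg_in_prob Pr (fun n w =>
          opnorm ((columns (U n w) (Cl n w))^t* *m Uh n w
                  - (Num.sqrt (kappaL mu c theta0))%:C *: Q n w)) 0 &
        cvg_in_prob Pr (fun n w =>
          opnorm ((columns (V n w) (Cl n w))^t* *m Vh n w
                  - (Num.sqrt (kappaR mu c theta0))%:C *: Q n w)) 0].
Proof.
have [mass cpt _ opn] := hnoise.
have muB := bulk_mass mass cpt.
have [hJu [dl dl0 hsep] _ _ _] := hJ.
have [jm [jM [bj jj JM]]] := interval_union_bounds hJu.
have b0 := bulk_edge_ge0 mu.
have [K [d0 [K0 d00 hdet]]] := deterministic_cluster muB hc hedge htheta0 bj jj dl0.
have kl0 := kappaL_gt0 muB hc hedge htheta0.
have [br _] := rho_spec muB hc hedge htheta0.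
have t0 : 0 < theta0 := lt_trans (theta_star_gt0 hedge) htheta0.
have skR := sqrt_kappaR muB hc hedge htheta0.
set kl := kappaL mu c theta0 in kl0 hdet skR *.
set b1 := phitR mu c (rho mu c theta0) * theta0 in hdet skR *.
have b10 : 0 < b1 by apply: mulr_gt0 t0; exact: phitR_gt0.
have sk0 : 0 < Num.sqrt kl by rewrite sqrtr_gt0.
have hQ n := measurable_best_unitary F kl (hU n) (hC n) (hUh n).
pose Q n := projT1 (cid (hQ n)).
have QP n := projT2 (cid (hQ n)).
suff key (e : R) : 0 < e -> whp Pr (fun n w =>
    opnorm ((columns (U n w) (Cl n w))^t* *m Uh n w - (Num.sqrt kl)%:C *: Q n w) < e
    /\ opnorm ((columns (V n w) (Cl n w))^t* *m Vh n w
         - (Num.sqrt (kappaR mu c theta0))%:C *: Q n w) < e).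
  exists Q; split.
  - by move=> n; case: (QP n).
  - by move=> n w; have [_ h _] := QP n; exact: h.
  - move=> e /key; apply: whp_mono => n w [h _].
    by rewrite subr0 ger0_norm ?opnorm_ge0.
  - move=> e /key; apply: whp_mono => n w [_ h].
    by rewrite subr0 ger0_norm ?opnorm_ge0.
move=> e0.
have [del [/andP[del0 deld] Kdel Ks Kb]] := small_parameter K0 b10 sk0 kl0 d00 e0.
have del20 : 0 < del ^+ 2 by rewrite exprn_gt0.
have [eps [epsc hgap]] := hlaw _ (compact_real_segment (a := jm) (e := jM + 1))
  (real_segment_off_cut b0 bj).
have half : 0 < (jm - bulk_edge mu) / 2 by rewrite divr_gt0// subr_gt0.
have EE := whp_and (whp_and (opn _ half) (hcluster _ del0))
  (whp_and hgap (whp_and hsep hCJ)).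
move: EE; apply: whp_near.
near=> n.
have epsn : eps n <= del ^+ 2 by near: n; exact: cvgr_le epsc _ del20.
have nn : 3 / n.+1%:R * (1 + b1) < e / 2.
  by apply: tail_bound => //; near: n; exact: nbhs_infty_ger.
move=> w [[hX1 hcl] [hg [hs hCJw]]].
have [C0|C0] := eqVneq (Cl n w) finset.set0.
  have c0 : #|Cl n w| = 0%N by rewrite C0 cards0.
  by split; rewrite (opnorm_dim0 _ c0).
have [[_ UU] [_ VV] _ th0 PE] := hsvd n w.
have hcl' i : i \in Cl n w -> `|theta n w 0 i - theta0| <= del.
  move=> iC; apply: ltW; apply: le_lt_trans hcl; rewrite subr0.
  apply: le_trans (ler_norm _).
  exact: (le_bigmax_cond 0 (fun i => `|theta n w 0 i - theta0|) iC).
have hX2 v : l2norm (X n w *m v) <= (bulk_edge mu + jm) / 2 * l2norm v.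
  apply: le_trans (opnormP _ _) _; rewrite ler_wpM2r ?l2norm_ge0//.
  exact: midpoint_bound hX1.
have hgap' x : jm <= x <= jM + 1 ->
    gap_at (X n w) (U n w) (V n w) (linM mu c (r n w) x%:C) (del ^+ 2) x.
  by apply: law_gap_at; apply: le_trans hg _; rewrite lee_fin.
have config : clustered mu c theta0 jm jM dl J (X n w) (U n w) (theta n w) (V n w)
    (Cl n w) del by split.
have dd : 0 < del <= d0 by rewrite del0.
have [nb pr] := hdet _ _ _ _ _ _ _ _ _ _ dd config C0.
have WE : spiked (X n w) (U n w) (V n w) (theta n w) = X n w + P n w by rewrite PE.
rewrite WE in nb pr.
have hp := hpair n w nb.
have est := pr _ _ _ hp.
have [[Uhr UhI] [Vhr VhI] _] := hp.
have [[Ur _] [Vr _] _ _ _] := hsvd n w.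
set A := (columns (U n w) (Cl n w))^t* *m Uh n w in est *.
set B := (columns (V n w) (Cl n w))^t* *m Vh n w in est *.
have Ar : entries_in F A.
  by apply: entries_inM Uhr; apply: entries_in_adj; exact: entries_in_columns.
have [Q0 [Q0r Q0u Q0A]] := polar_factor kl0 Kdel Ar (fun a => (est a).1).
have [_ _ best] := QP n.
have AQ := best w UU UhI Q0 Q0r Q0u.
rewrite -/A in AQ.
have n3 : 0 < 3 / n.+1%:R :> R by rewrite divr_gt0// ltr0n.
have A1 : opnorm (A - (Num.sqrt kl)%:C *: Q n w) <= K * del / Num.sqrt kl + 3 / n.+1%:R.
  by apply: le_trans AQ _; rewrite lerD2r.
have Kd0 : 0 <= K * del by case/andP: Kdel.
split.
  exact: le_lt_trans A1 (total_error_left b10 e0 n3 Ks nn).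
have -> : B - (Num.sqrt (kappaR mu c theta0))%:C *: Q n w
    = (B - b1%:C *: A) + b1%:C *: (A - (Num.sqrt kl)%:C *: Q n w).
  by rewrite skR scalerBr scalerA -rmorphM addrA subrK.
apply: le_lt_trans (opnormD _ _) _.
have B1 : opnorm (B - b1%:C *: A) <= K * del.
  by apply: opnorm_le => // a; case: (est a).
have A2 := le_trans (opnormZ_le _ (ltW b10)) (ler_wpM2l (ltW b10) A1).
exact: le_lt_trans (lerD B1 A2) (total_error_right e0 n3 Kb nn).
Unshelve. all: by end_near. Qed.
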